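(* Let $(\mathbf u_h,p_h,\mathbf E_h,\mathbf B_h)\in\mathbf W_h\times Q_h\times\mathbf V_h^{\mathrm{edge}}\times\mathbf V_h^{\mathrm{face}}$ be the solution of the semi-discrete virtual element scheme described in the context. Then $$\mathbf B_{h,t}+\mathbf{curl}\,\mathbf E_h=\mathbf 0,\qquad \mathrm{div}\,\mathbf u_h=0\qquad\text{in }\Omega .$$ As a consequence, if the initial datum satisfies $\mathrm{div}\,\mathbf B_{h,0}=0$, then $\mathrm{div}\,\mathbf B_h=0$ at all times.
   Context: **General notation.** $\Omega\subset\mathbb R^3$ is a (bounded) polyhedral domain with Lipschitz boundary; $(\cdot,\cdot)_D$ and $\|\cdot\|_{0,D}$ are the $L^2(D)$ inner product and norm, $|\cdot|_{1,D}$ the $H^1(D)$ seminorm; the subscript $D$ is dropped if $D=\Omega$. $L^2_0(D)$: zero-average functions. $H_0(\mathbf{curl},\Omega)$, $H_0(\mathrm{div},\Omega)$: vanishing tangential, resp. normal, trace. Subscript $t$ means time derivative. $\mathbb P_\ell(\omega)$: polynomials of degree $\le\ell$ on $\omega$. $T,Re,Re_m>0$ are given, as are a force $\mathbf f$ and initial data. **Meshes.** $\{\Omega_h\}_h$ is a family of partitions of $\Omega$ into finitely many nonoverlapping polyhedra $K$ with planar faces $F$ and straight edges $e$ (boundaries of distinct elements meet in common vertices, edges, faces, or not at all). $h_K,h_F$ are diameters, $h_e$ lengths; $\mathbf b_K,\mathbf b_F$ are the centers of $K,F$; $\mathbf x_K=\mathbf x-\mathbf b_K$, $\mathbf x_F=\mathbf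 x-\mathbf b_F$. There is $\gamma\in(0,1)$ independent of the mesh such that all elements and faces are $\gamma$-shape regular (e.g. star-shaped with respect to a ball/disc of radius at least $\gamma$ times the diameter), $\gamma h_K\le h_F$ for each face $F$ of $K$, and $\gamma h_F\le h_e$ for each edge $e$ of $F$. **Projections.** For $\omega$ an element or a face, $\Pi^{0,\omega}_\ell$ is the (componentwise) $L^2(\omega)$-orthogonal projection onto $\mathbb P_\ell(\omega)$, and $\Pi^{\nabla,\omega}_1 v\in\mathbb P_1(\omega)$ is defined (componentwise) by $(\nabla(\Pi^{\nabla,\omega}_1v-v),\nabla q)_\omega=0$ for all $q\in\mathbb P_1(\omega)$ and $\int_{\partial\omega}(\Pi^{\nabla,\omega}_1v-v)=0$. $\Pi^0_\ell$ is the elementwise $L^2$ projection. **Pressure and velocity spaces.** $Q_h=\{q_h\in L^2_0(\Omega): q_h|_K\in\mathbb P_0(K)\ \forall K\}$. For a face $F$ with unit normal $\mathbf n_F$, write $\mathbf w_{\tau}=(\mathbf n_F\times\mathbf w)\times\mathbf n_F$, $w_n=\mathbf n_F\cdot\mathbf w$; $\mathbf W_h(F)$ is the set of $\mathbf w\in[H^1(F)]^3$ with $\mathbf w|_{\partial F}$ continuous, $\mathbf w|_e\in[\mathbb P_1(e)]^3$ on each edge, $\Delta_F\mathbf w\in[\mathbb P_2(F)]^3$, $(\mathbf w_\tau-\Pi^{\nabla,F}_1\mathbf w_\tau,\mathbf q)_F=0$ for all $\mathbf q\in[\mathbb P_2(F)]^2$, $(w_n-\Pi^{\nabla,F}_1w_n,q)_F=0$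 for all $q\in\mathbb P_2(F)\setminus\mathbb R$ (the span of the scaled monomials of degree 1 and 2). $\mathbf W_h(\partial K)$: continuous fields on $\partial K$ with restriction in $\mathbf W_h(F)$ for each face. $\mathbf W_h(K)$: $\mathbf w\in[H^1(K)]^3$ with $\mathbf w|_{\partial K}\in\mathbf W_h(\partial K)$, $\Delta\mathbf w+\nabla s\in\mathbf x\times[\mathbb P_0(K)]^3$ for some $s\in L^2_0(K)$, $\mathrm{div}\,\mathbf w\in\mathbb P_0(K)$, and $(\mathbf w-\Pi^{\nabla,K}_1\mathbf w,\mathbf x\times\mathbf q)_K=0$ for all $\mathbf q\in[\mathbb P_0(K)]^3$. $\mathbf W_h=\{\mathbf w\in[H^1_0(\Omega)]^3:\mathbf w|_K\in\mathbf W_h(K)\ \forall K\}$; one has $\mathrm{div}\,\mathbf W_h\subseteq Q_h$. Unisolvent degrees of freedom (dofs): vertex values, and face averages $|F|^{-1}\int_F w_n$. **Velocity forms.** $b(\mathbf v,q)=-\int_\Omega q\,\mathrm{div}\,\mathbf v$. $a_h=\sum_K a_h^K$, $a_h^K(\mathbf u,\mathbf v)=(\nabla\Pi^{\nabla,K}_1\mathbf u,\nabla\Pi^{\nabla,K}_1\mathbf v)_K+S^K((I-\Pi^{\nabla,K}_1)\mathbf u,(I-\Pi^{\nabla,K}_1)\mathbf v)$; $m_h=\sum_K m_h^K$, $m_h^K(\mathbf u,\mathbf v)=(\Pi^{0,K}_1\mathbf u,\Pi^{0,K}_1\mathbf v)_K+\widetilde S^K((I-\Pi^{0,K}_1)\mathbf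 u,(I-\Pi^{0,K}_1)\mathbf v)$. $S^K,\widetilde S^K$ are symmetric bilinear forms on $\mathbf W_h(K)$ with $\sigma_*|\mathbf v|_{1,K}^2\le S^K(\mathbf v,\mathbf v)\le\sigma^*|\mathbf v|_{1,K}^2$ for $\mathbf v\in\ker\Pi^{\nabla,K}_1$, and $\widetilde\sigma_*\|\mathbf v\|_{0,K}^2\le\widetilde S^K(\mathbf v,\mathbf v)\le\widetilde\sigma^*\|\mathbf v\|_{0,K}^2$ for $\mathbf v\in\ker\Pi^{0,K}_1$, with positive constants independent of $h_K$. Trilinear form: $c_h^K(\mathbf v;\mathbf u,\mathbf w)=\int_K(\Pi^{0,K}_0\nabla\mathbf u)\,\Pi^{0,K}_1\mathbf v\cdot\Pi^{0,K}_1\mathbf w$, $\widetilde c_h(\mathbf v;\mathbf u,\mathbf w)=\sum_K\frac12\big(c_h^K(\mathbf v;\mathbf u,\mathbf w)-c_h^K(\mathbf v;\mathbf w,\mathbf u)\big)$. **Edge and face spaces.** $\mathbf V_h^{\mathrm{edge}}(F)$: $\mathbf E\in[L^2(F)]^2$ with $\mathrm{div}_F\mathbf E,\mathrm{rot}_F\mathbf E\in\mathbb P_0(F)$, $\mathbf E\cdot\mathbf t_e\in\mathbb P_0(e)$ for each edge, $\int_F\mathbf E\cdot\mathbf x_F=0$. $\mathbf V_h^{\mathrm{edge}}(K)$: $\mathbf E\in[L^2(K)]^3$ with tangential component on each face $F$ in $\mathbf V_h^{\mathrm{edge}}(F)$, $\mathbf E\cdot\mathbf t_e$ single valued on each edge,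 $\mathbf{curl}\,\mathbf{curl}\,\mathbf E\in[\mathbb P_0(K)]^3$, $\mathrm{div}\,\mathbf E=0$, $\int_K\mathbf{curl}\,\mathbf E\cdot(\mathbf x_K\times\mathbf q)=0$ for all $\mathbf q\in[\mathbb P_0(K)]^3$. $\mathbf V_h^{\mathrm{edge}}=\{\mathbf E\in H_0(\mathbf{curl},\Omega):\mathbf E|_K\in\mathbf V_h^{\mathrm{edge}}(K)\ \forall K\}$. $\mathbf V_h^{\mathrm{face}}(K)$: $\mathbf B\in[L^2(K)]^3$ with $\mathbf B\cdot\mathbf n_F\in\mathbb P_0(F)$ on each face, $\mathrm{div}\,\mathbf B\in\mathbb P_0(K)$, $\mathbf{curl}\,\mathbf B\in[\mathbb P_0(K)]^3$, $\int_K\mathbf B\cdot(\mathbf x_K\times\mathbf q)=0$ for all $\mathbf q\in[\mathbb P_0(K)]^3$. $\mathbf V_h^{\mathrm{face}}=\{\mathbf B\in H_0(\mathrm{div},\Omega):\mathbf B|_K\in\mathbf V_h^{\mathrm{face}}(K)\ \forall K\}$. The spaces satisfy exact sequence properties; in particular $\mathbf{curl}(\mathbf V_h^{\mathrm{edge}})=\{\mathbf C\in\mathbf V_h^{\mathrm{face}}:\mathrm{div}\,\mathbf C=0\}$. **Edge/face products.** For $\star\in\{\mathrm{edge},\mathrm{face}\}$, $[\mathbf E,\mathbf F]_\star=\sum_K[\mathbf E,\mathbf F]_{\star,K}$, $[\mathbf E,\mathbf F]_{\star,K}=(\Pi^{0,K}_0\mathbf E,\Pi^{0,K}_0\mathbf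 F)_K+S^K_\star((I-\Pi^{0,K}_0)\mathbf E,(I-\Pi^{0,K}_0)\mathbf F)$, with $S^K_\star$ symmetric bilinear and uniformly (in $h_K$) equivalent to $\|\cdot\|_{0,K}^2$ on $\ker\Pi^{0,K}_0\cap\mathbf V_h^\star(K)$. The products also apply to elementwise discontinuous fields. $\boldsymbol\chi_h(\mathbf v_h,\mathbf B_h)|_K:=\Pi^{0,K}_0\mathbf v_h\times\Pi^{0,K}_0\mathbf B_h$. **Scheme.** For every $t\in(0,T)$ find $(\mathbf u_h,p_h,\mathbf E_h,\mathbf B_h)\in\mathbf W_h\times Q_h\times\mathbf V_h^{\mathrm{edge}}\times\mathbf V_h^{\mathrm{face}}$, with $\mathbf j_h:=\mathbf E_h+\boldsymbol\chi_h(\mathbf u_h,\mathbf B_h)$, such that $m_h(\mathbf u_{h,t},\mathbf v_h)+Re^{-1}a_h(\mathbf u_h,\mathbf v_h)+b(\mathbf v_h,p_h)+\widetilde c_h(\mathbf u_h;\mathbf u_h,\mathbf v_h)+[\mathbf j_h,\boldsymbol\chi_h(\mathbf v_h,\mathbf B_h)]_{\mathrm{edge}}=(\mathbf f,\Pi^0_1\mathbf v_h)$ for all $\mathbf v_h\in\mathbf W_h$; $[\mathbf j_h,\mathbf F_h]_{\mathrm{edge}}-Re_m^{-1}[\mathbf B_h,\mathbf{curl}\,\mathbf F_h]_{\mathrm{face}}=0$ for all $\mathbf F_h\in\mathbf V_h^{\mathrm{edge}}$; $[\mathbf B_{h,t},\mathbf C_h]_{\mathrm{face}}+[\mathbf{curl}\,\mathbf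 E_h,\mathbf C_h]_{\mathrm{face}}=0$ for all $\mathbf C_h\in\mathbf V_h^{\mathrm{face}}$; $b(\mathbf u_h,q_h)=0$ for all $q_h\in Q_h$; with initial conditions $\mathbf u_h(0)=\mathbf u_{h,0}\in\mathbf W_h$, $\mathbf B_h(0)=\mathbf B_{h,0}\in\mathbf V_h^{\mathrm{face}}$. *)

(* Defs.v *)
From HB Require Import structures.
From mathcomp Require Import all_boot all_order all_algebra.
From mathcomp Require Import all_classical all_reals all_analysis.

Set Implicit Arguments.
Unset Strict Implicit.
Unset Printing Implicit Defensive.

Import Order.TTheory GRing.Theory Num.Theory.
Import numFieldNormedType.Exports.

Local Open Scope classical_set_scope.
Local Open Scope ring_scope.

Section MeasurableRowVector.
Context (R : realType) (n : nat).

Let coord (i : 'I_n) (x : 'rV[R]_n) : measurableTypeR R := x ord0 i.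

Let rV_set0 : g_sigma_preimage coord set0.
Proof. exact: sigma_algebra0. Qed.

Let rV_setC A : g_sigma_preimage coord A -> g_sigma_preimage coord (~` A).
Proof. exact: sigma_algebraC. Qed.

Let rV_bigcup (F : (set 'rV[R]_n)^nat) :
  (forall i, g_sigma_preimage coord (F i)) ->
  g_sigma_preimage coord (\bigcup_i (F i)).
Proof. exact: sigma_algebra_bigcup. Qed.

(* Same product sigma-algebra as the one carried by n.-tuple in the library. *)
HB.instance Definition _ :=
  @isMeasurable.Build default_measure_display 'rV[R]_n
    (g_sigma_preimage coord) rV_set0 rV_setC rV_bigcup.

Lemma measurable_rV d (T : measurableType d) (f : T -> 'rV[R]_n) :
  (forall i, measurable_fun [set: T] (fun x => f x ord0 i)) ->
  measurable_fun [set: T] f.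
Proof.
move=> mf; apply: (@measurability _ _ _ _ _ _
  (\big[setU/set0]_(i < n) preimage_set_system setT (coord i) measurable)) => //.
rewrite -bigcup_seq => _ [_ [i /= _ [A mA <-]] <-].
by rewrite setTI; exact: (mf i _ A mA).
Qed.

End MeasurableRowVector.

Section LebesgueRowVector.
Context (R : realType).
Local Notation RB := (measurableTypeR R).
Local Notation mu := (@lebesgue_measure R).

Definition row2 (x : RB * RB) : 'rV[R]_2 := \row_(i < 2) [:: x.1; x.2]`_i.

Definition row3 (x : RB * RB * RB) : 'rV[R]_3 :=
  \row_(i < 3) [:: x.1.1; x.1.2; x.2]`_i.

Lemma measurable_row2 : measurable_fun setT row2.
Proof.
apply: measurable_rV => -[[|[|//]] i2]; under eq_fun do rewrite mxE /=.
- exact: measurable_fst.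
- exact: measurable_snd.
Qed.

Lemma measurable_row3 : measurable_fun setT row3.
Proof.
apply: measurable_rV => -[[|[|[|//]]] i2]; under eq_fun do rewrite mxE /=.
- by apply: measurableT_comp; exact: measurable_fst.
- by apply: measurableT_comp; [exact: measurable_snd|exact: measurable_fst].
- exact: measurable_snd.
Qed.

Definition leb2 : set 'rV[R]_2 -> \bar R := pushforward (mu \x mu)%E row2.

HB.instance Definition _ := Measure.copy leb2
  (measure_function_pushforward__canonical__measure_function_Measure
    (mu \x mu)%E measurable_row2).

Definition leb3 : set 'rV[R]_3 -> \bar R := pushforward ((mu \x mu) \x mu)%E row3.

HB.instance Definition _ := Measure.copy leb3
  (measure_function_pushforward__canonical__measure_function_Measure
    ((mu \x mu) \x mu)%E measurable_row3).

End LebesgueRowVector.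

Notation "'mu2" := (@leb2 _) (at level 0, only parsing).
Notation "'mu3" := (@leb3 _) (at level 0, only parsing).

Section Vectors.
Context (R : realType).

Definition dot n (u v : 'rV[R]_n) : R := \sum_i u 0 i * v 0 i.

Definition enorm n (u : 'rV[R]_n) : R := Num.sqrt (dot u u).

Definition vec2 (a b : R) : 'rV[R]_2 := \row_(i < 2) [:: a; b]`_i.

Definition vec3 (a b c : R) : 'rV[R]_3 := \row_(i < 3) [:: a; b; c]`_i.

Definition cross (u v : 'rV[R]_3) : 'rV[R]_3 :=
  vec3 (u 0 1 * v 0 2 - u 0 2 * v 0 1)
       (u 0 2 * v 0 0 - u 0 0 * v 0 2)
       (u 0 0 * v 0 1 - u 0 1 * v 0 0).

Definition cmp (T : Type) n (v : T -> 'rV[R]_n) (i : 'I_n) : T -> R :=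
  fun x => v x 0 i.

Definition bdry n (A : set 'rV[R]_n) : set 'rV[R]_n := closure A `\` A°.

Definition diam n (A : set 'rV[R]_n) : R :=
  sup [set d | exists x y, [/\ A x, A y & d = enorm (x - y)]].

End Vectors.

Section Sobolev.
Context (R : realType) (n : nat).

Definition pd (i : 'I_n) (f : 'rV[R]_n -> R) : 'rV[R]_n -> R :=
  fun x => 'D_(delta_mx 0 i) f x.

Definition grad (f : 'rV[R]_n -> R) : 'rV[R]_n -> 'rV[R]_n :=
  fun x => \row_i pd i f x.

(* C^infinity: all iterated partial derivatives are differentiable *)
Definition smooth (f : 'rV[R]_n -> R) : Prop :=
  forall (s : seq 'I_n) (x : 'rV[R]_n), differentiable (foldr pd f s) x.

(* C^infinity_c(D) *)
Definition testfun (D : set 'rV[R]_n) (phi : 'rV[R]_n -> R) : Prop :=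
  smooth phi /\ exists C : set 'rV[R]_n,
    [/\ compact C, C `<=` D & forall x, ~ C x -> phi x = 0].

(* Test functions up to the boundary of U whose support meets the boundary of
   U only inside the piece G: they see the trace on G and nothing else. *)
Definition loctest (U G : set 'rV[R]_n) (phi : 'rV[R]_n -> R) : Prop :=
  smooth phi /\ exists C : set 'rV[R]_n,
    [/\ compact C, C `&` bdry U `<=` G & forall x, ~ C x -> phi x = 0].

Definition testvec m (P : ('rV[R]_n -> R) -> Prop)
  (phi : 'rV[R]_n -> 'rV[R]_m) : Prop := forall i, P (cmp phi i).

Definition polyfun (l : nat) (f : 'rV[R]_n -> R) : Prop :=
  exists c : {ffun 'I_n -> 'I_l.+1} -> R, forall x,
    f x = \sum_(a : {ffun 'I_n -> 'I_l.+1} | (\sum_i a i <= l)%N) c a * \prod_i x 0 i ^+ a i.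

(* span of the scaled monomials ((x - b)/h)^a with 0 < |a| <= l *)
Definition polyfun_nocst (l : nat) (b : 'rV[R]_n) (h : R)
    (f : 'rV[R]_n -> R) : Prop :=
  exists c : {ffun 'I_n -> 'I_l.+1} -> R, forall x,
    f x = \sum_(a : {ffun 'I_n -> 'I_l.+1} | (0 < \sum_i a i <= l)%N)
            c a * \prod_i ((x 0 i - b 0 i) / h) ^+ a i.

End Sobolev.

Section L2.
Context d (T : measurableType d) (R : realType) (mu : {measure set T -> \bar R}).

Definition L2 (D : set T) (f : T -> R) : Prop :=
  measurable_fun D f /\ mu.-integrable D (fun x => (f x ^+ 2)%:E).

Definition L2v m (D : set T) (v : T -> 'rV[R]_m) : Prop :=
  forall i, L2 D (cmp v i).

Definition L20 (D : set T) (f : T -> R) : Prop :=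
  L2 D f /\ \int[mu]_(x in D) f x = 0.

Definition ip (D : set T) (f g : T -> R) : R := \int[mu]_(x in D) (f x * g x).

Definition ipv m (D : set T) (v w : T -> 'rV[R]_m) : R :=
  \int[mu]_(x in D) dot (v x) (w x).

Definition nrm (D : set T) (f : T -> R) : R := Num.sqrt (ip D f f).

Definition nrmv m (D : set T) (v : T -> 'rV[R]_m) : R := Num.sqrt (ipv D v v).

Definition aeeq (V : Type) (D : set T) (f g : T -> V) : Prop :=
  {ae mu, forall x, D x -> f x = g x}.

End L2.

Section WeakDerivatives.
Context (R : realType) (n : nat) (mu : {measure set 'rV[R]_n -> \bar R}).
Implicit Types (D : set 'rV[R]_n) (f g : 'rV[R]_n -> R).

Definition is_wpd D (i : 'I_n) f g : Prop :=
  L2 mu D g /\ forall phi, testfun D phi -> ip mu D f (pd i phi) = - ip mu D g phi.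

(* Here and below, weak derivatives, projections and traces used as functions
   are representatives, chosen among the functions
   satisfying the defining identity (and 0 if there is none). *)
Definition wpd D i f : 'rV[R]_n -> R := xget (fun=> 0) [set g | is_wpd D i f g].

Definition wgrad D f : 'rV[R]_n -> 'rV[R]_n := fun x => \row_i wpd D i f x.

(* ( grad u, grad v )_D for vector-valued u, v *)
Definition ipgrad m D (u v : 'rV[R]_n -> 'rV[R]_m) : R :=
  \sum_i ipv mu D (wgrad D (cmp u i)) (wgrad D (cmp v i)).

Definition H1 D f : Prop := L2 mu D f /\ forall i, exists g, is_wpd D i f g.

(* closure of C^infinity_c(D) in H^1(D) *)
Definition H10 D f : Prop :=
  H1 D f /\ exists phi : nat -> 'rV[R]_n -> R,
    [/\ forall k, testfun D (phi k),
        (fun k => nrm mu D (phi k \- f)) @ \oo --> (0 : R) &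
        forall i, (fun k => nrm mu D (pd i (phi k) \- wpd D i f)) @ \oo --> (0 : R)].

Definition is_wdiv D (v : 'rV[R]_n -> 'rV[R]_n) g : Prop :=
  L2 mu D g /\
  forall phi, testfun D phi -> ipv mu D v (grad phi) = - ip mu D g phi.

Definition wdiv D v : 'rV[R]_n -> R := xget (fun=> 0) [set g | is_wdiv D v g].

(* H_0(div, D): vanishing normal trace, through Green's formula against
   functions that are smooth up to the boundary *)
Definition H0div D v : Prop :=
  [/\ L2v mu D v, exists g, is_wdiv D v g &
      forall phi, testfun setT phi ->
        ipv mu D v (grad phi) + ip mu D (wdiv D v) phi = 0].

Definition is_l2proj l D f p : Prop :=
  polyfun l p /\ forall q, polyfun l q -> ip mu D (p \- f) q = 0.

Definition l2proj l D f : 'rV[R]_n -> R := xget (fun=> 0) [set p | is_l2proj l D f p].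

Definition l2projv m l D (v : 'rV[R]_n -> 'rV[R]_m) : 'rV[R]_n -> 'rV[R]_m :=
  fun x => \row_i l2proj l D (cmp v i) x.

(* [bint f p] stands for the boundary integral
   of p - f over the boundary of D *)
Definition is_H1proj D (bint : ('rV[R]_n -> R) -> ('rV[R]_n -> R) -> R) f p : Prop :=
  [/\ polyfun 1 p,
      forall q, polyfun 1 q ->
        ipv mu D (fun x => grad p x - wgrad D f x) (grad q) = 0 &
      bint f p = 0].

Definition H1proj D bint f : 'rV[R]_n -> R :=
  xget (fun=> 0) [set p | is_H1proj D bint f p].

Definition barycenter D : 'rV[R]_n :=
  \row_i ((\int[mu]_(x in D) x 0 i) / \int[mu]_(x in D) 1).

End WeakDerivatives.

Section Curl.
Context (R : realType).
Implicit Types (D : set 'rV[R]_3) (v w : 'rV[R]_3 -> 'rV[R]_3).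

Definition curl v : 'rV[R]_3 -> 'rV[R]_3 := fun x =>
  vec3 (pd 1 (cmp v 2) x - pd 2 (cmp v 1) x)
       (pd 2 (cmp v 0) x - pd 0 (cmp v 2) x)
       (pd 0 (cmp v 1) x - pd 1 (cmp v 0) x).

Definition is_wcurl D v w : Prop :=
  L2v 'mu3 D w /\
  forall phi, testvec (testfun D) phi -> ipv 'mu3 D v (curl phi) = ipv 'mu3 D w phi.

Definition wcurl D v : 'rV[R]_3 -> 'rV[R]_3 :=
  xget (fun=> 0) [set w | is_wcurl D v w].

(* H_0(curl, D): vanishing tangential trace *)
Definition H0curl D v : Prop :=
  [/\ L2v 'mu3 D v, exists w, is_wcurl D v w &
      forall phi : 'rV[R]_3 -> 'rV[R]_3, testvec (testfun setT) phi ->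
        ipv 'mu3 D (wcurl D v) phi = ipv 'mu3 D v (curl phi)].

(* planar vector-valued curl of a scalar, and the scalar rot it is dual to:
   rot E = d_0 E_1 - d_1 E_0 *)
Definition vrot (phi : 'rV[R]_2 -> R) : 'rV[R]_2 -> 'rV[R]_2 :=
  fun x => vec2 (pd 1 phi x) (- pd 0 phi x).

Definition is_wrot (D : set 'rV[R]_2) (E : 'rV[R]_2 -> 'rV[R]_2) g : Prop :=
  L2 'mu2 D g /\
  forall phi, testfun D phi -> ipv 'mu2 D E (vrot phi) = ip 'mu2 D g phi.

Definition wrot (D : set 'rV[R]_2) E : 'rV[R]_2 -> R := xget (fun=> 0) [set g | is_wrot D E g].

End Curl.

(* A planar polygon: its (relatively open) interior and its edges, given by
   their endpoints, oriented so that the polygon lies on their left. *)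
Record polygon (R : realType) := Polygon {
  pgset : set 'rV[R]_2;
  pgne : nat;
  pgedge : 'I_pgne -> 'rV[R]_2 * 'rV[R]_2 }.

(* A face: a polygon placed in space by an origin and an orthonormal pair. *)
Record face (R : realType) := Face {
  forig : 'rV[R]_3;
  ftan0 : 'rV[R]_3;
  ftan1 : 'rV[R]_3;
  fpg : polygon R }.

(* A polyhedron: its interior and its faces. *)
Record polyhedron (R : realType) := Polyhedron {
  phset : set 'rV[R]_3;
  phnf : nat;
  phface : 'I_phnf -> face R }.

Record mesh (R : realType) := Mesh {
  mshn : nat;
  mshel : 'I_mshn -> polyhedron R }.

Section Geometry.
Context (R : realType).
Implicit Types (P : polygon R) (F : face R) (K : polyhedron R).

Definition segpt m (e : 'rV[R]_m * 'rV[R]_m) (s : R) : 'rV[R]_m :=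
  e.1 + s *: (e.2 - e.1).

Definition oseg m (e : 'rV[R]_m * 'rV[R]_m) : set 'rV[R]_m :=
  segpt e @` [set s | 0 < s < 1].

Definition cseg m (e : 'rV[R]_m * 'rV[R]_m) : set 'rV[R]_m :=
  segpt e @` [set s | 0 <= s <= 1].

Definition elen m (e : 'rV[R]_m * 'rV[R]_m) : R := enorm (e.2 - e.1).

Definition etan m (e : 'rV[R]_m * 'rV[R]_m) : 'rV[R]_m :=
  (elen e)^-1 *: (e.2 - e.1).

(* outward, since the polygon is on the left of its edges *)
Definition enor (e : 'rV[R]_2 * 'rV[R]_2) : 'rV[R]_2 :=
  vec2 (etan e 0 1) (- etan e 0 0).

Definition eint m (e : 'rV[R]_m * 'rV[R]_m) (g : R -> R) : R :=
  elen e * \int[@lebesgue_measure R]_(s in [set s : R | 0 <= s <= 1]) g s.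

Definition fpar F (y : 'rV[R]_2) : 'rV[R]_3 :=
  forig F + y 0 0 *: ftan0 F + y 0 1 *: ftan1 F.

Definition fnor F : 'rV[R]_3 := cross (ftan0 F) (ftan1 F).

Definition fset2 F : set 'rV[R]_2 := pgset (fpg F).

Definition fopen F : set 'rV[R]_3 := fpar F @` fset2 F.

Definition fclosed F : set 'rV[R]_3 := fpar F @` closure (fset2 F).

Definition fedge F (e : 'I_(pgne (fpg F))) : 'rV[R]_2 * 'rV[R]_2 := pgedge e.

Definition fedge3 F (e : 'I_(pgne (fpg F))) : 'rV[R]_3 * 'rV[R]_3 :=
  (fpar F (fedge e).1, fpar F (fedge e).2).

Definition domain n (D : set 'rV[R]_n) : Prop :=
  [/\ open D, connected D, bounded_set D & D !=set0].

Definition wf_polygon P : Prop :=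
  [/\ domain (pgset P),
      forall e, (pgedge e : 'rV[R]_2 * 'rV[R]_2).1 != (@pgedge _ P e).2,
      bdry (pgset P) = \bigcup_(e : 'I_(pgne P)) cseg (pgedge e),
      forall e e' : 'I_(pgne P), e <> e' ->
        [/\ oseg (pgedge e) `&` oseg (pgedge e') = set0,
            ~ oseg (pgedge e) (pgedge e').1 & ~ oseg (pgedge e) (pgedge e').2] &
      forall (e : 'I_(pgne P)) y, oseg (pgedge e) y ->
        \forall s \near (0:R)^'+,
          pgset P (y - s *: enor (pgedge e)) /\
          ~ pgset P (y + s *: enor (pgedge e))].

Definition wf_face F : Prop :=
  [/\ dot (ftan0 F) (ftan0 F) = 1, dot (ftan1 F) (ftan1 F) = 1,
      dot (ftan0 F) (ftan1 F) = 0 & wf_polygon (fpg F)].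

Definition cells K : set (set 'rV[R]_3) :=
  [set c | exists i : 'I_(phnf K), c = fopen (phface i) \/
     exists e : 'I_(pgne (fpg (phface i))),
       [\/ c = oseg (fedge3 e), c = [set (fedge3 e).1] | c = [set (fedge3 e).2]]].

(* the boundaries of K and K' meet in common vertices, edges, faces *)
Definition conforming K K' : Prop :=
  forall c c', cells K c -> cells K' c' -> c = c' \/ c `&` c' = set0.

(* fnor is the outward normal *)
Definition wf_polyhedron K : Prop :=
  [/\ domain (phset K),
      (forall i : 'I_(phnf K), wf_face (phface i)) /\
      bdry (phset K) = \bigcup_(i : 'I_(phnf K)) fclosed (phface i),
      forall i j : 'I_(phnf K), i <> j ->
        fopen (phface i) `&` fopen (phface j) = set0,
      conforming K K &
      forall (i : 'I_(phnf K)) x, fopen (phface i) x ->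
        \forall s \near (0:R)^'+,
          phset K (x - s *: fnor (phface i)) /\
          ~ phset K (x + s *: fnor (phface i))].

(* near every boundary point, D is the strict epigraph of a Lipschitz function
   in suitable orthonormal coordinates *)
Definition lipschitz_boundary (D : set 'rV[R]_3) : Prop :=
  forall x, bdry D x -> exists (Q : 'M[R]_3) (phi : 'rV[R]_2 -> R) (L r h : R),
    [/\ Q *m Q^T = 1%:M, L.-lipschitz phi, 0 < r, 0 < h &
        forall z, let y := (z - x) *m Q in let y' := vec2 (y 0 0) (y 0 1) in
          enorm y' < r -> `|y 0 2| < h -> (D z <-> phi y' < y 0 2)].

Definition lipschitz_polyhedral_domain (D : set 'rV[R]_3) : Prop :=
  (exists K, wf_polyhedron K /\ phset K = D) /\ lipschitz_boundary D.

Definition mesh_of (Om : set 'rV[R]_3) (M : mesh R) : Prop :=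
  [/\ forall k : 'I_(mshn M), wf_polyhedron (mshel k) /\ phset (mshel k) `<=` Om,
      forall k l : 'I_(mshn M), k <> l ->
        phset (mshel k) `&` phset (mshel l) = set0,
      closure Om = \bigcup_(k : 'I_(mshn M)) closure (phset (mshel k)) &
      forall k l : 'I_(mshn M), conforming (mshel k) (mshel l)].

Definition shape_regular n (gamma : R) (D : set 'rV[R]_n) : Prop :=
  exists (c : 'rV[R]_n) (r : R), gamma * diam D <= r /\
    forall y x s, enorm (y - c) < r -> D x -> 0 <= s <= 1 -> D (segpt (x, y) s).

Definition regular_mesh (gamma : R) (M : mesh R) : Prop :=
  forall (k : 'I_(mshn M)), let K := mshel k in
    shape_regular gamma (phset K) /\
    forall (i : 'I_(phnf K)), let F := phface i in
      [/\ shape_regular gamma (fset2 F),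
          gamma * diam (phset K) <= diam (fset2 F) &
          forall e : 'I_(pgne (fpg F)),
            gamma * diam (fset2 F) <= elen (fedge e)].

End Geometry.

(* Every trace is taken piece by piece (face of K, edge of F), by Green's
   formula against functions that vanish near the rest of the boundary. On a
   face F, functions are functions of the planar coordinates y, and on an edge
   they are functions of the parameter s in [0, 1]. *)
Section Traces.
Context (R : realType).
Implicit Types (F : face R) (K : polyhedron R).

Definition is_etrace (D : set 'rV[R]_2) (e : 'rV[R]_2 * 'rV[R]_2)
    (w : 'rV[R]_2 -> R) (g : R -> R) : Prop :=
  L2 (@lebesgue_measure R) [set s : R | 0 <= s <= 1] g /\
  forall i phi, loctest D (oseg e) phi ->
    ip 'mu2 D (wpd 'mu2 D i w) phi + ip 'mu2 D w (pd i phi)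
    = enor e 0 i * eint e (fun s => g s * phi (segpt e s)).

Definition etrace D e w : R -> R := xget (fun=> 0) [set g | is_etrace D e w g].

Definition is_ftrace K F (w : 'rV[R]_3 -> R) (g : 'rV[R]_2 -> R) : Prop :=
  L2 'mu2 (fset2 F) g /\
  forall i phi, loctest (phset K) (fopen F) phi ->
    ip 'mu3 (phset K) (wpd 'mu3 (phset K) i w) phi + ip 'mu3 (phset K) w (pd i phi)
    = fnor F 0 i * ip 'mu2 (fset2 F) g (phi \o fpar F).

Definition ftrace K F w : 'rV[R]_2 -> R := xget (fun=> 0) [set g | is_ftrace K F w g].

(* g = B . n_F on F *)
Definition is_ntrace K F (B : 'rV[R]_3 -> 'rV[R]_3) (g : 'rV[R]_2 -> R) : Prop :=
  L2 'mu2 (fset2 F) g /\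
  forall phi, loctest (phset K) (fopen F) phi ->
    ipv 'mu3 (phset K) B (grad phi) + ip 'mu3 (phset K) (wdiv 'mu3 (phset K) B) phi
    = ip 'mu2 (fset2 F) g (phi \o fpar F).

(* G is the tangential component of E on F, in the basis (ftan0, ftan1); the
   right-hand side is the integral of (n x E) . phi, where n x ftan0 = ftan1
   and n x ftan1 = - ftan0 *)
Definition is_ttrace K F (E : 'rV[R]_3 -> 'rV[R]_3) (G : 'rV[R]_2 -> 'rV[R]_2) : Prop :=
  L2v 'mu2 (fset2 F) G /\
  forall phi : 'rV[R]_3 -> 'rV[R]_3, testvec (loctest (phset K) (fopen F)) phi ->
    ipv 'mu3 (phset K) (wcurl (phset K) E) phi - ipv 'mu3 (phset K) E (curl phi)
    = \int['mu2]_(y in fset2 F)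
        dot (G y 0 0 *: ftan1 F - G y 0 1 *: ftan0 F) (phi (fpar F y)).

Definition is_etan (D : set 'rV[R]_2) (e : 'rV[R]_2 * 'rV[R]_2)
    (E : 'rV[R]_2 -> 'rV[R]_2) (c : R) : Prop :=
  forall phi, loctest D (oseg e) phi ->
    ip 'mu2 D (wrot D E) phi - ipv 'mu2 D E (vrot phi)
    = eint e (fun s => c * phi (segpt e s)).

Definition bintF F (f p : 'rV[R]_2 -> R) : R :=
  \sum_(e < pgne (fpg F))
    eint (fedge e) (fun s => p (segpt (fedge e) s) - etrace (fset2 F) (fedge e) f s).

Definition bintK K (f p : 'rV[R]_3 -> R) : R :=
  \sum_(i < phnf K) \int['mu2]_(y in fset2 (phface i))
     (p (fpar (phface i) y) - ftrace K (phface i) f y).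

Definition PiNablaF F : ('rV[R]_2 -> R) -> 'rV[R]_2 -> R :=
  H1proj 'mu2 (fset2 F) (bintF F).

Definition PiNablaK K (v : 'rV[R]_3 -> 'rV[R]_3) : 'rV[R]_3 -> 'rV[R]_3 :=
  fun x => \row_i H1proj 'mu3 (phset K) (bintK K) (cmp v i) x.

Definition Pi0 l K : ('rV[R]_3 -> 'rV[R]_3) -> 'rV[R]_3 -> 'rV[R]_3 :=
  l2projv 'mu3 l (phset K).

End Traces.

Section LocalSpaces.
Context (R : realType).
Implicit Types (F : face R) (K : polyhedron R).
Local Notation field := ('rV[R]_3 -> 'rV[R]_3).

Definition wtau F (w : 'rV[R]_2 -> 'rV[R]_3) : 'rV[R]_2 -> 'rV[R]_2 := fun y =>
  let wt := cross (cross (fnor F) (w y)) (fnor F) in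
  vec2 (dot wt (ftan0 F)) (dot wt (ftan1 F)).

Definition wnor F (w : 'rV[R]_2 -> 'rV[R]_3) : 'rV[R]_2 -> R :=
  fun y => dot (fnor F) (w y).

Definition WhF F (w : 'rV[R]_2 -> 'rV[R]_3) : Prop :=
  let D := fset2 F in
  [/\ forall i, H1 'mu2 D (cmp w i),
      exists r : 'rV[R]_2 -> 'rV[R]_3, {within bdry D, continuous r} /\
        forall (e : 'I_(pgne (fpg F))) (i : 'I_3),
          is_etrace D (fedge e) (cmp w i) (cmp r i \o segpt (fedge e)) /\
          exists a b : R, forall s, 0 <= s <= 1 ->
            cmp r i (segpt (fedge e) s) = a + b * s,
      forall i, exists p, polyfun 2 p /\ forall phi, testfun D phi ->
        ipv 'mu2 D (wgrad 'mu2 D (cmp w i)) (grad phi) = - ip 'mu2 D p phi,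
      forall k q, polyfun 2 q ->
        ip 'mu2 D (cmp (wtau F w) k \- PiNablaF F (cmp (wtau F w) k)) q = 0 &
      forall q, polyfun_nocst 2 (barycenter 'mu2 D) (diam D) q ->
        ip 'mu2 D (wnor F w \- PiNablaF F (wnor F w)) q = 0].

Definition WhK K (w : field) : Prop :=
  let D := phset K in
  [/\ forall i, H1 'mu3 D (cmp w i),
      exists g : field, {within bdry D, continuous g} /\
        forall j : 'I_(phnf K),
          (forall i, is_ftrace K (phface j) (cmp w i) (cmp g i \o fpar (phface j))) /\
          WhF (phface j) (g \o fpar (phface j)),
      exists s (q : 'rV[R]_3), L20 'mu3 D s /\
        forall phi : field, testvec (testfun D) phi ->
          - (\sum_i ipv 'mu3 D (wgrad 'mu3 D (cmp w i)) (grad (cmp phi i)))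
          - ip 'mu3 D s (fun x => \sum_i pd i (cmp phi i) x)
          = ipv 'mu3 D (fun x => cross x q) phi,
      exists c, polyfun 0 c /\ is_wdiv 'mu3 D w c &
      forall q : 'rV[R]_3, ipv 'mu3 D (w \- PiNablaK K w) (fun x => cross x q) = 0].

Definition VedgeF F (E : 'rV[R]_2 -> 'rV[R]_2) : Prop :=
  let D := fset2 F in
  [/\ L2v 'mu2 D E,
      exists c, polyfun 0 c /\ is_wdiv 'mu2 D E c,
      exists c, polyfun 0 c /\ is_wrot D E c,
      forall e : 'I_(pgne (fpg F)), exists c, is_etan D (fedge e) E c &
      ipv 'mu2 D E (fun y => y - barycenter 'mu2 D) = 0].

Definition polyfun0v n m (J : 'rV[R]_n -> 'rV[R]_m) : Prop :=
  forall i, polyfun 0 (cmp J i).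

Definition VedgeK K (E : field) : Prop :=
  let D := phset K in
  [/\ L2v 'mu3 D E,
      exists G : 'I_(phnf K) -> 'rV[R]_2 -> 'rV[R]_2,
        (forall j, is_ttrace K (phface j) E (G j) /\ VedgeF (phface j) (G j)) /\
        forall j l (e : 'I_(pgne (fpg (phface j)))) (e' : 'I_(pgne (fpg (phface l)))) c c',
          oseg (fedge3 e) = oseg (fedge3 e') ->
          is_etan (fset2 (phface j)) (fedge e) (G j) c ->
          is_etan (fset2 (phface l)) (fedge e') (G l) c' ->
          c *: etan (fedge3 e) = c' *: etan (fedge3 e'),
      exists J C, [/\ is_wcurl D E J, is_wcurl D J C & polyfun0v C],
      is_wdiv 'mu3 D E (fun=> 0) &
      forall q : 'rV[R]_3, ipv 'mu3 D (wcurl D E)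
        (fun x => cross (x - barycenter 'mu3 D) q) = 0].

Definition VfaceK K (B : field) : Prop :=
  let D := phset K in
  [/\ L2v 'mu3 D B,
      forall j : 'I_(phnf K), exists c, polyfun 0 c /\ is_ntrace K (phface j) B c,
      exists c, polyfun 0 c /\ is_wdiv 'mu3 D B c,
      exists C, polyfun0v C /\ is_wcurl D B C &
      forall q : 'rV[R]_3, ipv 'mu3 D B
        (fun x => cross (x - barycenter 'mu3 D) q) = 0].

End LocalSpaces.

Section GlobalSpaces.
Context (R : realType) (Om : set 'rV[R]_3) (M : mesh R).
Local Notation field := ('rV[R]_3 -> 'rV[R]_3).

Definition Qh (q : 'rV[R]_3 -> R) : Prop :=
  L20 'mu3 Om q /\
  forall k : 'I_(mshn M), exists c, polyfun 0 c /\ aeeq 'mu3 (phset (mshel k)) q c.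

Definition Wh (w : field) : Prop :=
  (forall i, H10 'mu3 Om (cmp w i)) /\ forall k : 'I_(mshn M), WhK (mshel k) w.

Definition Vedge (E : field) : Prop :=
  H0curl Om E /\ forall k : 'I_(mshn M), VedgeK (mshel k) E.

Definition Vface (B : field) : Prop :=
  H0div 'mu3 Om B /\ forall k : 'I_(mshn M), VfaceK (mshel k) B.

End GlobalSpaces.

Section Forms.
Context (R : realType).
Local Notation field := ('rV[R]_3 -> 'rV[R]_3).

Definition symmetric_bilinear_on (V : field -> Prop) (S : field -> field -> R) : Prop :=
  (forall u v, V u -> V v -> S u v = S v u) /\
  (forall (a : R) u v w, V u -> V v -> V w ->
     S (fun x => a *: u x + v x) w = a * S u w + S v w).

(* one bilinear form per element, for a_h, m_h, [.,.]_edge and [.,.]_face *)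
Record stab (n : nat) := Stab {
  Sgrad : 'I_n -> field -> field -> R;
  Smass : 'I_n -> field -> field -> R;
  Sedge : 'I_n -> field -> field -> R;
  Sface : 'I_n -> field -> field -> R }.

(* S_K is symmetric bilinear on V(K), and equivalent to [sqn K] on the kernel
   of Pi_K in V(K), with constants that depend neither on K nor on the mesh *)
Definition uniformly_equivalent (I : Type) (Th : I -> mesh R)
    (V : polyhedron R -> field -> Prop) (Pi : polyhedron R -> field -> field)
    (sqn : polyhedron R -> field -> R)
    (S : forall h, 'I_(mshn (Th h)) -> field -> field -> R) : Prop :=
  exists lo hi : R, [/\ 0 < lo, 0 < hi &
    forall h k, let K := mshel k in
      symmetric_bilinear_on (V K) (S h k) /\
      forall v, V K v -> (forall x, Pi K v x = 0) ->
        lo * sqn K v <= S h k v v <= hi * sqn K v].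

Definition sqn0 (K : polyhedron R) (v : field) : R := nrmv 'mu3 (phset K) v ^+ 2.

Definition sqn1 (K : polyhedron R) (v : field) : R := ipgrad 'mu3 (phset K) v v.

Definition admissible_stab (I : Type) (Th : I -> mesh R)
    (S : forall h, stab (mshn (Th h))) : Prop :=
  [/\ uniformly_equivalent (@WhK R) (@PiNablaK R) sqn1 (fun h => Sgrad (S h)),
      uniformly_equivalent (@WhK R) (@Pi0 R 1) sqn0 (fun h => Smass (S h)),
      uniformly_equivalent (@VedgeK R) (@Pi0 R 0) sqn0 (fun h => Sedge (S h)) &
      uniformly_equivalent (@VfaceK R) (@Pi0 R 0) sqn0 (fun h => Sface (S h))].

Context (Om : set 'rV[R]_3) (M : mesh R) (S : stab (mshn M)).
Implicit Types (u v w E B : field).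

Definition bform v (q : 'rV[R]_3 -> R) : R := - ip 'mu3 Om q (wdiv 'mu3 Om v).

Definition aform u v : R :=
  \sum_k let K := mshel k in
    (ipgrad 'mu3 (phset K) (PiNablaK K u) (PiNablaK K v) +
     Sgrad S k (u \- PiNablaK K u) (v \- PiNablaK K v)).

Definition mform u v : R :=
  \sum_k let K := mshel k in
    (ipv 'mu3 (phset K) (Pi0 1 K u) (Pi0 1 K v) +
     Smass S k (u \- Pi0 1 K u) (v \- Pi0 1 K v)).

Definition Pi0grad (K : polyhedron R) u : 'rV[R]_3 -> 'M[R]_3 := fun x =>
  \matrix_(i, j) l2proj 'mu3 0 (phset K) (wpd 'mu3 (phset K) j (cmp u i)) x.

Definition cformK (K : polyhedron R) v u w : R :=
  ipv 'mu3 (phset K) (fun x => Pi0 1 K v x *m (Pi0grad K u x)^T) (Pi0 1 K w).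

Definition cform v u w : R :=
  \sum_k 2^-1 * (cformK (@mshel _ M k) v u w - cformK (@mshel _ M k) v w u).

Definition vemprod (St : 'I_(mshn M) -> field -> field -> R)
    (E F : 'I_(mshn M) -> field) : R :=
  \sum_k let K := mshel k in
    (ipv 'mu3 (phset K) (Pi0 0 K (E k)) (Pi0 0 K (F k)) +
     St k (E k \- Pi0 0 K (E k)) (F k \- Pi0 0 K (F k))).

Definition chi v B : 'I_(mshn M) -> field := fun k x =>
  cross (Pi0 0 (mshel k) v x) (Pi0 0 (mshel k) B x).

Definition load (f v : field) : R :=
  \sum_k ipv 'mu3 (phset (@mshel _ M k)) f (Pi0 1 (mshel k) v).

End Forms.

Section Scheme.
Context (R : realType) (Om : set 'rV[R]_3) (M : mesh R) (S : stab R (mshn M)).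
Local Notation field := ('rV[R]_3 -> 'rV[R]_3).

(* dv is the time derivative at t of the curve v, in L^2(Om) *)
Definition time_derivative (v : R -> field) (t : R) (dv : field) : Prop :=
  (fun s => nrmv 'mu3 Om (fun x => s^-1 *: (v (t + s) x - v t x) - dv x)) @ 0^'
    --> (0 : R).

(* v attains the initial value v0 at time 0, continuously in L^2(Om) *)
Definition initial_value (v : R -> field) (v0 : field) : Prop :=
  aeeq 'mu3 Om (v 0) v0 /\
  (fun s => nrmv 'mu3 Om (v s \- v0)) @ (0:R)^'+ --> (0 : R).

Definition scheme_at (Re Rem : R) (f u ut E B Bt : field) (p : 'rV[R]_3 -> R) : Prop :=
  let j := fun k => E \+ chi (M := M) u B k in
  [/\ forall v, Wh Om M v ->
        mform S ut v + Re^-1 * aform S u v + bform Om v p + cform M u u v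
        + vemprod (Sedge S) j (chi v B) = load M f v,
      forall F, Vedge Om M F ->
        vemprod (Sedge S) j (fun=> F)
        - Rem^-1 * vemprod (Sface S) (fun=> B) (fun=> wcurl Om F) = 0,
      forall C, Vface Om M C ->
        vemprod (Sface S) (fun=> Bt) (fun=> C)
        + vemprod (Sface S) (fun=> wcurl Om E) (fun=> C) = 0 &
      forall q, Qh Om M q -> bform Om u q = 0].

Definition is_solution (T Re Rem : R) (f : R -> field) (u0 B0 : field)
    (u ut E B Bt : R -> field) (p : R -> 'rV[R]_3 -> R) : Prop :=
  [/\ forall t, 0 < t < T ->
        [/\ Wh Om M (u t), Qh Om M (p t), Vedge Om M (E t) & Vface Om M (B t)],
      forall t, 0 < t < T ->
        [/\ Wh Om M (ut t), time_derivative u t (ut t),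
            Vface Om M (Bt t) & time_derivative B t (Bt t)],
      forall t, 0 < t < T ->
        scheme_at Re Rem (f t) (u t) (ut t) (E t) (B t) (Bt t) (p t) &
      initial_value u u0 /\ initial_value B B0].

End Scheme.

(* Main.v *)
Require Import Defs.
From HB Require Import structures.
From mathcomp Require Import all_boot all_order all_algebra.
From mathcomp Require Import all_classical all_reals all_analysis.
From mathcomp Require Import measurable_realfun ring lra.

Set Implicit Arguments.
Unset Strict Implicit.
Unset Printing Implicit Defensive.

Import Order.TTheory GRing.Theory Num.Theory.
Import numFieldNormedType.Exports.

Local Open Scope classical_set_scope.
Local Open Scope ring_scope.

(** [C := B_t + curl E] is itself an admissible test function for the third
    equation of the scheme, because [curl E] lies in the discrete face space: its
    normal traces are the planar rotations of the tangential traces of [E], and its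
    divergence vanishes.  Testing gives [[C, C]_face = 0], and each element
    contribution is definite; the stabilization only sees [C - Pi0 C], which is in
    the local face space because that space contains the constants.  The normal
    traces of constants are the one place where the divergence theorem on a
    polyhedron is needed: for functions that see a single face [F] it states that
    [int_K d_i phi] is a multiple of [int_F phi], by Fubini along the lines of
    direction [i].

    The divergence of [u] is an admissible pressure (its average vanishes by
    density of the test functions), so testing with it gives [div u = 0].

    For a test function [phi], the time derivative of [(B, grad phi)] is
    [- (curl E, grad phi) = 0], so this flux keeps its initial value
    [- (div B_0, phi) = 0]. *)

(** * Smooth functions *)

(** Differential operators, projections and traces are chosen representatives ([xget]) of relations
    tested against smooth functions, so identities between them hold up to null sets. The
    fundamental lemma is therefore the hinge: it identifies two candidates for the same weak
    divergence or curl almost everywhere, in particular [wcurl] over [Om] with [wcurl] over an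
    element. It is obtained without mollifiers: dilations of $e^{-1/t}$ converge to indicators of
    half-spaces, whose finite intersections generate the sigma-algebra.

    Traces are prescribed face by face, against functions whose support meets the boundary inside
    one open face. Hence only interior points of faces matter, and there the element is locally a
    half-space. The hypothesis on normals speaks of the normal line at each point only; it spreads
    to a neighbourhood because membership in the element cannot change along a segment that avoids
    the boundary. On a coordinate line the indicator of the element then has at most one jump where
    the test function lives, and the one-dimensional fundamental theorem of calculus applies. *)

Lemma near_eq_differentiable (R : realType) (V W : normedModType R)
    (f g : V -> W) (x : V) :
  {near x, f =1 g} -> differentiable f x -> differentiable g x.
Proof.
move=> fg df; have [cf ef] := (diff_locallyP x f).1 df.
have eg : g \o shift x = cst (g x) + 'd f x +o_ (0 : V) id.
  apply/eqaddoP => e e0; move/eqaddoP : ef => /(_ e e0) ef.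
  have fgx : f x = g x by exact: nbhs_singleton fg.
  have : \forall y \near x, f y = g y by [].
  rewrite (near_shift 0 x) subr0 => fgs.
  near=> h; have fgh : f (h + x) = g (h + x) by near: h; exact: fgs.
  have : `|(f \o shift x - (cst (f x) + 'd f x)) h| <= e * `|h| by near: h; exact: ef.
  by rewrite !fctE /= fgx fgh.
apply/diff_locallyP.
have -> : 'd g x = 'd f x :> (V -> W) by exact: diff_unique.
by split.
Unshelve. all: by end_near. Qed.

Section SmoothFunctions.
Context (R : realType) (n : nat).
Implicit Types (f g : 'rV[R]_n -> R) (i j : 'I_n).

Lemma pdE f x i : differentiable f x -> pd i f x = 'd f x (delta_mx 0 i).
Proof. exact: deriveE. Qed.

Lemma pdD f g i x : differentiable f x -> differentiable g x ->
  pd i (f \+ g) x = pd i f x + pd i g x.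
Proof. by move=> df dg; apply: deriveD; exact: diff_derivable. Qed.

Lemma pdM f g i x : differentiable f x -> differentiable g x ->
  pd i (f \* g) x = f x * pd i g x + pd i f x * g x.
Proof.
move=> df dg; rewrite (mulrC (pd i f x)).
by apply: (@deriveM _ _ f g); exact: diff_derivable.
Qed.

Lemma pd_cst (c : R) i : pd i (fun=> c) = fun=> 0.
Proof. by apply/funext => x; exact: derive_cst. Qed.

Lemma pd_coord i j x : pd i (fun y : 'rV[R]_n => y 0 j) x = (i == j)%:R.
Proof.
rewrite /pd deriveE; last exact: differentiable_coord.
have @l : {linear 'rV[R]_n -> R}.
  by exists (fun N : 'rV[R]_n => N 0 j); do 2![eexists]; do ?[constructor];
     rewrite ?mxE// => ? *; rewrite ?mxE//; move=> ?; rewrite !mxE.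
rewrite (_ : (fun _ => _) = l) // diff_lin; last exact: coord_continuous.
by rewrite /= mxE eqxx eq_sym.
Qed.

Lemma near_eq_pd f g i x : {near x, f =1 g} -> pd i f x = pd i g x.
Proof.
by move=> fg; rewrite /pd; apply: near_eq_derive.
Qed.

(* The recursive form of [smooth]: partial derivatives are stripped from the
   inside, so that Leibniz' and the chain rules can be used by induction. *)
Fixpoint smoothk (k : nat) f : Prop := (forall x, differentiable f x) /\
  if k is k'.+1 then forall i, smoothk k' (pd i f) else True.

Lemma smoothk_diff k f : smoothk k f -> forall x, differentiable f x.
Proof. by case: k => [|k] []. Qed.

Lemma smoothkS k f : smoothk k.+1 f -> smoothk k f.
Proof. by elim: k f => [|k IH] f /= [df sf]; split => // i; apply: IH. Qed.

Lemma smoothk_pd k f i : smoothk k.+1 f -> smoothk k (pd i f).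
Proof. by move=> [_]; apply. Qed.

Lemma smoothP f : smooth f <-> forall k, smoothk k f.
Proof.
split=> [sf k|sf s x].
  elim: k f sf => [|k IH] f sf /=; split => //; try by move=> x; exact: (sf [::]).
  move=> i; apply: IH => s x.
  by have := sf (rcons s i) x; rewrite foldr_rcons.
have := sf (size s); elim/last_ind : s f {sf} => [|s i IH] f; first by case.
by rewrite size_rcons foldr_rcons => /smoothk_pd sf; apply: IH.
Qed.

Lemma smooth_differentiable f x : smooth f -> differentiable f x.
Proof. by move=> sf; exact: (sf [::]). Qed.

Lemma smooth_pd f i : smooth f -> smooth (pd i f).
Proof. by move=> /smoothP sf; apply/smoothP => k; have [_] := sf k.+1; exact. Qed.

Lemma smooth_continuous f : smooth f -> continuous f.
Proof. by move=> sf x; apply: differentiable_continuous; exact: smooth_differentiable. Qed.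

Lemma smoothkD k f g : smoothk k f -> smoothk k g -> smoothk k (f \+ g).
Proof.
elim: k f g => [|k IH] f g /= [df sf] [dg sg].
  by split => // x; exact: differentiableD.
split => [x|i]; first exact: differentiableD.
rewrite (_ : pd i (f \+ g) = pd i f \+ pd i g); first exact: IH.
by apply/funext => x; rewrite pdD.
Qed.

Lemma smoothkM k f g : smoothk k f -> smoothk k g -> smoothk k (f \* g).
Proof.
elim: k f g => [|k IH] f g.
  by move=> /= [df _] [dg _]; split => // x; exact: differentiableM.
move=> sf sg; have dfx := smoothk_diff sf; have dgx := smoothk_diff sg.
split => [x|i]; first exact: differentiableM.
rewrite (_ : pd i (f \* g) = (f \* pd i g) \+ (pd i f \* g)).
  by apply: smoothkD; apply: IH; do ?[exact: smoothkS|exact: smoothk_pd].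
by apply/funext => x; rewrite pdM.
Qed.

Lemma smoothD f g : smooth f -> smooth g -> smooth (f \+ g).
Proof. by move=> /smoothP sf /smoothP sg; apply/smoothP => k; exact: smoothkD. Qed.

Lemma smoothM f g : smooth f -> smooth g -> smooth (f \* g).
Proof. by move=> /smoothP sf /smoothP sg; apply/smoothP => k; exact: smoothkM. Qed.

Lemma smooth_cst (c : R) : smooth (fun _ : 'rV[R]_n => c).
Proof.
apply/smoothP => k; elim: k c => [|k IH] c /=.
  by split => // x; exact: differentiable_cst.
by split => [x|i]; [exact: differentiable_cst|rewrite pd_cst].
Qed.

Lemma smooth_coord i : smooth (fun x : 'rV[R]_n => x 0 i).
Proof.
apply/smoothP => -[|k] /=; first by split => // x; exact: differentiable_coord.
split => [x|j]; first exact: differentiable_coord.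
rewrite (_ : pd j _ = fun=> (j == i)%:R); last by apply/funext => x; rewrite pd_coord.
exact: (smoothP _).1 (smooth_cst _) k.
Qed.

Lemma smooth_sum (I : Type) (r : seq I) (F : I -> 'rV[R]_n -> R) :
  (forall j : I, smooth (F j)) -> smooth (fun x => \sum_(i <- r) F i x).
Proof.
move=> sF; elim: r => [|i r IH].
  by under eq_fun do rewrite big_nil; exact: smooth_cst.
by under eq_fun do rewrite big_cons; apply: smoothD.
Qed.

Lemma smooth_prod (I : Type) (r : seq I) (F : I -> 'rV[R]_n -> R) :
  (forall j : I, smooth (F j)) -> smooth (fun x => \prod_(i <- r) F i x).
Proof.
move=> sF; elim: r => [|i r IH].
  by under eq_fun do rewrite big_nil; exact: smooth_cst.
by under eq_fun do rewrite big_cons; apply: smoothM.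
Qed.

Lemma smoothZ (c : R) f : smooth f -> smooth (fun x => c * f x).
Proof. by move=> sf; apply: smoothM => //; exact: smooth_cst. Qed.

Lemma pdZ (c : R) f i x : differentiable f x ->
  pd i (fun y => c * f y) x = c * pd i f x.
Proof.
move=> df; rewrite (pdM (f := fun=> c)) ?pd_cst ?mul0r ?addr0//.
Qed.

Lemma pd_eq0 f i (A : set 'rV[R]_n) : open A -> (forall x, A x -> f x = 0) ->
  forall x, A x -> pd i f x = 0.
Proof.
move=> oA f0 x Ax; rewrite (@near_eq_pd _ (fun=> 0)) ?pd_cst//.
by apply: filterS (open_nbhs_nbhs (conj oA Ax)) => y /f0.
Qed.

(** Every point has a neighbourhood inside [D], where the extension by zero is [f], or inside the
    open complement of [C], where it is 0. Partial derivatives therefore commute with the extension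
    and inherit the vanishing off [C], which drives the induction on the order. The lemma serves to
    turn the trace of a function on an open face into a test function of that face. *)
Lemma smooth_patch (D C : set 'rV[R]_n) f :
  open D -> closed C -> C `<=` D -> smooth f ->
  (forall x, D x -> ~ C x -> f x = 0) -> smooth (f \_ D).
Proof.
move=> oD cC CD sf f0; apply/smoothP => k; move/smoothP/(_ k) : sf.
elim: k f f0 => [|k IH] f f0 sf.
  split => // x; have [Dx|Dx] := pselect (D x).
    apply: (near_eq_differentiable (f := f)); last exact: (smoothk_diff sf).
    by apply: filterS (open_nbhs_nbhs (conj oD Dx)) => y Dy; rewrite patchE mem_set.
  apply: (near_eq_differentiable (f := fun=> 0)); last exact: differentiable_cst.
  have oC : open (~` C) by exact: closed_openC.
  apply: filterS (open_nbhs_nbhs (conj oC (fun h => Dx (CD _ h)))) => y /= Cy.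
  by rewrite patchE; case: ifPn => // /[!inE] /f0 ->.
have P x : differentiable (f \_ D) x /\ forall i, pd i (f \_ D) x = (pd i f \_ D) x.
  have [Dx|Dx] := pselect (D x).
    have ff : {near x, f =1 f \_ D}.
      by apply: filterS (open_nbhs_nbhs (conj oD Dx)) => y Dy; rewrite patchE mem_set.
    split; first by apply: (near_eq_differentiable ff); exact: (smoothk_diff sf).
    by move=> i; rewrite -(near_eq_pd i ff) patchE mem_set.
  have ff : {near x, (fun=> 0 : R) =1 f \_ D}.
    have oC : open (~` C) by exact: closed_openC.
    apply: filterS (open_nbhs_nbhs (conj oC (fun h => Dx (CD _ h)))) => y /= Cy.
    by rewrite patchE; case: ifPn => // /[!inE] /f0 ->.
  split; first by apply: (near_eq_differentiable ff); exact: differentiable_cst.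
  by move=> i; rewrite -(near_eq_pd i ff) pd_cst patchE memNset.
split=> [x|i]; first by case: (P x).
rewrite (_ : pd i (f \_ D) = pd i f \_ D); last by apply/funext => x; case: (P x).
apply: IH; last exact: smoothk_pd.
move=> x Dx Cx; apply: (@pd_eq0 _ _ (D `\` C)) => //.
- by apply: openI => //; exact: closed_openC.
- by move=> y [/f0].
Qed.

Lemma derivable_affine m (A : 'M[R]_(m, n)) (b : 'rV[R]_n) (y : 'rV[R]_m) :
  differentiable (fun y => b + y *m A) y /\
  forall v, 'd (fun y => b + y *m A) y v = v *m A.
Proof.
have dd : differentiable (fun y => b + y *m A) y.
  rewrite (_ : (fun _ => _) = cst b + \sum_(i < m) (fun y : 'rV[R]_m => y 0 i *: row i A)).
    apply: differentiableD; first exact: differentiable_cst.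
    apply: differentiable_sum => i; apply: differentiableZl.
    exact: differentiable_coord.
  apply/funext => z; rewrite /GRing.add /= fct_sumE; congr (_ + _).
  exact: mulmx_sum_row.
split => // v; rewrite -deriveE// /derive.
apply: lim_near_cst => //; near=> h.
have h0 : h != 0 by near: h; exact: nbhs_dnbhs_neq.
have -> : b + (h *: v + y) *m A - (b + y *m A) = h *: (v *m A).
  by rewrite mulmxDl -scalemxAl opprD addrACA subrr add0r addrK.
by rewrite scalerA mulVf ?scale1r.
Unshelve. all: by end_near. Qed.

End SmoothFunctions.

(** * Composition with affine maps and symmetry of second derivatives *)

Section AffineComposition.
Context (R : realType).

Lemma diff_rV n (f : 'rV[R]_n -> R) x v : differentiable f x ->
  'd f x v = \sum_j v 0 j * pd j f x.
Proof.
move=> df; rewrite {1}(row_sum_delta v) linear_sum; apply: eq_bigr => j _.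
by rewrite linearZ pdE.
Qed.

Lemma differentiable_affine m n (A : 'M[R]_(m, n)) (b : 'rV[R]_n) (f : 'rV[R]_n -> R) :
  (forall x, differentiable f x) ->
  forall y, differentiable (fun y => f (b + y *m A)) y.
Proof.
move=> df y; have [dA _] := derivable_affine A b y.
exact: (differentiable_comp (f := fun y => b + y *m A) (g := f)).
Qed.

Lemma pd_affine m n (A : 'M[R]_(m, n)) (b : 'rV[R]_n) (f : 'rV[R]_n -> R) i y :
  (forall x, differentiable f x) ->
  pd i (fun y => f (b + y *m A)) y = \sum_j A i j * pd j f (b + y *m A).
Proof.
move=> df; have [dA eA] := derivable_affine A b y.
rewrite (pdE _ (differentiable_affine A b df y)).
rewrite (@diff_comp _ _ _ _ (fun y => b + y *m A) f)//= eA diff_rV//.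
by apply: eq_bigr => j _; rewrite -rowE mxE.
Qed.

Lemma smooth_affine m n (A : 'M[R]_(m, n)) (b : 'rV[R]_n) (f : 'rV[R]_n -> R) :
  smooth f -> smooth (fun y => f (b + y *m A)).
Proof.
move=> /smoothP sf; apply/smoothP => k; move/(_ k) : sf.
elim: k f => [|k IH] f sf /=.
  by split => // x; exact: (differentiable_affine A b (smoothk_diff sf)).
have df := smoothk_diff sf; split => [x|i]; first exact: differentiable_affine.
rewrite (_ : pd i _ = fun y => \sum_j A i j * pd j f (b + y *m A)); last first.
  by apply/funext => y; rewrite pd_affine.
elim: (index_enum _) => [|j r IHr].
  by under eq_fun do rewrite big_nil; exact: (smoothP _).1 (smooth_cst _) k.
under eq_fun do rewrite big_cons; apply: smoothkD => //.
apply: smoothkM; first exact: (smoothP _).1 (smooth_cst _) k.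
by apply: IH; exact: smoothk_pd.
Qed.

Lemma is_derive_line n (f : 'rV[R]_n -> R) (z v : 'rV[R]_n) (a : R) :
  differentiable f (z + a *: v) ->
  is_derive a (1 : R) (fun a => f (z + a *: v)) ('D_v f (z + a *: v)).
Proof.
move=> df; have := diff_derivable (v := v) df.
rewrite /derivable => H.
have E : (fun h : R => h^-1 *: (((fun a => f (z + a *: v)) \o shift a) (h *: 1) - f (z + a *: v))) =
    (fun h : R => h^-1 *: ((f \o shift (z + a *: v)) (h *: v) - f (z + a *: v))).
  apply/funext => h /=; congr (_ *: (f _ - _)).
  by rewrite scalerDl -scalerA scale1r addrCA.
by split; rewrite ?/derivable ?/derive E.
Qed.

(* The left-hand side is symmetric in i and j, which gives [pdC] as h tends to 0. *)
Lemma second_difference n (f : 'rV[R]_n -> R) x (i j : 'I_n) (h : R) :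
  smooth f -> 0 < h ->
  exists a b, [/\ 0 < a < h, 0 < b < h &
    f (x + h *: delta_mx 0 i + h *: delta_mx 0 j) - f (x + h *: delta_mx 0 i)
    - (f (x + h *: delta_mx 0 j) - f x)
    = pd j (pd i f) (x + a *: delta_mx 0 i + b *: delta_mx 0 j) * h * h].
Proof.
move=> sf h0; set ei := delta_mx 0 i; set ej := delta_mx 0 j.
have df y : differentiable f y by exact: smooth_differentiable.
have dpf k y : differentiable (pd k f) y.
  by apply: smooth_differentiable; exact: smooth_pd.
have D1 (a : R) : is_derive a (1:R) (fun a => f (x + h *: ej + a *: ei) - f (x + a *: ei))
   (pd i f (x + h *: ej + a *: ei) - pd i f (x + a *: ei)).
  by apply: is_deriveB; exact: is_derive_line.
have [|a /[!in_itv]/= ah] := MVT h0 (fun y _ => D1 y).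
  by apply: derivable_within_continuous => y _; case: (D1 y).
rewrite !scale0r !addr0 subr0 => Ea.
have D2 (b : R) : is_derive b (1:R) (fun b => pd i f (x + a *: ei + b *: ej))
   (pd j (pd i f) (x + a *: ei + b *: ej)).
  exact: is_derive_line.
have [|b /[!in_itv]/= bh] := MVT h0 (fun y _ => D2 y).
  by apply: derivable_within_continuous => y _; case: (D2 y).
rewrite scale0r addr0 subr0 => Eb.
exists a, b; split => //; rewrite -Eb (addrAC _ (a *: ei)) -Ea.
by rewrite (addrAC x).
Qed.

(** [ball] is the sup-norm ball, so it is enough to bound each coordinate; when [k] and [k']
    coincide the two steps add up, hence one half of [e] for each. *)
Lemma ball_two_steps n (x : 'rV[R]_n) (e c c' : R) (k k' : 'I_n) :
  0 < c < e / 2 -> 0 < c' < e / 2 ->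
  ball x e (x + c *: delta_mx 0 k + c' *: delta_mx 0 k').
Proof.
move=> /andP[c0 ce] /andP[c0' ce'].
have e0 : 0 < e by rewrite -(@pmulr_lgt0 _ 2^-1) ?invr_gt0// (lt_trans c0 ce).
split=> // l l'; rewrite /ball /= !mxE -addrA opprD addrA subrr sub0r normrN.
rewrite (splitr e) (le_lt_trans (ler_normD _ _))// ltrD// normrM gtr0_norm//.
  by apply: le_lt_trans ce; case: (_ && _); rewrite ?normr1 ?mulr1// normr0 mulr0 ltW.
by apply: le_lt_trans ce'; case: (_ && _); rewrite ?normr1 ?mulr1// normr0 mulr0 ltW.
Qed.

Lemma pdC n (f : 'rV[R]_n -> R) i j x : smooth f ->
  pd i (pd j f) x = pd j (pd i f) x.
Proof.
move=> sf; apply/eqP; rewrite -subr_eq0; apply/negPn/negP => n0.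
set d := `|pd i (pd j f) x - pd j (pd i f) x|.
have d0 : 0 < d / 2 by rewrite divr_gt0 ?normr_gt0.
have cij : {for x, continuous (pd i (pd j f))}.
  by apply: smooth_continuous; do 2!apply: smooth_pd.
have cji : {for x, continuous (pd j (pd i f))}.
  by apply: smooth_continuous; do 2!apply: smooth_pd.
move: cij => /cvgrPdist_lt /(_ _ d0) /nbhs_ballP [e1 /= e10 He1].
move: cji => /cvgrPdist_lt /(_ _ d0) /nbhs_ballP [e2 /= e20 He2].
have [h [h0 h1 h2]] : exists h : R, [/\ 0 < h, h <= e1 / 2 & h <= e2 / 2].
  exists (Num.min e1 e2 / 2); rewrite divr_gt0 ?lt_min ?e10// !ler_pM2r ?invr_gt0//.
  by rewrite !ge_min !lexx orbT.
have [a [b [ah bh E1]]] := second_difference x i j sf h0.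
have [b' [a' [bh' ah' E2]]] := second_difference x j i sf h0.
(* Both mean value forms describe the same second difference, so the two mixed derivatives take a
   common value at intermediate points near [x]; by continuity each value at [x] is within [d / 2]
   of it. *)
have E : pd i (pd j f) (x + b' *: delta_mx 0 j + a' *: delta_mx 0 i) =
         pd j (pd i f) (x + a *: delta_mx 0 i + b *: delta_mx 0 j).
  have hh : h * h != 0 by rewrite mulf_neq0// gt_eqF.
  apply: (mulIf hh); rewrite [LHS]mulrA [RHS]mulrA.
  apply: (etrans (esym E2)); apply: etrans E1; rewrite (addrAC x).
  have K (p q r s : R) : p - q - (r - s) = p - r - (q - s) by ring.
  exact: K.
have lth (c e : R) : 0 < c < h -> h <= e / 2 -> 0 < c < e / 2.
  by move=> /andP[-> ch] he; exact: lt_le_trans he.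
have := He1 _ (ball_two_steps x j i (lth _ _ bh' h1) (lth _ _ ah' h1)).
have := He2 _ (ball_two_steps x i j (lth _ _ ah h2) (lth _ _ bh h2)).
rewrite /= E; set p := pd j (pd i f) (_ + _ + _) => P1 P2.
have : d < d / 2 + d / 2.
  apply: le_lt_trans (ltrD P2 P1).
  have K (u v w : R) : `|u - v| <= `|u - w| + `|v - w|.
    by rewrite (distrC v); exact: ler_distD.
  exact: K.
by rewrite -splitr ltxx.
Qed.

End AffineComposition.

(** * Lebesgue measure on row vectors *)

Section MeasurableRV.
Context (R : realType) (n : nat).
Implicit Types (D : set 'rV[R]_n) (f g : 'rV[R]_n -> R).

Lemma measurable_coord (i : 'I_n) :
  measurable_fun [set: 'rV[R]_n] (fun x : 'rV[R]_n => x 0 i : measurableTypeR R).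
Proof.
move=> _ Y mY; apply: sub_sigma_algebra.
by rewrite -bigcup_seq; exists i; [rewrite /= mem_index_enum|exists Y].
Qed.

Lemma measurable_ball_rV (x : 'rV[R]_n) (e : R) : measurable (ball x e).
Proof.
have [e0|e0] := ltP 0 e; last first.
  rewrite (_ : ball x e = set0)//; apply/seteqP; split => // y [].
  by rewrite ltNge e0.
rewrite (_ : ball x e = \big[setI/setT]_(i < n)
    ((fun y : 'rV[R]_n => y 0 i) @^-1` ball (x 0 i) e)).
  apply: bigsetI_measurable => i _.
  rewrite -[X in measurable X]setTI.
  by apply: (measurable_coord i) => //; rewrite ball_itv; exact: measurable_itv.
rewrite -bigcap_seq; apply/seteqP; split => y.
  by move=> [_ xy] i _; exact: xy.
by move=> xy; split => // i j; rewrite (ord1 i); apply: xy; rewrite /= mem_index_enum.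
Qed.

(** Countably many balls, each with its double inside [D]: the margin leaves room for a smooth bump
    around each ball with compact support in [D]. *)
Lemma open_rV_cover D : open D -> D = \bigcup_(p in
    [set p : 'rV[rat]_n * nat | ball (map_mx ratr p.1 : 'rV[R]_n) (p.2.+1%:R^-1 *+ 2) `<=` D])
  ball (map_mx ratr p.1 : 'rV[R]_n) p.2.+1%:R^-1.
Proof.
move=> oD; apply/seteqP; split => [x Dx|x [p /= pD xp]]; last first.
  by apply: pD; apply: le_ball xp; rewrite mulr2n lerDl invr_ge0.
have /nbhs_ballP[e /= e0 xeD] := open_nbhs_nbhs (conj oD Dx).
(* A radius and a doubled radius add up to three times $1/(k+1)$, hence the third of [e]. *)
have [k ke] : exists k : nat, k.+1%:R^-1 < e / 3.
  have [k hk] := @ltr_add_invr R 0 (e / 3) (divr_gt0 e0 (ltr0Sn _ _)).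
  by exists k; move: hk; rewrite add0r.
have k0 : 0 < k.+1%:R^-1 :> R by rewrite invr_gt0.
have H (j : 'I_n) : exists q : rat, `|x 0 j - ratr q| < k.+1%:R^-1.
  have /rat_in_itvoo[q /itvP qx] : x 0 j - k.+1%:R^-1 < x 0 j + k.+1%:R^-1.
    by rewrite ltrBlDr -addrA ltrDl addr_gt0.
  by exists q; rewrite ltr_distlC !qx.
have [q qx] := choice H.
have xq : ball (map_mx ratr (\row_j q j) : 'rV[R]_n) k.+1%:R^-1 x.
  by split => // i j; rewrite (ord1 i) !mxE /ball/= distrC; exact: qx.
exists (\row_j q j, k) => //= y qy; apply: xeD.
apply: (@le_ball _ _ _ (k.+1%:R^-1 + k.+1%:R^-1 *+ 2)).
  move: ke; rewrite ltr_pdivlMr// => /ltW; apply: le_trans.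
  by rewrite -mulrS mulr_natr.
by apply: ball_triangle qy; exact: ball_sym.
Qed.

Lemma open_measurable_rV D : open D -> measurable D.
Proof.
move=> oD; rewrite (open_rV_cover oD).
rewrite bigcup_mkcond; apply: countable_bigcupT_measurable => // p.
by case: ifP => // _; exact: measurable_ball_rV.
Qed.

(** With lists, intersection is concatenation and the whole space is the empty list. The inequality
    is strict because the indicators of open half-spaces are the limits of the dilated bumps
    below. *)
Definition halfspaces (l : seq ('I_n * R)) : set 'rV[R]_n :=
  [set x | all (fun p => p.2 < x 0 p.1) l].

Lemma measurable_halfspacesE :
  measurable = <<s range halfspaces >> :> set (set 'rV[R]_n).
Proof.
apply/seteqP; split; last first.
  apply: smallest_sub; first exact: sigma_algebra_measurable.
  move=> _ [l _ <-]; elim: l => [|p l IH].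
    rewrite (_ : halfspaces [::] = setT); first exact: measurableT.
    by apply/seteqP; split.
  rewrite (_ : halfspaces _ = (fun x : 'rV[R]_n => x 0 p.1) @^-1` `]p.2, +oo[ `&` halfspaces l).
    apply: measurableI => //; rewrite -[X in measurable X]setTI.
    by apply: measurable_coord => //; exact: measurable_itv.
  by apply/seteqP; split => x /=; rewrite in_itv/= andbT => /andP.
apply: smallest_sub; first exact: smallest_sigma_algebra.
rewrite -bigcup_seq => A [i _]; rewrite /= RGenOInfty.measurableE.
rewrite -g_sigma_preimageE; apply: smallest_sub; first exact: smallest_sigma_algebra.
move=> _ [_ [a ->] <-]; apply: sub_sigma_algebra; exists [:: (i, a)] => //.
by rewrite setTI; apply/seteqP; split => x /=; rewrite /halfspaces/= in_itv/= !andbT.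
Qed.

Lemma closed_measurable_rV D : closed D -> measurable D.
Proof.
by move=> cD; rewrite -(setCK D); apply: measurableC; apply: open_measurable_rV; exact: closed_openC.
Qed.

Lemma continuous_measurable_rV f : continuous f -> measurable_fun setT f.
Proof.
move=> cf; apply: (measurability _ (RGenOpens.measurableE R)).
move=> _ [_ [a [b ->]] <-]; rewrite setTI; apply: open_measurable_rV.
by apply: open_comp => // x _; exact: cf.
Qed.

End MeasurableRV.

Lemma ord3P (j : 'I_3) : [\/ j = 0, j = 1 | j = 2].
Proof.
by case: j => -[|[|[|//]]] j3; [apply: Or31|apply: Or32|apply: Or33]; exact: val_inj.
Qed.

(** * Lebesgue measure in space: Fubini along any axis, cubes, planes *)

Section LebesgueR3.
Context (R : realType).
Local Notation RB := (measurableTypeR R).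
Local Notation mu := (@lebesgue_measure R).
Local Notation P3 := (RB * RB * RB)%type.

(* The point of R^3 with coordinate i equal to p.2, the two other coordinates
   being filled in order by p.1. *)
Definition ins (i : 'I_3) (p : P3) : 'rV[R]_3 :=
  row3 (nth p [:: (p.2, p.1.1, p.1.2); (p.1.1, p.2, p.1.2)] i).

Lemma measurable_ins i : measurable_fun setT (ins i).
Proof.
apply: measurableT_comp; first exact: measurable_row3.
have m1 : measurable_fun [set: P3] (fun p : P3 => p.1.1).
  exact: (measurableT_comp (@measurable_fst _ _ RB RB) (@measurable_fst _ _ (RB * RB)%type RB)).
have m2 : measurable_fun [set: P3] (fun p : P3 => p.1.2).
  exact: (measurableT_comp (@measurable_snd _ _ RB RB) (@measurable_fst _ _ (RB * RB)%type RB)).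
have m3 : measurable_fun [set: P3] (fun p : P3 => p.2) by exact: measurable_snd.
case: i => -[|[|[|//]]] ? /=; last exact: measurable_id.
  by do 2!apply: measurable_fun_pair => //.
by do 2!apply: measurable_fun_pair => //.
Qed.

Lemma ins_shift i a (t : R) : ins i (a, t) = ins i (a, 0) + t *: delta_mx 0 i.
Proof.
apply/rowP => j; rewrite !mxE.
by case: i => -[|[|[|//]]] ? /=; case: j => -[|[|[|//]]] ? /=;
  rewrite ?mulr0 ?mulr1 ?addr0 ?add0r.
Qed.

Lemma ins_coord i a (t : R) : ins i (a, t) 0 i = t.
Proof. by rewrite mxE; case: i => -[|[|[|//]]]. Qed.

Lemma sigma_finite_lebesgue2 : sigma_finite setT (mu \x mu)%E.
Proof.
have /sigma_finiteP[F [TF ndF Foo]] := sigma_finiteT mu.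
exists (fun n => F n `*` F n).
  rewrite -setXTT TF predeqE => -[x y]; split.
    move=> [/= [n _ Fnx] [k _ Fky]]; exists (maxn n k) => //; split.
    - by move: x Fnx; exact/subsetPset/ndF/leq_maxl.
    - by move: y Fky; exact/subsetPset/ndF/leq_maxr.
  by move=> [n _ []/= ? ?]; split; exists n.
move=> k; have [? ?] := Foo k.
split; first exact: measurableX.
by rewrite product_measure1E// lte_mul_pinfty// ge0_fin_numE.
Qed.

(** The planar measure packed with its sigma-finiteness, so that it can serve as a factor in the
    Tonelli and Fubini theorems on the triple product. *)
Definition lebesgue2 : {sigma_finite_measure set (RB * RB)%type -> \bar R} :=
  HB.pack (mu \x mu)%E
    (Measure_isSigmaFinite.Build _ _ _ (mu \x mu)%E sigma_finite_lebesgue2).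

Lemma triple_tonelli (f : P3 -> \bar R) : (forall p, 0 <= f p)%E ->
  measurable_fun setT f ->
  (\int[(mu \x mu) \x mu]_p f p = \int[mu]_x \int[mu]_y \int[mu]_z f (x, y, z))%E.
Proof.
move=> f0 mf.
have F0 p : (0 <= fubini_F mu f p)%E by exact: integral_ge0.
have mF := @measurable_fun_fubini_tonelli_F _ _ _ _ _ mu f mf f0.
transitivity (\int[mu \x mu]_q fubini_F mu f q)%E.
  exact: (@fubini_tonelli1 _ _ _ _ _ lebesgue2 mu f mf f0).
exact: (@fubini_tonelli1 _ _ _ _ _ mu mu (fubini_F mu f) mF F0).
Qed.

(** Invariance under permutation of the axes: Tonelli turns both sides into iterated integrals of
    the same indicator, and the order of integration is corrected by no, one or two exchanges for
    [i] equal to 2, 1, 0. *)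
Lemma leb3_ins i A : measurable A ->
  leb3 A = ((mu \x mu) \x mu)%E (ins i @^-1` A).
Proof.
move=> mA; pose B := @row3 R @^-1` A; pose f := EFin \o (\1_B : P3 -> R).
have mB : measurable B.
  by rewrite -[X in measurable X]setTI; exact: measurable_row3.
have mf : measurable_fun [set: P3] f by apply/measurable_EFinP; exact: measurable_indic.
have f0 p : (0 <= f p)%E by rewrite lee_fin.
have mi : measurable (ins i @^-1` A).
  by rewrite -[X in measurable X]setTI; exact: measurable_ins.
have -> : leb3 A = (\int[mu]_x \int[mu]_y \int[mu]_z f (x, y, z))%E.
  rewrite -triple_tonelli//.
  by rewrite integral_indic// setIT.
have -> : ((mu \x mu) \x mu)%E (ins i @^-1` A) =
    (\int[(mu \x mu) \x mu]_p f (nth p [:: (p.2, p.1.1, p.1.2); (p.1.1, p.2, p.1.2)] i))%E.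
  transitivity (\int[(mu \x mu) \x mu]_p (\1_(ins i @^-1` A) p)%:E)%E.
    by rewrite integral_indic// setIT.
  by apply: eq_integral => p _; rewrite /f /= !indicE.
have m1 : measurable_fun [set: P3] (fun p : P3 => p.1.1).
  exact: (measurableT_comp (@measurable_fst _ _ RB RB) (@measurable_fst _ _ (RB * RB)%type RB)).
have m2 : measurable_fun [set: P3] (fun p : P3 => p.1.2).
  exact: (measurableT_comp (@measurable_snd _ _ RB RB) (@measurable_fst _ _ (RB * RB)%type RB)).
have m3 : measurable_fun [set: P3] (fun p : P3 => p.2) by exact: measurable_snd.
rewrite triple_tonelli; [|by move=> p; exact: f0|].
- have swap x : (\int[mu]_y \int[mu]_z f (x, y, z) = \int[mu]_z \int[mu]_y f (x, y, z))%E.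
    rewrite (@fubini_tonelli _ _ _ _ _ mu mu (fun q : RB * RB => f (x, q.1, q.2)))//.
    apply: measurableT_comp => //; apply: measurable_fun_pair => //.
    by apply: measurable_fun_pair.
  case: i mi => -[|[|[|//]]] ? /= mi.
  + have F0 p : (0 <= fubini_F mu f p)%E by exact: integral_ge0.
    have mF := @measurable_fun_fubini_tonelli_F _ _ _ _ _ mu f mf f0.
    apply: etrans (@fubini_tonelli _ _ _ _ _ mu mu (fubini_F mu f) mF F0) _.
    apply: eq_integral => y _.
    rewrite (@fubini_tonelli _ _ _ _ _ mu mu (fun q : RB * RB => f (q.1, y, q.2)))//.
    apply: measurableT_comp => //; apply: measurable_fun_pair => //.
    by apply: measurable_fun_pair.
  + by apply: eq_integral => x _; exact: swap.
  + by [].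
- apply: measurableT_comp => //.
  case: i {mi} => -[|[|[|//]]] ? /=; last exact: measurable_id.
    by do 2!apply: measurable_fun_pair => //.
  by do 2!apply: measurable_fun_pair => //.
Qed.

Lemma integral_leb3 (i : 'I_3) (f : 'rV[R]_3 -> \bar R) : (@leb3 R).-integrable setT f ->
  (\int[@leb3 R]_x f x = \int[mu \x mu]_p \int[mu]_t f (ins i (p, t)))%E.
Proof.
move=> fi; have mf := measurable_int _ fi.
pose m' := measure_function_pushforward__canonical__measure_function_Measure
  ((mu \x mu) \x mu)%E (measurable_ins i).
have E A : measurable A -> A `<=` setT -> @leb3 R A = m' A.
  by move=> mA _; rewrite (leb3_ins i).
rewrite (eq_measure_integral m' E).
have fi' : ((mu \x mu) \x mu)%E.-integrable setT (f \o ins i).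
  apply/integrableP; split; first by apply: measurableT_comp => //; exact: measurable_ins.
  case/integrableP : fi => _; rewrite (eq_measure_integral m' E).
  rewrite ge0_integral_pushforward//; try exact: measurable_ins.
  exact: measurableT_comp.
rewrite integral_pushforward//; do ?exact: measurable_ins.
exact: esym (@integral12_prod_meas1 _ _ _ _ _ lebesgue2 mu _ fi').
Qed.

Lemma leb3_ball (x : 'rV[R]_3) (e : R) : 0 < e -> leb3 (ball x e) = ((e *+ 2) ^+ 3)%:E.
Proof.
move=> e0.
have mB i : measurable (ball (x 0 i) e : set RB) by rewrite ball_itv; exact: measurable_itv.
have muB i : mu (ball (x 0 i) e) = (e *+ 2)%:E.
  rewrite ball_itv lebesgue_measure_itv/= lte_fin ltrD2l gt0_cp// -EFinB.
  by rewrite opprD opprK addrACA subrr add0r mulr2n.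
rewrite /leb3 /= /pushforward (_ : _ @^-1` _ =
    (ball (x 0 0) e `*` ball (x 0 1) e) `*` ball (x 0 2) e).
  rewrite product_measure1E//; last exact: measurableX.
  transitivity ((e *+ 2)%:E * (e *+ 2)%:E * (e *+ 2)%:E)%E.
    congr (_ * _)%E; last exact: muB.
    by rewrite /= product_measure1E//; congr (_ * _)%E; exact: muB.
  by rewrite -!EFinM !exprS expr0 mulr1 mulrA.
apply/seteqP; split => -[[a b] c] /=.
  by move=> [_ /(_ 0) xy]; split; [split|]; have := xy _; [move/(_ 0)|move/(_ 1)|move/(_ 2)]; rewrite mxE.
move=> [[xa xb] xc]; split => // i j; rewrite (ord1 i) mxE.
by case: (ord3P j) => ->.
Qed.

Lemma leb3_bounded (D : set 'rV[R]_3) : measurable D -> bounded_set D -> (leb3 D < +oo)%E.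
Proof.
move=> mD [M [_ /(_ (`|M| + 1))]] DM.
have DB : D `<=` ball (0 : 'rV[R]_3) (`|M| + 2).
  move=> x /DM; rewrite -ball_normE /ball_/= sub0r normrN => H.
  apply: le_lt_trans (H _) _; last by rewrite ltrD2l ltr1n.
  by rewrite (le_lt_trans (ler_norm _))// ltrDl.
apply: (@le_lt_trans _ _ (leb3 (ball (0 : 'rV[R]_3) (`|M| + 2)))).
  by apply: le_measure => //; rewrite inE//; exact: measurable_ball_rV.
by rewrite leb3_ball ?ltry// ltr_wpDl.
Qed.

Lemma leb3_open_gt0 (D : set 'rV[R]_3) : open D -> D !=set0 -> (0 < leb3 D)%E.
Proof.
move=> oD [x Dx]; have /nbhs_ballP[e /= e0 xeD] := open_nbhs_nbhs (conj oD Dx).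
apply: (@lt_le_trans _ _ (leb3 (ball x e))).
  by rewrite leb3_ball// lte_fin exprn_gt0// pmulrn_lgt0.
apply: le_measure => //; rewrite inE; first exact: measurable_ball_rV.
exact: open_measurable_rV.
Qed.

Lemma dotDr n (u v w : 'rV[R]_n) : dot u (v + w) = dot u v + dot u w.
Proof. by rewrite /dot -big_split; apply: eq_bigr => i _ /=; rewrite mxE mulrDr. Qed.

Lemma dotZr n (a : R) (u v : 'rV[R]_n) : dot u (a *: v) = a * dot u v.
Proof. by rewrite /dot mulr_sumr; apply: eq_bigr => i _; rewrite mxE mulrCA. Qed.

Lemma dotC n (u v : 'rV[R]_n) : dot u v = dot v u.
Proof. by apply: eq_bigr => i _; rewrite mulrC. Qed.

Lemma dot_delta n (u : 'rV[R]_n) i : dot u (delta_mx 0 i) = u 0 i.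
Proof.
rewrite /dot (bigD1 i)//= mxE !eqxx mulr1 big1 ?addr0// => j ji.
by rewrite mxE eqxx (negbTE ji) mulr0.
Qed.

Lemma dot_ins (v : 'rV[R]_3) i a t : dot v (ins i (a, t)) = dot v (ins i (a, 0)) + t * v 0 i.
Proof. by rewrite ins_shift dotDr dotZr dot_delta. Qed.

Lemma continuous_dot n (v : 'rV[R]_n) : continuous (fun x : 'rV[R]_n => dot v x).
Proof.
apply: smooth_continuous; apply: smooth_sum => i.
by apply: smoothZ; exact: smooth_coord.
Qed.

(** A line in a direction [i] with [v 0 i] nonzero meets the plane in at most one point, so all
    sections in that direction are null. *)
Lemma leb3_plane (v : 'rV[R]_3) (c : R) : v != 0 -> leb3 [set x | dot v x = c] = 0%E.
Proof.
move=> /rV0Pn[i vi0].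
have mP : measurable [set x | dot v x = c].
  have -> : [set x | dot v x = c] = (dot v) @^-1` [set c] by [].
  apply: closed_measurable_rV; apply: closed_comp => [x _|].
    exact: continuous_dot.
  exact: closed_eq.
rewrite (leb3_ins i mP).
change ((\int[mu \x mu]_p (mu \o xsection (ins i @^-1` [set x | dot v x = c])) p)%E = 0%E).
apply: integral0_eq => p _.
have sub : xsection (ins i @^-1` [set x | dot v x = c]) p
    `<=` [set (c - dot v (ins i (p, 0))) / v 0 i].
  move=> t; rewrite /xsection /= inE /= dot_ins => <-.
  by rewrite addrC addKr mulfK.
apply: (subset_measure0 _ _ sub); last exact: lebesgue_measure_set1; last by [].
apply: measurable_xsection; rewrite -[X in measurable X]setTI.
exact: measurable_ins.
Qed.

End LebesgueR3.

(** * The fundamental lemma of the calculus of variations *)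

Section Bump.
Context (R : realType).

(** For [k = 0] this is the classical flat function $e^{-1/t}$; the powers of $1/t$ make the family
    closed under differentiation up to linear combinations. *)
Definition ebump (k : nat) (t : R) : R := if 0 < t then t^-1 ^+ k * expR (- t^-1) else 0.

(** Since $s/n\le e^{s/n}$, raising to the power $n$ gives $(s/n)^n\le e^s$. *)
Lemma expR_dominates (n : nat) (s : R) : 0 <= s -> s ^+ n * expR (- s) <= n%:R ^+ n.
Proof.
move=> s0; case: n => [|n]; first by rewrite !expr0 mul1r -expR0 ler_expR oppr_le0.
rewrite expRN ler_pdivrMr ?expR_gt0//.
have -> : expR s = expR (s / n.+1%:R) ^+ n.+1.
  by rewrite -expRM_natl mulrCA divff// mulr1.
rewrite -exprMn lerXn2r ?nnegrE ?mulr_ge0 ?expR_ge0//.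
rewrite -ler_pdivrMl ?ltr0n// mulrC.
by apply: le_trans (expR_ge1Dx _); rewrite lerDr.
Qed.

Lemma ebump_ge0 k t : 0 <= ebump k t.
Proof.
rewrite /ebump; case: ifPn => // t0.
by rewrite mulr_ge0 ?expR_ge0// exprn_ge0// invr_ge0 ltW.
Qed.

(** [expR_dominates] at $s=1/t$ with exponent $k+2$; two powers of $t$ are kept so that the
    difference quotient at 0 tends to 0. *)
Lemma ebump_quadratic k t : ebump k t <= k.+2%:R ^+ k.+2 * t ^+ 2.
Proof.
rewrite /ebump; case: ifPn => t0; last by rewrite mulr_ge0 ?sqr_ge0.
have t2 : 0 < t ^+ 2 by rewrite exprn_gt0.
rewrite -ler_pdivrMr//; apply: le_trans (expR_dominates k.+2 (s := t^-1) _).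
  rewrite mulrAC ler_wpM2r ?expR_ge0// -exprVn -exprD addn2.
  by rewrite lexx.
by rewrite invr_ge0 ltW.
Qed.

Lemma is_derive_ebump k (t : R) :
  is_derive t (1 : R) (ebump k) (ebump k.+2 t - k%:R * ebump k.+1 t).
Proof.
have [t0|t0|->] := ltgtP t 0.
- rewrite /ebump !ltNge (ltW t0)/= mulr0 subr0.
  apply: (@near_eq_is_derive _ _ _ (cst 0) _ t).
  have : \forall s \near t, s < 0 by exact: lt_nbhsl.
  by apply: filterS => s s0; rewrite ltNge (ltW s0).
- have tn0 : t != 0 by rewrite gt_eqF.
  apply: (@near_eq_is_derive _ _ _ ((fun s => s ^+ k * expR (- s)) \o (fun s => s^-1)) _ t).
    have : \forall s \near t, 0 < s by exact: lt_nbhsr.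
    by apply: filterS => s s0; rewrite /ebump /= s0.
  have d1 : is_derive t^-1 1 (fun s : R => s ^+ k * expR (- s))
    (k%:R * t^-1 ^+ k.-1 * expR (- t^-1) - t^-1 ^+ k * expR (- t^-1)).
    have dX : is_derive t^-1 1 (fun s : R => s ^+ k) (k%:R * t^-1 ^+ k.-1).
      have := @is_deriveX _ _ id k t^-1 1 1 (is_derive_id _ _).
      by rewrite (_ : id ^+ k = (fun s : R => s ^+ k)) /GRing.scale/= ?mulr1//; apply/funext => s; rewrite fctE.
    have dE : is_derive t^-1 1 (fun s : R => expR (- s)) (- expR (- t^-1)).
      have := is_derive1_comp (is_derive_expR (- t^-1)) (is_deriveNid t^-1 1).
      by rewrite mulrN1.
    have := is_deriveM dX dE.
    by move=> /is_derive_eq; apply; rewrite /GRing.scale/=; ring.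
  have d2 : is_derive t 1 (fun s : R => s^-1) (- t^-1 ^+ 2).
    have := @is_deriveV _ id t 1 1 tn0 (is_derive_id _ _).
    by move=> /is_derive_eq; apply; rewrite /GRing.scale/= mulr1 exprVn.
  have := is_derive1_comp d1 d2; move=> /is_derive_eq; apply.
  rewrite /ebump t0; case: k {d1} => [|k] /=; first by rewrite !mul0r !expr0 subr0 add0r; ring.
  by rewrite !exprS; ring.
(* At 0 the claimed derivative is 0, and the quotient is at most $(k+2)^{k+2}|h|$; the summand 1 in
   the denominator below keeps it positive. *)
- rewrite /ebump ltxx mulr0 subr0.
  have C0 : 0 <= k.+2%:R ^+ k.+2 :> R by rewrite exprn_ge0.
  suff H : (fun h : R => h^-1 *: ((ebump k \o shift 0) (h *: 1) - ebump k 0)) @ 0^' --> 0.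
    by split; [apply/cvg_ex; exists 0|exact: cvg_lim H].
  apply/cvgrPdist_le => e e0.
  have : \forall h \near (0:R)^', `|h| <= e / (1 + k.+2%:R ^+ k.+2).
    by apply: dnbhs0_le; rewrite divr_gt0// ltr_pwDl.
  apply: filterS => h he.
  rewrite sub0r normrN {2}/ebump ltxx subr0 /= addr0 /GRing.scale/= mulr1.
  have [->|h0] := eqVneq h 0; first by rewrite invr0 mul0r normr0 ltW.
  rewrite normrM (ger0_norm (ebump_ge0 _ _)) normfV.
  apply: (@le_trans _ _ (`|h|^-1 * (k.+2%:R ^+ k.+2 * h ^+ 2))).
    by rewrite ler_wpM2l ?invr_ge0// ebump_quadratic.
  rewrite -(real_normK (num_real h)) mulrC -mulrA expr2 mulfK ?normr_eq0//.
  move: he; rewrite ler_pdivlMr ?ltr_pwDl// mulrC; apply: le_trans.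
  by rewrite ler_wpM2l// lerDr.
Qed.

Lemma ebump_le1 t : ebump 0 t <= 1.
Proof.
rewrite /ebump; case: ifPn => // t0.
by rewrite expr0 mul1r -expR0 ler_expR oppr_le0 invr_ge0 ltW.
Qed.

Lemma ebump_gt0 k t : (0 < ebump k t) = (0 < t).
Proof.
rewrite /ebump; case: ifPn => [t0|]; last by rewrite ltxx => /negbTE.
by rewrite mulr_gt0 ?expR_gt0// exprn_gt0// invr_gt0.
Qed.

Lemma ebump_eq0 k t : t <= 0 -> ebump k t = 0.
Proof. by move=> t0; rewrite /ebump ltNge t0. Qed.

(** Smooth approximation, with values in $[0,1]$, of the indicator of the open half-line; at 0
    itself every term vanishes, which is why the limit carries a strict inequality. *)
Lemma cvg_ebump_dilation t :
  (fun N : nat => ebump 0 (N.+1%:R * t)) @ \oo --> ((0 < t)%R%:R : R).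
Proof.
rewrite /ebump; case: (ltP 0 t) => t0; last first.
  under eq_fun do rewrite pmulr_rgt0// ltNge t0/=.
  exact: cvg_cst.
under eq_fun do rewrite pmulr_rgt0// t0 expr0 mul1r invfM -mulNr.
rewrite (_ : true%:R = expR (- 0 / t)); last by rewrite oppr0 mul0r expR0.
apply: continuous_cvg; first exact: continuous_expR.
apply: cvgMl; apply: cvgN; exact: cvg_harmonic.
Qed.

(** The derivative of a member of the family is a combination of members with larger exponents, so
    the induction on the order runs over all [k] at once. *)
Lemma smooth_ebump n k (a b : R) (i : 'I_n) :
  smooth (fun x : 'rV[R]_n => ebump k (a + b * x 0 i)).
Proof.
have dl x : differentiable (fun x : 'rV[R]_n => a + b * x 0 i) x.
  by apply: smooth_differentiable; apply: smoothD; [exact: smooth_cst|apply: smoothZ; exact: smooth_coord].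
have db k' t : differentiable (ebump k') t.
  by apply/derivable1_diffP; case: (is_derive_ebump k' t).
have dc k' x : differentiable (fun x : 'rV[R]_n => ebump k' (a + b * x 0 i)) x.
  exact: (differentiable_comp (f := fun x : 'rV[R]_n => a + b * x 0 i) (g := ebump k')).
apply/smoothP => m; elim: m k => [|m IH] k; first by split.
split => // j.
rewrite (_ : pd j _ = fun x : 'rV[R]_n => (b * (i == j)%:R) *
    (ebump k.+2 (a + b * x 0 i) + (- k%:R) * ebump k.+1 (a + b * x 0 i))).
  apply: smoothkM; first exact: (smoothP _).1 (smooth_cst _) m.
  apply: smoothkD => //; apply: smoothkM => //.
  exact: (smoothP _).1 (smooth_cst _) m.
apply/funext => x; rewrite (pdE _ (dc k x)).
rewrite (@diff_comp _ _ _ _ (fun x : 'rV[R]_n => a + b * x 0 i) (ebump k))//=.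
rewrite -(pdE _ (dl x)) diff1E// derive1E.
rewrite (@derive_val _ _ _ _ _ _ _ (is_derive_ebump k (a + b * x 0 i))).
rewrite (pdD (f := fun=> a) (g := fun y : 'rV[R]_n => b * y 0 i)); last 2 first.
- exact: differentiable_cst.
- by apply: smooth_differentiable; apply: smoothZ; exact: smooth_coord.
rewrite pd_cst add0r (@pdZ _ _ b (fun y : 'rV[R]_n => y 0 i)); last exact: differentiable_coord.
by rewrite pd_coord eq_sym /GRing.scale/= mulNr.
Qed.

End Bump.

Section BallBump.
Context (R : realType) (n : nat).

(* Positive exactly on the ball of center c and radius r. *)
Definition bbump (c : 'rV[R]_n) (r : R) : 'rV[R]_n -> R := fun x =>
  \prod_i (ebump 0 ((r - c 0 i) + 1 * x 0 i) * ebump 0 ((r + c 0 i) + (- 1) * x 0 i)).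

Lemma smooth_bbump c r : smooth (bbump c r).
Proof. by apply: smooth_prod => i; apply: smoothM; exact: smooth_ebump. Qed.

Lemma bbump_gt0 c r x : ball c r x -> 0 < bbump c r x.
Proof.
move=> [r0 cx]; apply: prodr_gt0 => i _; have := cx 0 i.
rewrite /ball/= ltr_distlC => /andP[c1 c2].
rewrite mul1r mulN1r mulr_gt0// ebump_gt0 ?subr_gt0 1?addrC//.
by rewrite addrA subr_gt0 -ltrBlDr.
Qed.

Lemma bbump_le1 c r x : 0 <= bbump c r x <= 1.
Proof.
apply: (big_ind (fun y : R => 0 <= y <= 1)) => [|y z /andP[y0 y1] /andP[z0 z1]|i _].
- by rewrite ler01 lexx.
- by rewrite mulr_ge0//= mulr_ile1.
- by rewrite mulr_ge0 ?ebump_ge0//= mulr_ile1 ?ebump_ge0 ?ebump_le1.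
Qed.

(** The closed counterpart of the sup-norm ball, which carries the support of [bbump]; as a product
    of segments it is visibly compact. *)
Definition cbox (c : 'rV[R]_n) (r : R) : set 'rV[R]_n :=
  [set x | forall i, `[c 0 i - r, c 0 i + r]%classic (x 0 i)].

Lemma compact_cbox c r : compact (cbox c r).
Proof.
have := @rV_compact R n (fun i => `[c 0 i - r, c 0 i + r]%classic).
by apply => i; exact: segment_compact.
Qed.

Lemma bbump_out c r x : ~ cbox c r x -> bbump c r x = 0.
Proof.
move=> /existsNP[i /negP]; rewrite /bbump (bigD1 i)//=.
rewrite in_itv/= negb_and -!ltNge => /orP[h|h].
  by rewrite (@ebump_eq0 _ _ (r - _ + _)) ?mul0r//; lra.
by rewrite (@ebump_eq0 _ _ (r + c 0 i + _)) ?mulr0 ?mul0r//; lra.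
Qed.

Lemma cbox_ball c r s : 0 < r -> r < s -> cbox c r `<=` ball c s.
Proof.
move=> r0 rs x cx; split; first exact: lt_trans rs.
move=> i j; rewrite (ord1 i) /ball/= distrC; apply: le_lt_trans rs.
have /itvP /= h := cx j.
by rewrite ler_norml lerBrDl h/= lerBlDl h.
Qed.

Lemma testfun_bbump_mul (D : set 'rV[R]_n) c r (psi : 'rV[R]_n -> R) :
  0 < r -> ball c (r *+ 2) `<=` D -> smooth psi ->
  testfun D (fun x => bbump c r x * psi x).
Proof.
move=> r0 bD spsi; split; first by apply: smoothM => //; exact: smooth_bbump.
exists (cbox c r); split; first exact: compact_cbox.
  by apply: subset_trans bD; apply: cbox_ball => //; rewrite mulr2n ltrDl.
by move=> x /bbump_out ->; rewrite mul0r.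
Qed.

End BallBump.

Section FundamentalLemma.
Context (R : realType) (n : nat) (m : {measure set 'rV[R]_n -> \bar R}).

Lemma ae_countable (T : countType) (P : T -> 'rV[R]_n -> Prop) :
  (forall i, {ae m, forall x, P i x}) -> {ae m, forall x, forall i, P i x}.
Proof.
move=> H.
have : {ae m, forall x, forall k : nat, forall i : T, unpickle k = Some i -> P i x}.
  apply/ae_foralln => k; case: (unpickle k) => [i|]; last exact: aeW.
  by apply: filterS (H i) => x Px j [<-].
by apply: filterS => x Px i; exact: (Px (pickle i)) (pickleK i).
Qed.

(* The finite intersections of half-spaces form a pi-system. *)
Lemma integral_halfspaces_eq0 (f : 'rV[R]_n -> R) : m.-integrable setT (EFin \o f) ->
  (forall l, (\int[m]_(x in halfspaces l) (f x)%:E = 0)%E) ->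
  {ae m, forall x, f x = 0}.
Proof.
move=> fi f0.
have intA A : measurable A -> m.-integrable A (EFin \o f).
  by move=> mA; apply: integrableS fi.
have fA A : measurable A -> (\int[m]_(x in A) (f x)%:E = 0)%E.
  move=> mA; have : <<s range (@halfspaces R n) >> A by rewrite -measurable_halfspacesE.
  apply: (@dynkin_induction _ 'rV[R]_n (range (@halfspaces R n))
    (fun A => (\int[m]_(x in A) (f x)%:E = 0)%E)) => //.
  - exact: measurable_halfspacesE.
  - move=> _ _ [l _ <-] [l' _ <-]; exists (l ++ l') => //.
    by apply/seteqP; split => x /=; rewrite /halfspaces/= all_cat => /andP.
  - have := f0 [::]; rewrite (_ : halfspaces [::] = setT)//.
    by apply/seteqP; split.
  - by move=> _ [l _ <-].
  - move=> S mS S0; have := f0 [::].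
    rewrite (_ : halfspaces [::] = S `|` ~` S); last first.
      by rewrite setUv; apply/seteqP; split.
    rewrite integral_setU//; first by rewrite S0 add0e.
    + exact: measurableC.
    + by rewrite setUv; exact: measurable_int fi.
    + exact/disj_setPCl.
  - move=> F mF tF F0.
    rewrite integral_bigcup//; last exact: intA (bigcup_measurable _).
    by apply: eseries0 => k _ _; exact: F0.
have : ae_eq m setT (EFin \o f) (cst 0%E).
  apply: integral_ae_eq => // E _ mE.
  by rewrite integral0; exact: fA.
by apply: filterS => x /(_ I) [].
Qed.

Lemma integrable_mul_bounded (A : set 'rV[R]_n) (f h : 'rV[R]_n -> R) (M : R) :
  measurable A -> m.-integrable A (EFin \o f) -> measurable_fun A h ->
  (forall x, A x -> `|h x| <= M) -> m.-integrable A (EFin \o (f \* h)).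
Proof.
move=> mA fi mh hM.
have fMi : m.-integrable A (EFin \o (fun x => M * f x)).
  by have := integrableZl mA M fi.
apply: le_integrable fMi => //.
  apply/measurable_EFinP; apply: measurable_funM => //.
  by apply/measurable_EFinP; exact: measurable_int fi.
move=> x Ax /=; rewrite lee_fin normrM mulrC normrM ler_wpM2r//.
by apply: le_trans (hM x Ax) _; exact: ler_norm.
Qed.

(** A bump localizes [g] to an integrable function [f] on the whole space. Testing with products of
    bumps that converge boundedly to indicators of half-spaces shows that [f] has zero integral on
    all their finite intersections. Hence [f] vanishes almost everywhere, and so does [g] on the
    ball where the bump is positive. *)
Lemma fundamental_lemma (D : set 'rV[R]_n) (g : 'rV[R]_n -> R) :
  open D -> m.-integrable D (EFin \o g) ->
  (forall phi, testfun D phi -> ip m D g phi = 0) ->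
  {ae m, forall x, D x -> g x = 0}.
Proof.
move=> oD gi H; have mD := open_measurable_rV oD.
have loc c r : 0 < r -> ball c (r *+ 2) `<=` D ->
    {ae m, forall x, ball c r x -> g x = 0}.
  move=> r0 cD; pose f := (g \* bbump c r) \_ D.
  have mb : measurable_fun setT (bbump c r).
    by apply: continuous_measurable_rV; apply: smooth_continuous; exact: smooth_bbump.
  have fi : m.-integrable setT (EFin \o f).
    have := @integrable_mul_bounded D g (bbump c r) 1 mD gi.
    move=> /(_ (measurable_funTS mb)) => K.
    rewrite /f -restrict_EFin; apply/integrable_restrict => //; rewrite setTI; apply: K.
    by move=> x _; have /andP[b0 b1] := bbump_le1 c r x; rewrite ger0_norm.
  have fpi A psi : measurable A -> smooth psi -> (forall x, 0 <= psi x <= 1) ->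
      m.-integrable A (EFin \o (f \* psi)).
    move=> mA spsi psi01; apply: (@integrable_mul_bounded _ _ _ 1) => //.
    - exact: integrableS fi.
    - by apply: measurable_funTS; apply: continuous_measurable_rV; exact: smooth_continuous.
    - by move=> x _; have /andP[b0 b1] := psi01 x; rewrite ger0_norm.
  have mhs l : measurable (halfspaces l).
    by rewrite measurable_halfspacesE; apply: sub_sigma_algebra; exists l.
  (* Stated for all smooth [psi] with values in $[0,1]$, so that the induction can absorb the
     approximation of one more half-space into [psi], before dominated convergence restores the
     indicator. *)
  have f0 l psi : smooth psi -> (forall x, 0 <= psi x <= 1) ->
      (\int[m]_(x in halfspaces l) (f x * psi x)%:E = 0)%E.
    elim: l psi => [|[i a] l IH] psi spsi psi01.
      rewrite (_ : halfspaces [::] = setT); last by apply/seteqP; split.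
      have := H _ (testfun_bbump_mul r0 cD spsi).
      rewrite /ip Rintegral_mkcond /Rintegral => H0.
      have E : (\int[m]_x (f x * psi x)%:E)%E =
          (\int[m]_x (((fun x => g x * (bbump c r x * psi x)) \_ D) x)%:E)%E.
        apply: eq_integral => x _; congr EFin; rewrite /f !patchE.
        by case: ifPn => //=; rewrite ?mul0r ?mulrA.
      rewrite -[LHS]fineK; first by rewrite E H0.
      exact: (integrable_fin_num measurableT (fpi setT psi measurableT spsi psi01)).
    pose e N (x : 'rV[R]_n) : R := ebump 0 ((- (N.+1%:R * a)) + N.+1%:R * x 0 i).
    have se N : smooth (e N) by exact: smooth_ebump.
    have e01 N x : 0 <= psi x * e N x <= 1.
      have /andP[p0 p1] := psi01 x.
      by rewrite mulr_ge0 ?ebump_ge0//= mulr_ile1 ?ebump_ge0 ?ebump_le1.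
    have K N := IH _ (smoothM spsi (se N)) (e01 N).
    pose P := [set x : 'rV[R]_n | a < x 0 i].
    have mP : measurable P.
      rewrite (_ : P = (fun x : 'rV[R]_n => x 0 i) @^-1` `]a, +oo[).
        rewrite -[X in measurable X]setTI.
        by apply: measurable_coord => //; exact: measurable_itv.
      by apply/seteqP; split => x /=; rewrite in_itv/= andbT.
    have -> : halfspaces ((i, a) :: l) = halfspaces l `&` P.
      by apply/seteqP; split => [x /= /andP[]|x /= [? ?]]; [split|apply/andP; split].
    rewrite integral_mkcondr.
    have fpsi := fpi _ _ (mhs _ _ l) spsi psi01.
    have [] := @dominated_convergence _ _ _ m (halfspaces l) (mhs _ _ l)
      (fun N x => (f x * (psi x * e N x))%:E)
      ((fun x => (f x * psi x)%:E) \_ P) (fun x => `|f x|%:E).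
    - by move=> N; exact: measurable_int (fpi _ _ (mhs _ _ l) (smoothM spsi (se N)) (e01 N)).
    - apply/measurable_restrict; [exact: mP|exact: mhs|]; exact: measurable_int (fpi _ psi (measurableI _ _ (mhs _ _ l) mP) spsi psi01).
    - apply: aeW => x _; rewrite patchE.
      have E : (fun N => (f x * (psi x * e N x))%:E) =
          (fun N => (f x * psi x * ebump 0 (N.+1%:R * (x 0 i - a)))%:E).
        by apply/funext => N; rewrite /e mulrBr [in RHS]addrC mulrA.
      have -> : (if x \in P then (f x * psi x)%:E else 0%E) =
          (f x * psi x * (0 < x 0 i - a)%R%:R)%:E.
        case: ifPn; rewrite subr_gt0; first by rewrite inE => -> ; rewrite mulr1.
        by rewrite notin_setE => /negP/negbTE ->; rewrite mulr0.
      rewrite E; apply: cvg_EFin; first exact: nearW.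
      by apply: cvgMr; exact: cvg_ebump_dilation.
    - exact: (integrable_norm (integrableS measurableT (mhs _ _ l) (@subsetT _ _) fi)).
    - apply: aeW => x N _; rewrite lee_fin normrM ler_piMr//.
      by have /andP[b0 b1] := e01 N x; rewrite ger0_norm.
    move=> _ _; under eq_fun do rewrite K.
    by move=> /(cvg_unique _ (cvg_cst _)) <-.
  have := integral_halfspaces_eq0 fi.
  have f0' l : (\int[m]_(x in halfspaces l) (f x)%:E = 0)%E.
    have := f0 l (fun=> 1) (smooth_cst 1); under eq_integral do rewrite mulr1.
    by apply=> x; rewrite ler01 lexx.
  move=> /(_ f0'); apply: filterS => x + cx.
  rewrite /f patchE mem_set; last by apply: cD; apply: le_ball cx; rewrite mulr2n lerDl ltW.
  by move=> /eqP; rewrite mulf_eq0 (gt_eqF (bbump_gt0 cx)) orbF => /eqP.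
(* Countably many such balls cover [D], so the union of the exceptional sets is still null. *)
have : {ae m, forall x, forall p : 'rV[rat]_n * nat,
    ball (map_mx ratr p.1 : 'rV[R]_n) (p.2.+1%:R^-1 *+ 2) `<=` D ->
    ball (map_mx ratr p.1 : 'rV[R]_n) p.2.+1%:R^-1 x -> g x = 0}.
  apply: ae_countable => p; have [pD|pD] := pselect (ball (map_mx ratr p.1 : 'rV[R]_n) (p.2.+1%:R^-1 *+ 2) `<=` D).
    by apply: filterS (loc _ _ _ pD) => // x h _; exact: h.
  by apply: aeW => x.
apply: filterS => x Hx; rewrite {1}(open_rV_cover oD) => -[p /= pD px].
exact: Hx pD px.
Qed.

End FundamentalLemma.

(** * Square-integrable functions and weak derivatives *)

Section AeEqIntegral.
Context d (T : measurableType d) (R : realType) (mu : {measure set T -> \bar R}).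

Import HBNNSimple.

Let ge0_ae_le_integral (f g : T -> \bar R) : (forall x, 0 <= f x)%E ->
  (forall x, 0 <= g x)%E -> {ae mu, forall x, f x = g x} ->
  (\int[mu]_x f x <= \int[mu]_x g x)%E.
Proof.
move=> f0 g0 [N [mN N0 Nfg]]; rewrite !ge0_integralTE//.
apply: ge_ereal_sup => _ [h /= hf <-].
have mNC : measurable (~` N) by exact: measurableC.
pose h' := proj_nnsfun h mNC.
have -> : sintegral mu h = sintegral mu h'.
  rewrite -!integralT_nnsfun; apply: ae_eq_integral => //.
  - by apply/measurable_EFinP.
  - by apply/measurable_EFinP.
  exists N; split => // x /= Hx; apply: contrapT => Nx; apply: Hx => _.
  by rewrite /h'/= mindicE mem_set// mulr1.
apply: ereal_sup_ubound; exists h' => // x; rewrite /h'/= mindicE.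
have [Nx|Nx] := pselect (N x); first by rewrite memNset ?mulr0//; exact: (fun h => h Nx).
rewrite mem_set// mulr1 (le_trans (hf x))// (_ : f x = g x)//.
by apply: contrapT => fgx; apply: Nx; exact: Nfg.
Qed.

(* No measurability: the integral is a supremum over the simple functions below
   the integrand, each of which can be set to 0 on a null set. *)
Lemma ae_eq_Rintegral (D : set T) (f g : T -> R) :
  {ae mu, forall x, D x -> f x = g x} ->
  \int[mu]_(x in D) f x = \int[mu]_(x in D) g x.
Proof.
move=> fg; rewrite /Rintegral; congr fine; rewrite integral_mkcond [in RHS]integral_mkcond.
have fgD : {ae mu, forall x, ((fun x => (f x)%:E) \_ D) x = ((fun x => (g x)%:E) \_ D) x}.
  by apply: filterS fg => x h; rewrite !patchE; case: ifPn => // /[!inE] /h ->.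
rewrite integralE [in RHS]integralE; congr (_ - _)%E; apply/eqP; rewrite eq_le; apply/andP;
  split; apply: ge0_ae_le_integral => //; apply: filterS fgD => x h;
  by rewrite ?funeposE ?funenegE h.
Qed.

End AeEqIntegral.

Section L2Theory.
Context d (T : measurableType d) (R : realType) (mu : {measure set T -> \bar R}).
Variable D : set T.
Hypothesis mD : measurable D.
Implicit Types f g h : T -> R.

Lemma L2_mul f g : L2 mu D f -> L2 mu D g -> mu.-integrable D (EFin \o (f \* g)).
Proof.
move=> [mf f2] [mg g2].
have fg2 : mu.-integrable D (fun x => (f x ^+ 2)%:E + (g x ^+ 2)%:E)%E.
  exact: integrableD.
apply: le_integrable fg2 => //.
  by apply/measurable_EFinP; exact: measurable_funM.
move=> x Dx /=; rewrite lee_fin [leRHS]ger0_norm ?addr_ge0 ?sqr_ge0//.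
rewrite normrM -(real_normK (num_real (f x))) -(real_normK (num_real (g x))).
have := sqr_ge0 (`|f x| - `|g x|); have := normr_ge0 (f x); have := normr_ge0 (g x).
by nra.
Qed.

Lemma L2D f g : L2 mu D f -> L2 mu D g -> L2 mu D (f \+ g).
Proof.
move=> Lf Lg; have ifg := L2_mul Lf Lg; have [mf f2] := Lf; have [mg g2] := Lg.
split; first exact: measurable_funD.
have := integrableD mD (integrableD mD f2 g2) (integrableZl mD 2 ifg).
apply: eq_integrable => // x _ /=; congr EFin.
by rewrite sqrrD mulr2n mulrDl mul1r; ring.
Qed.

Lemma L2Z (a : R) f : L2 mu D f -> L2 mu D (fun x => a * f x).
Proof.
move=> [mf f2]; split; first by apply: measurable_funM => //; exact: measurable_cst.
have := integrableZl mD (a ^+ 2) f2.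
by apply: eq_integrable => // x _ /=; rewrite exprMn.
Qed.

Lemma L2N f : L2 mu D f -> L2 mu D (\- f).
Proof.
move=> /(L2Z (-1)); congr L2; by apply/funext => x; rewrite mulN1r.
Qed.

Lemma L2B f g : L2 mu D f -> L2 mu D g -> L2 mu D (f \- g).
Proof. by move=> Lf Lg; apply: (L2D Lf (L2N Lg)). Qed.

Lemma L2_bounded f (M : R) : (mu D < +oo)%E -> measurable_fun D f ->
  (forall x, D x -> `|f x| <= M) -> L2 mu D f.
Proof.
move=> muD mf fM; split => //.
have iM : mu.-integrable D (fun=> (M ^+ 2)%:E).
    apply/integrableP; split; first exact: measurable_cst.
    by rewrite integral_cst//= lte_mul_pinfty.
apply: le_integrable iM => //.
  by apply/measurable_EFinP; exact: measurable_funX.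
move=> x Dx /=; rewrite lee_fin !ger0_norm ?sqr_ge0//.
by rewrite -(real_normK (num_real (f x))) lerXn2r ?nnegrE// (le_trans _ (fM x Dx)).
Qed.

Lemma L2_cst (c : R) : (mu D < +oo)%E -> L2 mu D (fun=> c).
Proof. by move=> muD; apply: (L2_bounded (M := `|c|)). Qed.

Lemma L2_integrable f : (mu D < +oo)%E -> L2 mu D f -> mu.-integrable D (EFin \o f).
Proof.
move=> muD Lf; have := L2_mul Lf (L2_cst 1 muD).
by apply: eq_integrable => // x _ /=; rewrite mulr1.
Qed.

Lemma L2_sum (I : Type) (r : seq I) (F : I -> T -> R) : (mu D < +oo)%E ->
  (forall i, L2 mu D (F i)) -> L2 mu D (fun x => \sum_(i <- r) F i x).
Proof.
move=> muD LF; elim: r => [|i r IH].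
  by under eq_fun do rewrite big_nil; exact: L2_cst.
by under eq_fun do rewrite big_cons; exact: L2D.
Qed.

Lemma ipC f g : ip mu D f g = ip mu D g f.
Proof. by rewrite /ip; under eq_Rintegral do rewrite mulrC. Qed.

Lemma ip_eq f1 f2 g1 g2 : {in D, f1 =1 f2} -> {in D, g1 =1 g2} ->
  ip mu D f1 g1 = ip mu D f2 g2.
Proof. by move=> ff gg; apply: eq_Rintegral => x xD; rewrite ff// gg. Qed.

Lemma ip_aeeq f1 f2 g : aeeq mu D f1 f2 -> ip mu D f1 g = ip mu D f2 g.
Proof. by move=> ff; apply: ae_eq_Rintegral; apply: filterS ff => x h Dx; rewrite h. Qed.

Lemma ipDl f1 f2 g : L2 mu D f1 -> L2 mu D f2 -> L2 mu D g ->
  ip mu D (f1 \+ f2) g = ip mu D f1 g + ip mu D f2 g.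
Proof.
move=> L1 L2 Lg; rewrite /ip -RintegralD//; try exact: L2_mul.
by apply: eq_Rintegral => x _; rewrite mulrDl.
Qed.

Lemma ipZl (a : R) f g : L2 mu D f -> L2 mu D g ->
  ip mu D (fun x => a * f x) g = a * ip mu D f g.
Proof.
move=> L1 Lg; rewrite /ip -RintegralZl//; last exact: L2_mul.
by apply: eq_Rintegral => x _; rewrite mulrA.
Qed.

Lemma ipDr f g1 g2 : L2 mu D f -> L2 mu D g1 -> L2 mu D g2 ->
  ip mu D f (g1 \+ g2) = ip mu D f g1 + ip mu D f g2.
Proof. by move=> *; rewrite ipC ipDl// !(ipC f). Qed.

Lemma ipZr (a : R) f g : L2 mu D f -> L2 mu D g ->
  ip mu D f (fun x => a * g x) = a * ip mu D f g.
Proof. by move=> *; rewrite ipC ipZl// (ipC f). Qed.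

Lemma ip0l g : ip mu D (fun=> 0) g = 0.
Proof.
by rewrite /ip; under eq_Rintegral do rewrite mul0r; rewrite Rintegral_cst// mul0r.
Qed.

Lemma ip_ge0 f : 0 <= ip mu D f f.
Proof. by apply: Rintegral_ge0 => x _; rewrite -expr2 sqr_ge0. Qed.

Lemma ip_eq0 f : L2 mu D f -> ip mu D f f = 0 -> aeeq mu D f (fun=> 0).
Proof.
move=> Lf; have [mf f2] := Lf; rewrite /ip /Rintegral => /eqP.
have i2 := L2_mul Lf Lf.
rewrite fine_eq0; last exact: integrable_fin_num i2.
move=> /eqP i0.
have : ae_eq mu D (EFin \o (f \* f)) (cst 0%E).
  apply/ae_eq_integral_abs => //; first exact: measurable_int i2.
  rewrite -[RHS]i0; apply: eq_integral => x _ /=.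
  by rewrite ger0_norm// -expr2 sqr_ge0.
by apply: filterS => x h /h /= [] /eqP; rewrite mulf_eq0 orbb => /eqP.
Qed.

(* The quadratic polynomial t |-> |f + t g|^2 is nonnegative. *)
Lemma ip_cauchy_schwarz f g : L2 mu D f -> L2 mu D g ->
  ip mu D f g ^+ 2 <= ip mu D f f * ip mu D g g.
Proof.
move=> Lf Lg.
have H t : 0 <= ip mu D f f + 2 * t * ip mu D f g + t ^+ 2 * ip mu D g g.
  have Lt : L2 mu D (fun x => t * g x) by exact: L2Z.
  have := ip_ge0 (f \+ (fun x => t * g x)).
  rewrite ipDl ?ipDr ?ipZl ?ipZr//; try exact: L2D.
  by rewrite (ipC g f) => h; apply: le_trans h _; rewrite le_eqVlt; apply/orP; left; apply/eqP; ring.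
have [g0|g0] := eqVneq (ip mu D g g) 0.
  rewrite g0 mulr0.
  have [->|n0] := eqVneq (ip mu D f g) 0; first by rewrite expr0n.
  (* When $g$ has norm 0 the polynomial is affine in $t$; this $t$ gives it the value $-1$. *)
  have := H (- (ip mu D f f + 1) / (2 * ip mu D f g)); rewrite g0 mulr0 addr0.
  have -> : 2 * (- (ip mu D f f + 1) / (2 * ip mu D f g)) * ip mu D f g = - (ip mu D f f + 1).
    by field.
  by rewrite opprD addrA subrr add0r oppr_ge0 ler10.
have gp : 0 < ip mu D g g by rewrite lt_def g0 ip_ge0.
(* The minimizer of the quadratic polynomial. *)
have := H (- ip mu D f g / ip mu D g g).
have -> : ip mu D f f + 2 * (- ip mu D f g / ip mu D g g) * ip mu D f g +
    (- ip mu D f g / ip mu D g g) ^+ 2 * ip mu D g g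
  = ip mu D f f - ip mu D f g ^+ 2 / ip mu D g g by field.
by rewrite subr_ge0 ler_pdivrMr.
Qed.

End L2Theory.

Section TestFunctions.
Context (R : realType) (n : nat).
Implicit Types (D C : set 'rV[R]_n) (phi : 'rV[R]_n -> R).

Lemma bounded_compact_support phi C : compact C -> continuous phi ->
  (forall x, ~ C x -> phi x = 0) -> exists M, forall x, `|phi x| <= M.
Proof.
move=> cC cphi phi0.
have : compact (phi @` C).
  by apply: continuous_compact => //; exact: continuous_subspaceT.
move=> /compact_bounded [M [_ HM]]; exists (`|M| + 1) => x.
have [Cx|/phi0 ->] := pselect (C x); last by rewrite normr0 addr_ge0.
by apply: HM; [rewrite (le_lt_trans (ler_norm _))// ltrDl|exists x].
Qed.

Lemma pd_compact_support phi C i : compact C -> (forall x, ~ C x -> phi x = 0) ->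
  forall x, ~ C x -> pd i phi x = 0.
Proof.
move=> cC phi0; apply: (@pd_eq0 _ _ phi i (~` C)) => //.
by apply: closed_openC; apply: compact_closed => //; exact: norm_hausdorff.
Qed.

Lemma testfun_smooth D phi : testfun D phi -> smooth phi.
Proof. by case. Qed.

Lemma testfun_pd D phi i : testfun D phi -> testfun D (pd i phi).
Proof.
move=> [sphi [C [cC CD phi0]]]; split; first exact: smooth_pd.
by exists C; split => //; exact: pd_compact_support cC phi0.
Qed.

Lemma testfun_out D phi x : testfun D phi -> ~ D x -> phi x = 0.
Proof. by move=> [_ [C [_ CD phi0]]] Dx; apply: phi0 => /CD. Qed.

Lemma testfun_sub D D' phi : D `<=` D' -> testfun D phi -> testfun D' phi.
Proof.
move=> DD' [sphi [C [cC CD phi0]]]; split => //; exists C; split => //.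
exact: subset_trans DD'.
Qed.

Lemma testfun0 D : testfun D (fun=> 0).
Proof.
split; first exact: smooth_cst.
by exists set0; split => //; exact: compact0.
Qed.

Lemma testfun_bounded D phi : testfun D phi -> exists M, forall x, `|phi x| <= M.
Proof.
move=> [sphi [C [cC _ phi0]]].
exact: (bounded_compact_support cC (smooth_continuous sphi) phi0).
Qed.

Lemma loctest_testfunT U G phi : loctest U G phi -> testfun setT phi.
Proof. by move=> [sphi [C [cC _ phi0]]]; split => //; exists C; split. Qed.

Lemma loctest_pd U G phi i : loctest U G phi -> loctest U G (pd i phi).
Proof.
move=> [sphi [C [cC CD phi0]]]; split; first exact: smooth_pd.
by exists C; split => //; exact: pd_compact_support cC phi0.
Qed.

Context (m : {measure set 'rV[R]_n -> \bar R}).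

Lemma testfun_L2 D D' phi : measurable D -> (m D < +oo)%E -> testfun D' phi ->
  L2 m D phi.
Proof.
move=> mD mDoo tphi; have [M phiM] := testfun_bounded tphi.
apply: (L2_bounded mD mDoo (M := M)) => //.
apply: measurable_funTS; apply: continuous_measurable_rV.
by apply: smooth_continuous; exact: testfun_smooth tphi.
Qed.

Lemma ip_testfun_sub D D' f phi : D `<=` D' -> testfun D phi ->
  ip m D' f phi = ip m D f phi.
Proof.
move=> DD' tphi; rewrite /ip Rintegral_mkcond [RHS]Rintegral_mkcond.
apply: eq_Rintegral => x _; rewrite !patchE.
have [Dx|Dx] := pselect (D x); first by rewrite !mem_set//; exact: DD'.
by rewrite (memNset Dx) (testfun_out tphi Dx) mulr0; case: ifP.
Qed.

Lemma ipv_sub p D D' (v w : 'rV[R]_n -> 'rV[R]_p) : D `<=` D' ->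
  (forall x, ~ D x -> w x = 0) -> ipv m D' v w = ipv m D v w.
Proof.
move=> DD' w0; rewrite /ipv Rintegral_mkcond [RHS]Rintegral_mkcond.
apply: eq_Rintegral => x _; rewrite !patchE.
have [Dx|Dx] := pselect (D x); first by rewrite !mem_set//; exact: DD'.
rewrite (memNset Dx) w0// /dot big1; first by case: ifP.
by move=> i _; rewrite mxE mulr0.
Qed.

Lemma L2_sub D D' f : measurable D -> measurable D' -> D `<=` D' -> L2 m D' f -> L2 m D f.
Proof.
move=> mD mD' DD' [mf f2]; split; first exact: measurable_funS mf.
exact: integrableS f2.
Qed.

Lemma ipv_ipE p D (v w : 'rV[R]_n -> 'rV[R]_p) : measurable D ->
  L2v m D v -> L2v m D w -> ipv m D v w = \sum_i ip m D (cmp v i) (cmp w i).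
Proof.
move=> mD Lv Lw; rewrite /ipv /dot.
have intv i : m.-integrable D (EFin \o (cmp v i \* cmp w i)) by exact: L2_mul.
suff [] : m.-integrable D (EFin \o (fun x => \sum_i v x 0 i * w x 0 i)) /\
  \int[m]_(x in D) \sum_i v x 0 i * w x 0 i = \sum_i ip m D (cmp v i) (cmp w i) by [].
elim: (index_enum _) => [|i r [IHi IH]].
  rewrite big_nil; under eq_fun do rewrite big_nil; split; first exact: integrable0.
  by rewrite Rintegral_cst// mul0r.
rewrite big_cons -IH; under eq_fun do rewrite big_cons.
split; first by have := integrableD mD (intv i) IHi.
by rewrite /ip -RintegralD//; exact: intv.
Qed.

Lemma ipv_aeeq p D (v v' w : 'rV[R]_n -> 'rV[R]_p) : aeeq m D v v' ->
  ipv m D v w = ipv m D v' w.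
Proof. by move=> vv; apply: ae_eq_Rintegral; apply: filterS vv => x h Dx; rewrite h. Qed.

Lemma ipvDl p D (v v' w : 'rV[R]_n -> 'rV[R]_p) : measurable D ->
  L2v m D v -> L2v m D v' -> L2v m D w ->
  ipv m D (v \+ v') w = ipv m D v w + ipv m D v' w.
Proof.
move=> mD Lv Lv' Lw; have Lvv : L2v m D (v \+ v').
  move=> i; rewrite (_ : cmp _ i = cmp v i \+ cmp v' i); first exact: L2D.
  by apply/funext => x; rewrite /cmp/= mxE.
rewrite !ipv_ipE// -big_split; apply: eq_bigr => i _ /=.
rewrite -ipDl//; congr ip; by apply/funext => x; rewrite /cmp/= mxE.
Qed.

Lemma L2vD p D (v w : 'rV[R]_n -> 'rV[R]_p) : measurable D ->
  L2v m D v -> L2v m D w -> L2v m D (v \+ w).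
Proof.
move=> mD Lv Lw i; rewrite (_ : cmp _ i = cmp v i \+ cmp w i); first exact: L2D.
by apply/funext => x; rewrite /cmp/= mxE.
Qed.

Lemma L2vZ p D a (v : 'rV[R]_n -> 'rV[R]_p) : measurable D ->
  L2v m D v -> L2v m D (fun x => a *: v x).
Proof.
move=> mD Lv i; rewrite (_ : cmp _ i = fun x => a * cmp v i x); first exact: L2Z.
by apply/funext => x; rewrite /cmp/= mxE.
Qed.

Lemma ipvZl p D a (v w : 'rV[R]_n -> 'rV[R]_p) : measurable D ->
  L2v m D v -> L2v m D w -> ipv m D (fun x => a *: v x) w = a * ipv m D v w.
Proof.
move=> mD Lv Lw; rewrite !ipv_ipE//; last exact: L2vZ.
rewrite mulr_sumr; apply: eq_bigr => i _.
rewrite -ipZl//; congr ip; by apply/funext => x; rewrite /cmp/= mxE.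
Qed.

Lemma ipv0r p D (v : 'rV[R]_n -> 'rV[R]_p) : ipv m D v (fun=> 0) = 0.
Proof.
rewrite /ipv (@eq_Rintegral _ _ _ m D (fun=> 0)); last first.
  by move=> x _; rewrite /dot big1// => i _; rewrite mxE mulr0.
by rewrite /Rintegral integral0.
Qed.

Lemma ipvC p D (v w : 'rV[R]_n -> 'rV[R]_p) : ipv m D v w = ipv m D w v.
Proof. by rewrite /ipv; under eq_Rintegral do rewrite dotC. Qed.

Lemma L2v_sub p D D' (v : 'rV[R]_n -> 'rV[R]_p) :
  measurable D -> measurable D' -> D `<=` D' -> L2v m D' v -> L2v m D v.
Proof. by move=> mD mD' DD' Lv i; exact: L2_sub (Lv i). Qed.

Lemma ipv_ge0 p D (v : 'rV[R]_n -> 'rV[R]_p) : 0 <= ipv m D v v.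
Proof.
by apply: Rintegral_ge0 => x _; apply: sumr_ge0 => i _; rewrite -expr2 sqr_ge0.
Qed.

Lemma ipv_eq0 p D (v : 'rV[R]_n -> 'rV[R]_p) : measurable D -> L2v m D v ->
  ipv m D v v = 0 -> aeeq m D v (fun=> 0).
Proof.
move=> mD Lv; rewrite ipv_ipE// => /eqP.
rewrite psumr_eq0 => [/allP H|i _]; last exact: ip_ge0.
have H' i : aeeq m D (cmp v i) (fun=> 0).
  by apply: ip_eq0 => //; apply/eqP/H; rewrite mem_index_enum.
have := ae_countable H'; apply: filterS => x h Dx.
by apply/rowP => i; rewrite mxE; exact: h.
Qed.

(** Cauchy-Schwarz in each component, the norm of a component of [v] being at most the full norm.
    The sum is cruder than the sharp bound but linear in the norm of [v], which suffices to pass to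
    limits. *)
Lemma ipv_cauchy_schwarz p D (v w : 'rV[R]_n -> 'rV[R]_p) : measurable D ->
  L2v m D v -> L2v m D w -> `|ipv m D v w| <= \sum_i nrmv m D v * nrm m D (cmp w i).
Proof.
move=> mD Lv Lw; rewrite ipv_ipE//.
apply: le_trans (ler_norm_sum _ _ _) _; apply: ler_sum => i _.
have -> : `|ip m D (cmp v i) (cmp w i)| = Num.sqrt (ip m D (cmp v i) (cmp w i) ^+ 2).
  by rewrite sqrtr_sqr.
rewrite /nrmv /nrm -sqrtrM ?ipv_ge0// ler_wsqrtr//.
apply: le_trans (ip_cauchy_schwarz mD (Lv i) (Lw i)) _.
rewrite ler_wpM2r ?ip_ge0// ipv_ipE// (bigD1 i)//= lerDl.
by apply: sumr_ge0 => j _; exact: ip_ge0.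
Qed.

End TestFunctions.

(** * Weak divergence and weak curl: restriction, linearity, uniqueness *)

Section WeakDivergence.
Context (R : realType) (n : nat) (m : {measure set 'rV[R]_n -> \bar R}).
Implicit Types (D : set 'rV[R]_n) (v w : 'rV[R]_n -> 'rV[R]_n).

Lemma cmp_grad (phi : 'rV[R]_n -> R) i : cmp (grad phi) i = pd i phi.
Proof. by apply/funext => x; rewrite /cmp mxE. Qed.

Lemma testvec_grad D phi : testfun D phi -> testvec (testfun D) (grad phi).
Proof. by move=> tphi i; rewrite cmp_grad; exact: testfun_pd. Qed.

Lemma testvec_L2v p D D' (phi : 'rV[R]_n -> 'rV[R]_p) : measurable D -> (m D < +oo)%E ->
  testvec (testfun D') phi -> L2v m D phi.
Proof. by move=> mD mDoo tphi i; exact: testfun_L2 (tphi i). Qed.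

Lemma testvec_out p D (phi : 'rV[R]_n -> 'rV[R]_p) x :
  testvec (testfun D) phi -> ~ D x -> phi x = 0.
Proof.
by move=> tphi Dx; apply/rowP => i; rewrite mxE; exact: (testfun_out (tphi i)).
Qed.

Lemma wdivP D v : (exists g, is_wdiv m D v g) -> is_wdiv m D v (wdiv m D v).
Proof. by move=> [g vg]; apply: xgetPex; exists g. Qed.

Lemma is_wdiv_sub D D' v g : measurable D -> measurable D' -> D `<=` D' ->
  is_wdiv m D' v g -> is_wdiv m D v g.
Proof.
move=> mD mD' DD' [Lg vg]; split; first exact: L2_sub Lg.
move=> phi tphi; have := vg _ (testfun_sub DD' tphi).
rewrite (ipv_sub m _ DD') ?(ip_testfun_sub m _ DD' tphi)// => x Dx.
exact: testvec_out (testvec_grad tphi) Dx.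
Qed.

Lemma is_wdiv_aeeq D v v' g : aeeq m D v v' -> is_wdiv m D v g -> is_wdiv m D v' g.
Proof.
by move=> vv' [Lg vg]; split => // phi /vg <-; apply: esym; exact: ipv_aeeq.
Qed.

Variable D : set 'rV[R]_n.
Hypotheses (oD : open D) (mDoo : (m D < +oo)%E).
Let mD : measurable D := open_measurable_rV oD.

Lemma is_wdiv_lin a v w g h : L2v m D v -> L2v m D w ->
  is_wdiv m D v g -> is_wdiv m D w h ->
  is_wdiv m D (fun x => a *: v x + w x) (fun x => a * g x + h x).
Proof.
move=> Lv Lw [Lg vg] [Lh wh]; split; first by apply: L2D => //; exact: L2Z.
move=> phi tphi; have Lphi := testvec_L2v mD mDoo (testvec_grad tphi).
have Lp := testfun_L2 mD mDoo tphi.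
rewrite (ipvDl mD (v := fun x => a *: v x))//; last exact: L2vZ.
rewrite ipvZl// vg// wh// (ipDl mD (f1 := fun x => a * g x))//; last exact: L2Z.
by rewrite ipZl// mulrN -opprD.
Qed.

Lemma L2_ae_unique g g' : L2 m D g -> L2 m D g' ->
  (forall phi, testfun D phi -> ip m D g phi = ip m D g' phi) -> aeeq m D g g'.
Proof.
move=> Lg Lg' gg'.
have iB : m.-integrable D (EFin \o (g \- g')) by apply: L2_integrable => //; exact: L2B.
have := fundamental_lemma oD iB.
have H phi : testfun D phi -> ip m D (g \- g') phi = 0.
  move=> tphi; have Lp := testfun_L2 mD mDoo tphi.
  have : ip m D (g \- g') phi + ip m D g' phi = ip m D g phi.
    rewrite -ipDl//; last exact: L2B.
    by apply: ip_eq => // x _; rewrite /= subrK.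
  by rewrite gg'// -[RHS]add0r; exact: addIr.
by move=> /(_ H); apply: filterS => x h Dx; apply/eqP; rewrite -subr_eq0; apply/eqP/h.
Qed.

Lemma wdiv_unique v g g' : is_wdiv m D v g -> is_wdiv m D v g' -> aeeq m D g g'.
Proof.
move=> [Lg vg] [Lg' vg']; apply: L2_ae_unique => // phi tphi.
by apply: oppr_inj; rewrite -vg// -vg'.
Qed.

End WeakDivergence.

Section WeakCurl.
Context (R : realType).
Local Notation field := ('rV[R]_3 -> 'rV[R]_3).
Implicit Types (D : set 'rV[R]_3) (v w E J : field).

Lemma curl_grad (phi : 'rV[R]_3 -> R) : smooth phi -> curl (grad phi) = fun=> 0.
Proof.
move=> sphi; apply/funext => x; apply/rowP => j; rewrite !mxE !cmp_grad.
by case: (ord3P j) => -> /=; rewrite (pdC _ _ _ sphi) subrr.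
Qed.

Lemma curl_out D (phi : field) x : testvec (testfun D) phi -> ~ D x -> curl phi x = 0.
Proof.
move=> tphi Dx; apply/rowP => j; rewrite !mxE.
by case: (ord3P j) => -> /=; rewrite !(testfun_out (testfun_pd _ (tphi _)) Dx) subrr.
Qed.

Lemma L2v_curl D D' (phi : field) : measurable D -> (leb3 D < +oo)%E ->
  testvec (testfun D') phi -> L2v 'mu3 D (curl phi).
Proof.
move=> mD mDoo tphi.
have L i j : L2 'mu3 D (pd i (cmp phi j)) by apply: testfun_L2 (testfun_pd _ (tphi j)).
move=> j.
have -> : cmp (curl phi) j = fun x => [:: pd 1 (cmp phi 2) x - pd 2 (cmp phi 1) x;
    pd 2 (cmp phi 0) x - pd 0 (cmp phi 2) x; pd 0 (cmp phi 1) x - pd 1 (cmp phi 0) x]`_j.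
  by apply/funext => x; rewrite /cmp mxE.
by case: (ord3P j) => -> /=; exact: L2B.
Qed.

Lemma wcurlP D v : (exists w, is_wcurl D v w) -> is_wcurl D v (wcurl D v).
Proof. by move=> [w vw]; apply: xgetPex; exists w. Qed.

Lemma is_wcurl_sub D D' v w : measurable D -> measurable D' -> D `<=` D' ->
  is_wcurl D' v w -> is_wcurl D v w.
Proof.
move=> mD mD' DD' [Lw vw]; split; first exact: L2v_sub Lw.
move=> phi tphi.
have tphi' : testvec (testfun D') phi by move=> i; exact: testfun_sub (tphi i).
have := vw _ tphi'; rewrite (ipv_sub 'mu3 _ DD'); last by move=> x; exact: curl_out.
by rewrite (ipv_sub 'mu3 _ DD')//; move=> x; exact: testvec_out.
Qed.

Lemma is_wcurl_aeeq D v v' w : aeeq 'mu3 D v v' -> is_wcurl D v w -> is_wcurl D v' w.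
Proof.
by move=> vv' [Lg vg]; split => // phi /vg <-; apply: esym; exact: ipv_aeeq.
Qed.

(** The gradient of a test function is an admissible test field for the weak curl, and its own curl
    is 0. *)
Lemma wcurl_div0 D E J : measurable D -> (leb3 D < +oo)%E -> is_wcurl D E J ->
  is_wdiv 'mu3 D J (fun=> 0).
Proof.
move=> mD mDoo [LJ EJ]; split; first exact: L2_cst.
move=> phi tphi; rewrite -(EJ _ (testvec_grad tphi)) (curl_grad (testfun_smooth tphi)).
by rewrite ip0l// oppr0 ipv0r.
Qed.

Lemma wcurl_unique D v w w' : open D -> (leb3 D < +oo)%E ->
  is_wcurl D v w -> is_wcurl D v w' -> aeeq 'mu3 D w w'.
Proof.
move=> oD mDoo [Lw vw] [Lw' vw']; have mD := open_measurable_rV oD.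
have H i : aeeq 'mu3 D (cmp w i) (cmp w' i).
  apply: L2_ae_unique => // phi tphi.
  (* A test field along axis [i] isolates one component. *)
  pose Phi : field := fun x => phi x *: delta_mx 0 i.
  have cPhi j : cmp Phi j = if i == j then phi else fun=> 0.
    by apply/funext => x; rewrite /cmp !mxE eqxx/= eq_sym; case: eqP; rewrite ?mulr1 ?mulr0.
  have tPhi : testvec (testfun D) Phi.
    by move=> j; rewrite cPhi; case: ifP => // _; exact: testfun0.
  have LPhi := testvec_L2v mD mDoo tPhi.
  have E (z : field) : L2v 'mu3 D z -> ipv 'mu3 D z Phi = ip 'mu3 D (cmp z i) phi.
    move=> Lz; rewrite ipv_ipE// (bigD1 i)//= cPhi eqxx big1 ?addr0// => j ji.
    by rewrite cPhi eq_sym (negbTE ji) ipC ip0l.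
  by rewrite -!E// -vw// -vw'.
have := ae_countable H; apply: filterS => x h Dx.
by apply/rowP => i; exact: h.
Qed.

Lemma is_wcurl_lin D a v w g h : measurable D -> (leb3 D < +oo)%E ->
  L2v 'mu3 D v -> L2v 'mu3 D w -> is_wcurl D v g -> is_wcurl D w h ->
  is_wcurl D (fun x => a *: v x + w x) (fun x => a *: g x + h x).
Proof.
move=> mD mDoo Lv Lw [Lg vg] [Lh wh]; split; first by apply: L2vD => //; exact: L2vZ.
move=> phi tphi; have Lphi := testvec_L2v mD mDoo tphi.
have Lc := L2v_curl mD mDoo tphi.
rewrite (ipvDl mD (v := fun x => a *: v x))//; last exact: L2vZ.
rewrite ipvZl// vg// wh// (ipvDl mD (v := fun x => a *: g x))//; last exact: L2vZ.
by rewrite ipvZl.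
Qed.

(** The Green formula that encodes a vanishing tangential trace admits gradients of functions that
    do not vanish at the boundary. Their curl is 0, so the condition on [E] becomes the vanishing of
    the normal trace of its curl. *)
Lemma H0div_wcurl D E : open D -> (leb3 D < +oo)%E -> H0curl D E -> H0div 'mu3 D (wcurl D E).
Proof.
move=> oD mDoo [LE exw Htr]; have mD := open_measurable_rV oD.
have wE := wcurlP exw; have d0 := wcurl_div0 mD mDoo wE.
split; [by case: wE|by exists (fun=> 0)|move=> phi tphi].
rewrite (Htr _ (testvec_grad tphi)) (curl_grad (testfun_smooth tphi)) ipv0r add0r.
have := wdiv_unique oD mDoo (wdivP (ex_intro _ _ d0)) d0.
by move=> /ip_aeeq ->; exact: ip0l.
Qed.

End WeakCurl.

(** * The divergence theorem near a face of a polyhedron *)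

Section LineIntegrals.
Context (R : realType).
Local Notation mu := (@lebesgue_measure R).
Variables (psi dpsi : R -> R) (M : R).
Hypothesis dpsiP : forall t : R, is_derive t (1 : R) psi (dpsi t).
Hypothesis cdpsi : continuous dpsi.
Hypothesis psi0 : forall t, M < `|t| -> psi t = 0.

Let near0_dpsi (t : R) : (\forall s \near t, psi s = 0) -> \forall s \near t, dpsi s = 0.
Proof.
move=> /nbhs_interior; apply: filterS => s ps.
have : is_derive s (1 : R) psi 0.
  apply: (@near_eq_is_derive _ _ _ (cst 0) _ s).
  by apply: filterS ps => r ->.
by move=> /@derive_val <-; rewrite (@derive_val _ _ _ _ _ _ _ (dpsiP s)).
Qed.

Let near0_out (t : R) : M < `|t| -> \forall s \near t, psi s = 0.
Proof.
move=> Mt; have : \forall s \near t, M < `|s|.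
  exact: (@norm_continuous _ _ t _ (lt_nbhsr Mt)).
by apply: filterS => s; exact: psi0.
Qed.

Let dpsi0 (t : R) : M < `|t| -> dpsi t = 0.
Proof. by move=> /near0_out /near0_dpsi /nbhs_singleton. Qed.

Let cont_integrable (f : R -> R) a b : continuous f -> (forall t, ~ (a <= t <= b) -> f t = 0) ->
  mu.-integrable setT (EFin \o f).
Proof.
move=> cf f0; have -> : EFin \o f = (EFin \o f) \_ `[a, b].
  apply/funext => t; rewrite patchE; case: ifPn => //; rewrite notin_setE /= in_itv/= => /f0 E.
  by rewrite /= E.
apply/integrable_restrict => //=; rewrite setTI.
apply: continuous_compact_integrable; first exact: segment_compact.
exact: continuous_subspaceT.
Qed.

Let FTC_itv (f F : R -> R) a b : a < b -> continuous f ->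
  (forall t : R, is_derive t (1 : R) F (f t)) ->
  (\int[mu]_(t in `[a, b]) (f t)%:E = (F b - F a)%:E)%E.
Proof.
move=> ab cf dF; rewrite (@continuous_FTC2 _ f F)//.
- exact: continuous_subspaceT.
- have cF x : {for x, continuous F}.
    by apply/differentiable_continuous/derivable1_diffP; case: (dF x).
  split => [x _||]; first by case: (dF x).
  + by apply: cvg_at_right_filter; exact: cF.
  + by apply: cvg_at_left_filter; exact: cF.
- by move=> x _; rewrite derive1E; apply: derive_val.
Qed.

(* The product h psi is C^1, although h may jump where psi vanishes. *)
Lemma integral_jump_derive (h : R -> R) :
  (forall t : R, (\forall s \near t, psi s = 0) \/ (\forall s \near t, h s = h t)) ->
  mu.-integrable setT (EFin \o (h \* dpsi)) /\
  (\int[mu]_t (h t * dpsi t)%:E = 0)%E.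
Proof.
move=> H.
have dH (t : R) : is_derive t (1 : R) (h \* psi) (h t * dpsi t).
  have [p0|hc] := H t.
    rewrite (nbhs_singleton (near0_dpsi p0)) mulr0.
    apply: (@near_eq_is_derive _ _ _ (cst 0) _ t).
    by apply: filterS p0 => s /= ->; rewrite mulr0.
  apply: (@near_eq_is_derive _ _ _ (h t \*: psi) _ t).
  by apply: filterS hc => s /= ->.
have cH : continuous (h \* dpsi).
  move=> t; have [p0|hc] := H t.
    have E : \forall s \near t, (fun=> 0) s = (h \* dpsi) s.
      by apply: filterS (near0_dpsi p0) => s /= ->; rewrite mulr0.
    have : (fun=> 0 : R) x @[x --> t] --> (h \* dpsi) t.
      by rewrite -(nbhs_singleton E); exact: cvg_cst.
    by apply: cvg_trans; apply: near_eq_cvg; apply: filterS E => s /= ->.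
  have E : \forall s \near t, h t * dpsi s = (h \* dpsi) s.
    by apply: filterS hc => s /= ->.
  have : h t * dpsi x @[x --> t] --> (h \* dpsi) t.
    by apply: cvgMr; exact: cdpsi.
  by apply: cvg_trans; apply: near_eq_cvg; apply: filterS E => s /= ->.
pose N : R := `|M| + 1.
have N0 : 0 < N by rewrite /N ltr_wpDl.
have MN : M < N by rewrite (le_lt_trans (ler_norm _))// ltrDl.
have out t : ~ (- N <= t <= N) -> (h \* dpsi) t = 0.
  move=> /negP; rewrite -ler_norml -ltNge => Nt.
  by rewrite /= dpsi0 ?mulr0// (lt_trans MN).
split; first exact: cont_integrable out.
transitivity (\int[mu]_(t in `[(- N)%R, N]) (h t * dpsi t)%:E)%E.
  rewrite [RHS]integral_mkcond; apply: eq_integral => t _; rewrite patchE.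
  by case: ifPn => //; rewrite notin_setE /= in_itv/= => /out /= ->.
rewrite (FTC_itv (F := h \* psi))//=; last by rewrite gtrN.
by rewrite !psi0 ?mulr0 ?subrr// ?normrN ger0_norm ?ltW.
Qed.

(** Near a crossing of a face the indicator of the element is that of a half-line. Cutting the
    half-line at [- N], beyond the support, reduces it to the fundamental theorem of calculus on a
    segment. *)
Lemma integral_lt_derive t0 :
  mu.-integrable setT (EFin \o (fun t => (t < t0)%R%:R * dpsi t)) /\
  (\int[mu]_t ((t < t0)%R%:R * dpsi t)%:E = (psi t0)%:E)%E.
Proof.
have [N [N0 MN tN]] : exists N, [/\ 0 < N, M < N & - N < t0].
  exists (`|M| + `|t0| + 1); split.
  - by rewrite ltr_wpDl// addr_ge0.
  - by rewrite -addrA (le_lt_trans (ler_norm _))// ltrDl ltr_wpDl.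
  - by rewrite ltrNl (le_lt_trans (ler_norm _))// normrN -addrA addrCA ltrDl ltr_wpDl.
have E : (fun t => ((t < t0)%R%:R * dpsi t)%:E) = (EFin \o dpsi) \_ `[- N, t0[.
  apply/funext => t; rewrite patchE; case: ifPn; rewrite ?inE ?notin_setE /= in_itv/=.
    by move=> /andP[_ ->]; rewrite mul1r.
  move=> /negP; rewrite negb_and; case: (ltP t t0) => tt0; last by rewrite mul0r.
  rewrite orbF -ltNge => tN'; rewrite dpsi0 ?mulr0//.
  apply: (lt_trans MN); rewrite ltrNr in tN'; apply: lt_le_trans tN' _.
  by rewrite -normrN ler_norm.
have i0 : mu.-integrable `[- N, t0] (EFin \o dpsi).
  apply: continuous_compact_integrable; first exact: segment_compact.
  exact: continuous_subspaceT.
split.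
  rewrite /comp E; apply/integrable_restrict => //=; rewrite setTI.
  apply: integrableS i0 => //; exact: subset_itv_co_cc.
rewrite E -integral_mkcond integral_itv_bndo_bndc; last first.
  by apply/measurable_EFinP; apply: measurable_funTS; exact: continuous_measurable_fun.
rewrite (FTC_itv (F := psi))// (psi0 (t := - N)) ?subr0//.
by rewrite normrN ger0_norm ?ltW.
Qed.

Lemma integral_gt_derive t0 :
  mu.-integrable setT (EFin \o (fun t => (t0 < t)%R%:R * dpsi t)) /\
  (\int[mu]_t ((t0 < t)%R%:R * dpsi t)%:E = (- psi t0)%:E)%E.
Proof.
have [N [N0 MN tN]] : exists N, [/\ 0 < N, M < N & t0 < N].
  exists (`|M| + `|t0| + 1); split.
  - by rewrite ltr_wpDl// addr_ge0.
  - by rewrite -addrA (le_lt_trans (ler_norm _))// ltrDl ltr_wpDl.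
  - by rewrite (le_lt_trans (ler_norm _))// -addrA addrCA ltrDl ltr_wpDl.
have E : (fun t => ((t0 < t)%R%:R * dpsi t)%:E) = (EFin \o dpsi) \_ `]t0, N].
  apply/funext => t; rewrite patchE; case: ifPn; rewrite ?inE ?notin_setE /= in_itv/=.
    by move=> /andP[-> _]; rewrite mul1r.
  move=> /negP; rewrite negb_and; case: (ltP t0 t) => tt0; last by rewrite mul0r.
  rewrite -ltNge => tN'; rewrite dpsi0 ?mulr0//.
  by apply: (lt_trans MN); apply: lt_le_trans tN' _; exact: ler_norm.
have i0 : mu.-integrable `[t0, N] (EFin \o dpsi).
  apply: continuous_compact_integrable; first exact: segment_compact.
  exact: continuous_subspaceT.
split.
  rewrite /comp E; apply/integrable_restrict => //=; rewrite setTI.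
  apply: integrableS i0 => //; exact: subset_itv_oc_cc.
rewrite E -integral_mkcond integral_itv_obnd_cbnd; last first.
  by apply/measurable_EFinP; apply: measurable_funTS; exact: continuous_measurable_fun.
rewrite (FTC_itv (F := psi))// (psi0 (t := N)) ?sub0r//.
by rewrite ger0_norm ?ltW.
Qed.

End LineIntegrals.

(** * Affine changes of variables on the line and in the plane *)

Section AffineChange.
Context (R : realType).
Local Notation RB := (measurableTypeR R).
Local Notation mu := (@lebesgue_measure R).

Lemma measurable_affine1 (a b : R) : measurable_fun [set: RB] (fun t : RB => a + b * t : RB).
Proof.
by apply: measurable_funD => //; apply: measurable_funM => //; exact: measurable_id.
Qed.

(** Lebesgue measure is determined by its values on half-open intervals, and the pushforward by the
    affine map, scaled by $|b|$, has these values. *)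
Lemma ge0_integral_affine1 (a b : R) (f : RB -> \bar R) : b != 0 ->
  measurable_fun setT f -> (forall t, 0 <= f t)%E ->
  (\int[mu]_t f (a + b * t)%R = `|b|^-1%:E * \int[mu]_t f t)%E.
Proof.
move=> b0 mf f0; have b0' : 0 < `|b| by rewrite normr_gt0.
pose m' := mscale (NngNum (ltW b0'))
  (measure_function_pushforward__canonical__measure_function_Measure mu (measurable_affine1 a b)).
have E A : measurable A -> mu A = m' A.
  apply: lebesgue_measure_unique => _ [[x y] /= _ <-].
  rewrite /m' /mscale /= /pushforward.
  have [xy|xy] := leP y x.
    by rewrite set_itv_ge ?preimage_set0 ?measure0 ?mule0// bnd_simp -leNgt.
  have [b1|b1] := ltP 0 b.
    rewrite (_ : _ @^-1` _ = `](x - a) / b, (y - a) / b]%classic).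
      rewrite !lebesgue_measure_itv/= !lte_fin ltr_pM2r ?invr_gt0// ltrD2r xy.
      by rewrite -!EFinB -EFinM gtr0_norm//; congr EFin; field; rewrite gt_eqF.
    apply/seteqP; split => t /=; rewrite !in_itv/=.
      by rewrite ltr_pdivrMr// ler_pdivlMr// ltrBlDl lerBrDl mulrC.
    by rewrite ltr_pdivrMr// ler_pdivlMr// ltrBlDl lerBrDl mulrC.
  (* A negative slope exchanges the open and the closed end, which leaves the length unchanged. *)
  have {}b1 : b < 0 by rewrite lt_neqAle b0.
  rewrite (_ : _ @^-1` _ = `[(y - a) / b, (x - a) / b[%classic).
    rewrite !lebesgue_measure_itv/= !lte_fin ltr_nM2r ?invr_lt0// ltrD2r xy.
    by rewrite -!EFinB -EFinM ltr0_norm//; congr EFin; field; rewrite lt_eqF.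
  apply/seteqP; split => t /=; rewrite !in_itv/= ltr_ndivlMr// ler_ndivrMr//;
    by rewrite ltrBlDl lerBrDl (mulrC t) andbC.
have -> : (\int[mu]_t f t = \int[m']_t f t)%E.
  by apply: eq_measure_integral => A mA _; exact: E.
rewrite ge0_integral_mscale//= ge0_integral_pushforward//; try exact: measurable_affine1.
by rewrite muleA -EFinM mulVf ?gt_eqF// mul1e.
Qed.

Definition affine2 (a b c e u v : R) (p : RB * RB) : RB * RB :=
  (u + (a * p.1 + b * p.2), v + (c * p.1 + e * p.2)).

Lemma measurable_affine2 a b c e u v : measurable_fun setT (affine2 a b c e u v).
Proof.
have m1 (x y z : R) : measurable_fun [set: RB * RB] (fun p : RB * RB => x + (y * p.1 + z * p.2) : RB).
  apply: measurable_funD => //; apply: measurable_funD; apply: measurable_funM => //.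
by apply: measurable_fun_pair; exact: m1.
Qed.

(* Two one-dimensional changes of variables; a pivot is found in the first row
   of the matrix, which accounts for the two cases. *)
Lemma ge0_integral_affine2 a b c e u v : a * e - b * c != 0 ->
  exists k : R, forall f : RB * RB -> \bar R, measurable_fun setT f ->
  (forall p, 0 <= f p)%E ->
  (\int[mu \x mu]_p f (affine2 a b c e u v p) = k%:E * \int[mu \x mu]_p f p)%E.
Proof.
move=> det.
have [a0|a0] := eqVneq a 0.
  have b0 : b != 0 by apply: contraNneq det => ->; rewrite a0; apply/eqP; ring.
  have c0 : c != 0 by apply: contraNneq det => ->; rewrite a0; apply/eqP; ring.
  exists (`|c|^-1 * `|b|^-1) => f mf f0.
  have mfA : measurable_fun setT (f \o affine2 a b c e u v).
    by apply: measurableT_comp => //; exact: measurable_affine2.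
  rewrite (@fubini_tonelli2 _ _ _ _ _ mu mu (f \o affine2 a b c e u v) mfA)//; last by move=> p; exact: f0.
  rewrite (@fubini_tonelli1 _ _ _ _ _ mu mu f mf f0).
  rewrite /fubini_F /fubini_G /=.
  have mF := @measurable_fun_fubini_tonelli_F _ _ _ _ _ mu f mf f0.
  have F0 x : (0 <= fubini_F mu f x)%E by exact: integral_ge0.
  transitivity (\int[mu]_y (`|c|^-1%:E * \int[mu]_x f ((u + b * y)%R, x)))%E.
    apply: eq_integral => y _.
    rewrite -(@ge0_integral_affine1 (v + e * y) c (fun x => f ((u + b * y)%R, x)))//; last exact: measurable_fun_pair2.
    apply: eq_integral => x _; congr f; rewrite /affine2 /= a0.
    by congr pair; ring.
  rewrite ge0_integralZl//; try exact: (measurableT_comp mF (measurable_affine1 u b));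
    try (by move=> y _; exact: F0).
  by rewrite (@ge0_integral_affine1 u b (fubini_F mu f))// muleA -EFinM.
exists (`|a|^-1 * `|(a * e - b * c) / a|^-1) => f mf f0.
have ae0 : (a * e - b * c) / a != 0 by rewrite mulf_neq0// invr_neq0.
have mfA : measurable_fun setT (f \o affine2 a b c e u v).
  by apply: measurableT_comp => //; exact: measurable_affine2.
rewrite (@fubini_tonelli2 _ _ _ _ _ mu mu (f \o affine2 a b c e u v) mfA)//; last by move=> p; exact: f0.
rewrite (@fubini_tonelli1 _ _ _ _ _ mu mu f mf f0).
rewrite /fubini_G /fubini_F /=.
(* [g] is [f] with the first variable eliminated: for $x'=u+ax+by$ the second coordinate is
   $v+(c/a)(x'-u)+((ae-bc)/a)\,y$. The two one-dimensional factors multiply to the inverse of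
   $|ae-bc|$. *)
pose g (q : RB * RB) := f (q.1, (v + c / a * (q.1 - u)) + (a * e - b * c) / a * q.2).
have mg : measurable_fun setT g.
  apply: measurableT_comp => //; apply: measurable_fun_pair => //.
  apply: measurable_funD; last by apply: measurable_funM.
  by apply: measurable_funD => //; apply: measurable_funM => //; exact: measurable_funB.
have g0 q : (0 <= g q)%E by exact: f0.
transitivity (\int[mu]_y (`|a|^-1%:E * \int[mu]_x g (x, y)))%E.
  apply: eq_integral => y _.
  rewrite -(@ge0_integral_affine1 (u + b * y) a (fun x => g (x, y)))//; last exact: measurable_fun_pair1.
  apply: eq_integral => x _; rewrite /g /affine2 /=; congr f.
  by congr pair; [ring|field].
have mG := @measurable_fun_fubini_tonelli_G _ _ _ _ _ mu g mg g0.
have mF := @measurable_fun_fubini_tonelli_F _ _ _ _ _ mu f mf f0.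
rewrite ge0_integralZl//; try exact: mG; try (by move=> y _; exact: integral_ge0).
rewrite -(@fubini_tonelli _ _ _ _ _ mu mu g mg g0) EFinM -muleA; congr (_ * _)%E.
rewrite -ge0_integralZl//; try exact: mF; try (by move=> y _; exact: integral_ge0).
apply: eq_integral => x _; rewrite /g /=.
rewrite -(@ge0_integral_affine1 (v + c / a * (x - u)) ((a * e - b * c) / a) (fun y => f (x, y)))//.
exact: measurable_fun_pair2.
Qed.

Lemma integral_affine2 a b c e u v : a * e - b * c != 0 ->
  exists k : R, forall f : RB * RB -> \bar R, (mu \x mu)%E.-integrable setT f ->
  (\int[mu \x mu]_p f (affine2 a b c e u v p) = k%:E * \int[mu \x mu]_p f p)%E.
Proof.
move=> /(@ge0_integral_affine2 a b c e u v) [k H]; exists k => f fi.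
have mf := measurable_int _ fi.
rewrite integralE [in RHS]integralE.
have -> : (\int[mu \x mu]_p (fun p => f (affine2 a b c e u v p))^\+ p =
    k%:E * \int[mu \x mu]_p f^\+ p)%E.
  rewrite -H//; last exact: measurable_funepos.
  by apply: eq_integral => p _; rewrite !funeposE.
have -> : (\int[mu \x mu]_p (fun p => f (affine2 a b c e u v p))^\- p =
    k%:E * \int[mu \x mu]_p f^\- p)%E.
  rewrite -H//; last exact: measurable_funeneg.
  by apply: eq_integral => p _; rewrite !funenegE.
have mulB (P Q : \bar R) : P \is a fin_num -> Q \is a fin_num ->
    (k%:E * P - k%:E * Q = k%:E * (P - Q))%E.
  by case: P => [p||//] //; case: Q => [q||//] // _ _; exact: (congr1 EFin (esym (mulrBr k p q))).
apply: mulB; first exact: integrable_pos_fin_num fi.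
exact: integrable_neg_fin_num fi.
Qed.

End AffineChange.

(** * Orthonormal coordinates attached to a face *)

Section FaceGeometry.
Context (R : realType).
Implicit Types (F : face R) (K : polyhedron R).

Lemma dot2E (u v : 'rV[R]_2) : dot u v = u 0 0 * v 0 0 + u 0 1 * v 0 1.
Proof. by rewrite /dot !big_ord_recl big_ord0 addr0; congr (_ * _ + _ * _); congr (_ _ _); exact: val_inj. Qed.

Lemma dot3E (u v : 'rV[R]_3) :
  dot u v = u 0 0 * v 0 0 + u 0 1 * v 0 1 + u 0 2 * v 0 2.
Proof.
rewrite /dot !big_ord_recl big_ord0 addr0 addrA.
by congr (_ * _ + _ * _ + _ * _); congr (_ _ _); exact: val_inj.
Qed.

Lemma dotBr n (u v w : 'rV[R]_n) : dot u (v - w) = dot u v - dot u w.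
Proof. by rewrite -scaleN1r dotDr dotZr mulN1r. Qed.

Lemma dot0r n (u : 'rV[R]_n) : dot u 0 = 0.
Proof. by rewrite -(scale0r 0) dotZr mul0r. Qed.

Lemma dotZl n a (u v : 'rV[R]_n) : dot (a *: u) v = a * dot u v.
Proof. by rewrite !(dotC _ v) dotZr. Qed.

Lemma row2_eq (u v : 'rV[R]_2) : u 0 0 = v 0 0 -> u 0 1 = v 0 1 -> u = v.
Proof.
move=> h0 h1; apply/rowP => -[[|[|//]] i].
  by rewrite (_ : Ordinal i = 0)//; exact: val_inj.
by rewrite (_ : Ordinal i = 1)//; exact: val_inj.
Qed.

(** Planar coordinates of the orthogonal projection onto the plane of the face: defined on all of
    space, and inverse to [fpar] on the plane. *)
Definition fcoord F (x : 'rV[R]_3) : 'rV[R]_2 :=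
  vec2 (dot (ftan0 F) (x - forig F)) (dot (ftan1 F) (x - forig F)).

Definition fmx F : 'M[R]_(2, 3) := \matrix_(i, j) [:: ftan0 F 0 j; ftan1 F 0 j]`_i.

Lemma fparE F y : fpar F y = forig F + y *m fmx F.
Proof.
rewrite /fpar -addrA; congr (_ + _); apply/rowP => j.
rewrite !mxE !big_ord_recl big_ord0 addr0 !mxE /=.
by congr (y _ _ * _ + y _ _ * _); exact: val_inj.
Qed.

Lemma continuous_fpar F : continuous (fpar F).
Proof.
move=> y; apply: differentiable_continuous.
rewrite (_ : fpar F = fun y => forig F + y *m fmx F); last by apply/funext => z; exact: fparE.
by have [] := derivable_affine (fmx F) (forig F) y.
Qed.

Lemma fcoordE F x : fcoord F x = fcoord F 0 + x *m (fmx F)^T.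
Proof.
have E u : \sum_j x 0 j * (fmx F)^T j u = dot (row u (fmx F)) x.
  by apply: eq_bigr => j _; rewrite !mxE mulrC.
have r0 : row 0 (fmx F) = ftan0 F by apply/rowP => j; rewrite !mxE.
have r1 : row 1 (fmx F) = ftan1 F by apply/rowP => j; rewrite !mxE.
by apply: row2_eq; rewrite !mxE E /= ?r0 ?r1 !dotBr dot0r sub0r addrC.
Qed.

Lemma continuous_fcoord F : continuous (fcoord F).
Proof.
move=> y; apply: differentiable_continuous.
rewrite (_ : fcoord F = fun y => fcoord F 0 + y *m (fmx F)^T); last first.
  by apply/funext => z; exact: fcoordE.
by have [] := derivable_affine (fmx F)^T (fcoord F 0) y.
Qed.

Lemma continuous_dotB (v w : 'rV[R]_3) : continuous (fun x : 'rV[R]_3 => dot v (x - w)).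
Proof.
have -> : (fun x : 'rV[R]_3 => dot v (x - w)) = (dot v \- cst (dot v w)).
  by apply/funext => x; rewrite dotBr.
have c : continuous (dot v) := @continuous_dot R 3 v.
by move=> x; apply: continuousB; [exact: c|exact: cst_continuous].
Qed.

Section Orthonormal.
Variable F : face R.
Hypothesis wF : wf_face F.
Let t0 := ftan0 F.
Let t1 := ftan1 F.
Let n := fnor F.

(** Lagrange's identity $|t_0\times t_1|^2=|t_0|^2|t_1|^2-(t_0\cdot t_1)^2$. *)
Lemma fnor_norm : dot n n = 1.
Proof.
case: wF => h0 h1 h01 _; rewrite -/t0 -/t1 in h0 h1 h01.
have : dot t0 t0 * dot t1 t1 - dot t0 t1 ^+ 2 = 1 by rewrite h0 h1 h01 expr0n/= mulr1 subr0.
move=> <-; rewrite !dot3E /n /fnor /cross !mxE /= -/t0 -/t1.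
by ring.
Qed.

Lemma fnor_tan0 : dot n t0 = 0.
Proof. by rewrite dot3E /n /fnor /cross !mxE /= -/t0 -/t1; ring. Qed.

Lemma fnor_tan1 : dot n t1 = 0.
Proof. by rewrite dot3E /n /fnor /cross !mxE /= -/t0 -/t1; ring. Qed.

Lemma fnor_neq0 : n != 0.
Proof.
apply/eqP => n0; have := fnor_norm; rewrite n0 dot3E !mxE !mulr0 !addr0 => /eqP.
by rewrite eq_sym oner_eq0.
Qed.

(** The matrix [M] of the three vectors satisfies [M *m M^T = 1]; a one-sided inverse of a square
    matrix is two-sided, and [M^T *m M = 1] is the expansion. *)
Lemma fbasis (v : 'rV[R]_3) : v = dot t0 v *: t0 + dot t1 v *: t1 + dot n v *: n.
Proof.
case: wF => h0 h1 h01 _; rewrite -/t0 -/t1 in h0 h1 h01.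
pose M : 'M[R]_3 := \matrix_(i, j) [:: t0 0 j; t1 0 j; n 0 j]`_i.
have MM : M *m M^T = 1%:M.
  apply/matrixP => i j; rewrite !mxE.
  have -> : \sum_k M i k * M^T k j = dot (row i M) (row j M).
    by apply: eq_bigr => k _; rewrite !mxE.
  have r0 : row 0 M = t0 by apply/rowP => k; rewrite !mxE.
  have r1 : row 1 M = t1 by apply/rowP => k; rewrite !mxE.
  have r2 : row 2 M = n by apply/rowP => k; rewrite !mxE.
  by case: (ord3P i) => ->; case: (ord3P j) => ->;
    rewrite ?r0 ?r1 ?r2 ?h0 ?h1 ?h01 ?fnor_norm ?fnor_tan0 ?fnor_tan1
      1?dotC ?h01 ?fnor_tan0 ?fnor_tan1.
have {1}-> : v = v *m M^T *m M by rewrite -mulmxA (mulmx1C MM) mulmx1.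
apply/rowP => k; rewrite [LHS]mxE !big_ord_recl big_ord0 addr0 addrA [RHS]mxE [X in _ = X + _]mxE.
have E i : (v *m M^T) 0 i = dot v (row i M).
  by rewrite mxE; apply: eq_bigr => j _; rewrite !mxE.
have rM : [/\ row ord0 M = t0, row (lift ord0 ord0) M = t1 & row (lift ord0 (lift ord0 ord0)) M = n].
  by split; apply/rowP => l; rewrite 2![LHS]mxE.
case: rM => r0 r1 r2.
have Mk i : M i k = row i M 0 k by rewrite [RHS]mxE.
by rewrite !E !Mk r0 r1 r2 !(dotC v) -/n; congr (_ + _ + _); rewrite [RHS]mxE.
Qed.

Lemma fpar_sub y : fpar F y - forig F = y 0 0 *: t0 + y 0 1 *: t1.
Proof. by rewrite /fpar -(addrA (forig F)) [LHS]addrC addKr. Qed.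

Lemma fcoordK x : dot n (x - forig F) = 0 -> fpar F (fcoord F x) = x.
Proof.
move=> nx; apply: (addIr (- forig F)); rewrite [RHS]fbasis nx scale0r addr0.
by rewrite fpar_sub !mxE.
Qed.

Lemma fparK y : fcoord F (fpar F y) = y.
Proof.
case: wF => h0 h1 h01 _; rewrite -/t0 -/t1 in h0 h1 h01.
by apply: row2_eq; rewrite !mxE /= fpar_sub dotDr !dotZr -/t0 -/t1 ?h0 ?h1 ?h01
  1?(dotC t1) ?h01; ring.
Qed.

Lemma fpar_plane y : dot n (fpar F y - forig F) = 0.
Proof.
by rewrite fpar_sub dotDr !dotZr fnor_tan0 fnor_tan1 !mulr0 addr0.
Qed.

Lemma fopenP x : fopen F x <-> dot n (x - forig F) = 0 /\ fset2 F (fcoord F x).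
Proof.
split=> [[y Fy <-]|[nx Fx]]; first by rewrite fparK fpar_plane.
by exists (fcoord F x) => //; rewrite fcoordK.
Qed.

Lemma fclosedP x : Defs.fclosed F x <->
  dot n (x - forig F) = 0 /\ closure (fset2 F) (fcoord F x).
Proof.
split=> [[y Fy <-]|[nx Fx]]; first by rewrite fparK fpar_plane.
by exists (fcoord F x) => //; rewrite fcoordK.
Qed.

Lemma closed_fclosed : closed (Defs.fclosed F).
Proof.
have -> : Defs.fclosed F = ((fun x => dot n (x - forig F)) @^-1` [set 0]) `&`
    (fcoord F @^-1` closure (fset2 F)).
  by apply/seteqP; split => x /fclosedP.
apply: closedI; apply: closed_comp.
- by move=> x _; exact: continuous_dotB.
- exact: closed_eq.
- by move=> x _; exact: continuous_fcoord.
- exact: closed_closure.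
Qed.

Lemma open_fset2 : open (fset2 F).
Proof. by case: wF => _ _ _ [[]]. Qed.

Lemma plane_near_fopen x : fopen F x ->
  \forall z \near x, dot n (z - forig F) = 0 -> fopen F z.
Proof.
move=> /fopenP[_ Fx].
have : \forall z \near x, fset2 F (fcoord F z).
  by apply: (continuous_fcoord (open_nbhs_nbhs _)); split => //; exact: open_fset2.
by apply: filterS => z Fz nz; apply/fopenP.
Qed.

(* An open face spans two independent directions: it is neither an edge nor a
   vertex. *)
Lemma fopen_not_in_line (a v : 'rV[R]_3) :
  fset2 F !=set0 -> ~ (fopen F `<=` [set x | exists s, x = a + s *: v]).
Proof.
move=> [y Fy] sub; case: wF => h0 h1 h01 _; rewrite -/t0 -/t1 in h0 h1 h01.
have /nbhs_ballP[e /= e0 ye] := open_nbhs_nbhs (conj open_fset2 Fy).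
have e2 : 0 < e / 2 by rewrite divr_gt0.
(* Two displaced points of the face, whose images differ from [fpar F y] by $(e/2)t_0$ and
   $(e/2)t_1$. On a line both differences would be multiples of [v], against orthogonality. *)
have inF (k : 'I_2) : fset2 F (y + (e / 2) *: delta_mx 0 k).
  apply: ye; split => // i j; rewrite /ball/= !mxE opprD addrA subrr sub0r normrN.
  rewrite normrM (gtr0_norm e2).
  apply: (@le_lt_trans _ _ (e / 2)); last by rewrite [ltRHS]splitr ltrDl.
  by rewrite ler_piMr ?(ltW e2)//; case: (_ && _); rewrite ?normr1 ?normr0.
have [s Es] := sub _ (ex_intro2 _ _ _ Fy erefl).
have [s0 Es0] := sub _ (ex_intro2 _ _ _ (inF 0) erefl).
have [s1 Es1] := sub _ (ex_intro2 _ _ _ (inF 1) erefl).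
have dF k : fpar F (y + (e / 2) *: delta_mx 0 k) - fpar F y = (e / 2) *: row k (fmx F).
  by rewrite !fparE mulmxDl -scalemxAl -rowE opprD addrACA subrr add0r addrAC subrr add0r.
have D s1' s2 : a + s1' *: v - (a + s2 *: v) = (s1' - s2) *: v.
  by rewrite opprD addrACA subrr add0r scalerBl.
have := dF 0; rewrite Es0 Es D (_ : row 0 _ = t0) => [D0|]; last first.
  by apply/rowP => j; rewrite !mxE.
have := dF 1; rewrite Es1 Es D (_ : row 1 _ = t1) => [D1|]; last first.
  by apply/rowP => j; rewrite !mxE.
set q := dot v v; set c0 := s0 - s in D0; set c1 := s1 - s in D1; set k := e / 2 in e2 D0 D1.
have p01 : c0 * c1 * q = 0.
  have : dot (c0 *: v) (c1 *: v) = 0 by rewrite D0 D1 dotZr dotZl h01 !mulr0.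
  by rewrite dotZr dotZl mulrA [c1 * _]mulrC.
have p00 : c0 * c0 * q = k * k.
  have : dot (c0 *: v) (c0 *: v) = k * k by rewrite D0 dotZr dotZl h0 mulr1.
  by rewrite dotZr dotZl mulrA.
have p11 : c1 * c1 * q = k * k.
  have : dot (c1 *: v) (c1 *: v) = k * k by rewrite D1 dotZr dotZl h1 mulr1.
  by rewrite dotZr dotZl mulrA.
have : (k * k) * (k * k) = 0.
  rewrite -{1}p00 -p11.
  have -> : c0 * c0 * q * (c1 * c1 * q) = (c0 * c1 * q) ^+ 2 by ring.
  by rewrite p01 expr0n.
by apply/eqP; rewrite !mulf_neq0// gt_eqF.
Qed.

End Orthonormal.
End FaceGeometry.

(** * A polyhedron is locally a half-space at its open faces *)

Section PolyhedronGeometry.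
Context (R : realType).
Implicit Types (F : face R) (K : polyhedron R).

Lemma segpt_ball n (x a b : 'rV[R]_n) e s :
  ball x e a -> ball x e b -> 0 <= s <= 1 -> ball x e (segpt (a, b) s).
Proof.
rewrite -!ball_normE /ball_ /= => xa xb /andP[s0 s1].
have -> : x - segpt (a, b) s = (1 - s) *: (x - a) + s *: (x - b).
  by apply/rowP => j; rewrite !mxE /=; ring.
apply: le_lt_trans (ler_normD _ _) _; rewrite !normrZ (ger0_norm s0) ger0_norm ?subr_ge0//.
have [->|s0'] := eqVneq s 0; first by rewrite subr0 mul1r mul0r addr0.
have -> : e = (1 - s) * e + s * e by ring.
apply: ler_ltD; first by rewrite ler_wpM2l ?subr_ge0// ltW.
by rewrite ltr_pM2l// lt_neqAle eq_sym s0'.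
Qed.

Lemma dot_segpt n (v a b x : 'rV[R]_n) s :
  dot v (segpt (a, b) s - x) = (1 - s) * dot v (a - x) + s * dot v (b - x).
Proof.
rewrite -!dotZr -dotDr; congr dot.
by apply/rowP => j; rewrite !mxE /=; ring.
Qed.

Lemma continuous_segpt n (a b : 'rV[R]_n) : continuous (segpt (a, b)).
Proof.
move=> s; apply: differentiable_continuous; exact: differentiableD.
Qed.

(** Off the boundary [D] agrees with its closure, so the parameters whose point lies in [D] form an
    open and closed part of $[0,1]$, which is connected. *)
Lemma segment_off_bdry n (D : set 'rV[R]_n) a b : open D ->
  (forall s, 0 <= s <= 1 -> ~ bdry D (segpt (a, b) s)) -> D a -> D b.
Proof.
move=> oD off Da; pose B := [set s : R | 0 <= s <= 1 /\ D (segpt (a, b) s)].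
have BE : B = `[0, 1]%classic.
  apply: (@segment_connected R 0 1).
  - exists 0; split; first by rewrite lexx ler01.
    by rewrite /segpt scale0r addr0.
  - exists (segpt (a, b) @^-1` D).
      by apply: open_comp => // s _; exact: continuous_segpt.
    by apply/seteqP; split => s; rewrite /B /= in_itv /=.
  - exists (segpt (a, b) @^-1` closure D).
      by apply: closed_comp => [s _|]; [exact: continuous_segpt|exact: closed_closure].
    apply/seteqP; split => s; rewrite /B /= in_itv /=.
      by move=> [s01 Ds]; split => //; exact: subset_closure.
    move=> [s01 Ds]; split => //; apply: contrapT => nD; apply: (off _ s01).
    by split => // /interior_subset.
have : B 1 by rewrite BE /= in_itv /= ler01 lexx.
by move=> [_]; rewrite /segpt scale1r addrC subrK.
Qed.

Lemma fpar_segpt F e s : fpar F (segpt e s) = segpt (fpar F e.1, fpar F e.2) s.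
Proof.
rewrite /segpt /= !fparE; apply/rowP => j.
by rewrite !(mxE, big_ord_recl, big_ord0) /=; ring.
Qed.

Lemma fclosed_cases F x : wf_face F -> Defs.fclosed F x ->
  fopen F x \/ exists e : 'I_(pgne (fpg F)), cseg (fedge3 e) x.
Proof.
move=> wF [y Fy <-]; have [Fo|Fo] := pselect (fset2 F y); first by left; exists y.
right; have : bdry (fset2 F) y by split => // /interior_subset.
case: (wF) => _ _ _ [_ _ -> _ _] [e _ [s s01 <-]].
by exists e; exists s => //; rewrite fpar_segpt.
Qed.

Section Polyhedron.
Variable K : polyhedron R.
Hypothesis wK : wf_polyhedron K.

Lemma wf_polyhedron_face i : wf_face (@phface _ K i).
Proof. by case: wK => _ []. Qed.

Lemma open_phset : open (phset K).
Proof. by case: wK => [[]]. Qed.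

Lemma fset2_neq0 i : fset2 (@phface _ K i) !=set0.
Proof. by case: (wf_polyhedron_face i) => _ _ _ [[]]. Qed.

Lemma fclosed_bdry i : Defs.fclosed (@phface _ K i) `<=` bdry (phset K).
Proof. by case: wK => _ [_ ->] _ _ _ x Fx; exists i. Qed.

Lemma fopen_bdry i : fopen (@phface _ K i) `<=` bdry (phset K).
Proof.
by move=> x [y Fy <-]; apply: (@fclosed_bdry i); exists y => //; exact: subset_closure.
Qed.

(** A closed face is its open face together with edges and vertices, which are cells. Conformity
    makes the open face [i] equal to such a cell or disjoint from it, and equality would put it
    inside a line. *)
Lemma fopen_other i j x : i <> j -> fopen (@phface _ K i) x -> ~ Defs.fclosed (@phface _ K j) x.
Proof.
move=> ij Fx /(fclosed_cases (wf_polyhedron_face j)) [Fj|[e [s /= s01 sx]]].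
  by case: wK => _ _ /(_ _ _ ij) H _ _; have : set0 x by rewrite -H.
have [c [cc cx [a [v cl]]]] : exists c, [/\ cells K c, c x & exists a v,
    forall y, c y -> exists s, y = a + s *: v].
  have [s0|s0] := eqVneq s 0.
    exists [set (fedge3 e).1]; split.
    - by exists j; right; exists e; apply: Or32.
    - by rewrite /= -sx s0 /segpt scale0r addr0.
    - by exists (fedge3 e).1, 0 => y ->; exists 0; rewrite scaler0 addr0.
  have [s1|s1] := eqVneq s 1.
    exists [set (fedge3 e).2]; split.
    - by exists j; right; exists e; apply: Or33.
    - by rewrite /= -sx s1 /segpt scale1r addrC subrK.
    - by exists (fedge3 e).2, 0 => y ->; exists 0; rewrite scaler0 addr0.
  exists (oseg (fedge3 e)); split.
  - by exists j; right; exists e; apply: Or31.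
  - exists s => //=; move: s01 => /andP[h0 h1]; rewrite !lt_neqAle h0 h1.
    by rewrite eq_sym s0 s1.
  - by exists (fedge3 e).1, ((fedge3 e).2 - (fedge3 e).1) => y [r _ <-]; exists r.
have ci : cells K (fopen (@phface _ K i)) by exists i; left.
case: wK => _ _ _ /(_ _ _ ci cc) [E|E] _.
  apply: (@fopen_not_in_line _ _ (wf_polyhedron_face i) a v (fset2_neq0 i)).
  by rewrite E => y /cl.
by have : set0 x by rewrite -E.
Qed.

(** The finitely many other closed faces are closed and miss [x], so they miss a neighbourhood; the
    boundary that remains lies in the plane of face [i]. *)
Lemma near_bdry_fopen i x : fopen (@phface _ K i) x ->
  \forall z \near x, bdry (phset K) z -> fopen (@phface _ K i) z.
Proof.
move=> Fx.
have H j : \forall z \near x, i <> j -> ~ Defs.fclosed (@phface _ K j) z.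
  have [->|/eqP ij] := eqVneq i j; first by apply/nbhs_ballP; exists 1 => //= z _ /(_ erefl).
  have : open_nbhs x (~` Defs.fclosed (@phface _ K j)).
    split; first by apply: closed_openC; exact: closed_fclosed (wf_polyhedron_face j).
    exact: fopen_other ij Fx.
  by move=> /open_nbhs_nbhs; apply: filterS => z.
have {}H : \forall z \near x, forall j, i <> j -> ~ Defs.fclosed (@phface _ K j) z.
  exact: (filter_forall (F := nbhs x) _ H).
have P := plane_near_fopen (wf_polyhedron_face i) Fx.
apply: filterS2 H P => z Hz Pz; case: (wK) => _ [_ ->] _ _ _ [j _ Fj].
have [ij|ij] := pselect (i = j); last by have := Hz _ ij Fj.
by apply: Pz; move: Fj; rewrite -ij => /(fclosedP (wf_polyhedron_face i))[].
Qed.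

(** In a small ball the boundary lies in the plane of the face, so membership is constant along
    segments strictly on one side. The normal condition of [wf_polyhedron] provides one point inside
    the element and one outside, on either side. Points of the plane are boundary points, which the
    open element excludes. *)
Lemma half_space_near_fopen i x : fopen (@phface _ K i) x ->
  \forall z \near x, phset K z <-> dot (fnor (@phface _ K i)) (z - x) < 0.
Proof.
move=> Fx; set F := @phface _ K i; set n := fnor F.
have wF : wf_face F := wf_polyhedron_face i.
have nx : dot n (x - forig F) = 0 by have [] := (fopenP wF x).1 Fx.
have shiftE z : dot n (z - forig F) = dot n (z - x).
  have -> : z - x = (z - forig F) - (x - forig F) by rewrite opprB addrA subrK.
  by rewrite [RHS]dotBr nx subr0.
have := near_bdry_fopen Fx; have := plane_near_fopen wF Fx => N1 N2.
have /nbhs_ballP[e /= e0 xe] : \forall z \near x,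
    (dot n (z - forig F) = 0 -> fopen F z) /\ (bdry (phset K) z -> fopen F z).
  by apply: filterS2 N1 N2.
have off s : ball x e s -> dot n (s - x) != 0 -> ~ bdry (phset K) s.
  move=> /xe[_ H] ns /H /(fopenP wF)[]; rewrite shiftE => /eqP.
  by rewrite (negbTE ns).
have nn : dot n n = 1 := fnor_norm wF.
have [s [s0 sm sp Ds nDs]] : exists s, [/\ 0 < s, ball x e (x - s *: n), ball x e (x + s *: n),
    phset K (x - s *: n) & ~ phset K (x + s *: n)].
  case: wK => _ _ _ _ /(_ i x Fx) H.
  have e1 : \forall s \near (0:R)^'+, ball x e (x - s *: n) /\ ball x e (x + s *: n).
    have n0 : 0 < `|n| by rewrite normr_gt0 (fnor_neq0 wF).
    have : \forall s \near (0:R)^'+, s < e / `|n|.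
      by apply: nbhs_right_lt; rewrite divr_gt0.
    have P0 : \forall s \near (0:R)^'+, 0 < s by exact: nbhs_right_gt.
    apply: filterS2 P0 => s s0; rewrite ltr_pdivlMr// => sn.
    rewrite -ball_normE /ball_/= opprB addrCA subrr addr0 opprD addrA subrr sub0r normrN.
    by rewrite normrZ gtr0_norm.
  have P0 : \forall s \near (0:R)^'+, 0 < s by exact: nbhs_right_gt.
  have [s [[b1 b2] [s0 [D1 D2]]]] := filter_ex (filterI e1 (filterI P0 H)).
  by exists s; split.
have dm : dot n (x - s *: n - x) = - s.
  by rewrite addrAC subrr add0r -scaleNr dotZr nn mulr1.
have dp : dot n (x + s *: n - x) = s.
  by rewrite addrAC subrr add0r dotZr nn mulr1.
apply/nbhs_ballP; exists e => //= z zb.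
have [zl|zl|zl] := ltgtP (dot n (z - x)) 0.
- split => // _; apply: (segment_off_bdry open_phset _ Ds) => r r01.
  apply: off; first exact: segpt_ball.
  rewrite dot_segpt dm lt_eqF//; case/andP: r01 => r0 r1.
  have [->|r0'] := eqVneq r 0; first by rewrite subr0 mul1r mul0r addr0 oppr_lt0.
  rewrite -oppr_gt0 opprD mulrN opprK ltr_wpDl ?mulr_ge0 ?subr_ge0// ?(ltW s0)//.
  by rewrite -mulrN mulr_gt0 ?oppr_gt0// lt_neqAle eq_sym r0'.
- split=> // Dz; exfalso; apply: nDs; apply: (segment_off_bdry open_phset _ Dz) => r r01.
  apply: off; first exact: segpt_ball.
  rewrite dot_segpt dp gt_eqF//; case/andP: r01 => r0 r1.
  have [->|r0'] := eqVneq r 0; first by rewrite subr0 mul1r mul0r addr0.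
  rewrite ltr_wpDl ?mulr_ge0 ?subr_ge0// ?(ltW zl)//.
  by rewrite mulr_gt0// lt_neqAle eq_sym r0'.
- split=> // Dz; exfalso; have [] := xe _ zb; rewrite shiftE => /(_ zl) Fz _.
  by have [_] := fopen_bdry Fz; apply; rewrite (interior_id _).1//; exact: open_phset.
Qed.

End Polyhedron.
End PolyhedronGeometry.

Section Lines.
Context (R : realType).
Local Notation RB := (measurableTypeR R).

Lemma ins_line (m : 'I_3) (p : RB * RB) (s t : R) :
  ins m (p, s) - ins m (p, t) = (s - t) *: delta_mx 0 m :> 'rV[R]_3.
Proof.
by rewrite (ins_shift m p s) (ins_shift m p t) opprD addrACA subrr add0r scalerBl.
Qed.

Lemma continuous_ins (m : 'I_3) (p : RB * RB) : continuous (fun s : R => ins m (p, s)).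
Proof.
move=> s; apply: differentiable_continuous.
rewrite (_ : (fun _ => _) = fun s => ins m (p, 0) + s *: delta_mx 0 m); last first.
  by apply/funext => r; exact: ins_shift.
exact: differentiableD.
Qed.

Lemma near_ins (m : 'I_3) (p : RB * RB) (t : R) (P : set 'rV[R]_3) :
  (\forall z \near ins m (p, t), P z) -> \forall s \near t, P (ins m (p, s)).
Proof. by move=> nP; exact: (continuous_ins nP). Qed.

Lemma is_derive_ins (m : 'I_3) (p : RB * RB) (phi : 'rV[R]_3 -> R) (t : R) : smooth phi ->
  is_derive t (1 : R) (fun t => phi (ins m (p, t))) (pd m phi (ins m (p, t))).
Proof.
move=> sphi; rewrite (_ : (fun t => _) = fun t => phi (ins m (p, 0) + t *: delta_mx 0 m)).
  rewrite [in X in is_derive _ _ _ X]ins_shift.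
  by apply: is_derive_line; exact: smooth_differentiable.
by apply/funext => s; rewrite -ins_shift.
Qed.

Lemma compact_ins_out (C : set 'rV[R]_3) : compact C ->
  exists M : R, forall m p t, M < `|t| -> ~ C (ins m (p, t)).
Proof.
move=> /compact_bounded[M [_ /(_ (`|M| + 1))]] CM; exists (`|M| + 2) => m p t Mt Ct.
have : ball (0 : 'rV[R]_3) (`|M| + 2) (ins m (p, t)).
  rewrite -ball_normE /ball_/= sub0r normrN.
  apply: le_lt_trans (CM _ _ Ct) _; last by rewrite ltrD2l ltr1n.
  by rewrite (le_lt_trans (ler_norm _))// ltrDl.
move=> [_ /(_ 0 m)]; rewrite ins_coord /ball/= mxE sub0r normrN.
by rewrite ltNge (ltW Mt).
Qed.

End Lines.

(** * Projection onto the plane of a face along a coordinate axis *)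

Section FootPoint.
Context (R : realType) (F : face R).
Local Notation RB := (measurableTypeR R).
Let n := fnor F.

(** The solution [t] of [dot n (ins m (p, t) - forig F) = 0], meaningful when [n 0 m] is nonzero. *)
Definition crossing m (p : RB * RB) : R := - dot n (ins m (p, 0) - forig F) / n 0 m.

Definition footpt m p : 'rV[R]_3 := ins m (p, crossing m p).

Lemma footpt_plane m p : n 0 m != 0 -> dot n (footpt m p - forig F) = 0.
Proof.
move=> nm; rewrite /footpt dotBr dot_ins /crossing dotBr.
by field.
Qed.

Lemma dot_ins0 m (v : 'rV[R]_3) p : dot v (ins m (p, 0)) =
  nth 0 [:: v 0 1; v 0 0; v 0 0] m * p.1 + nth 0 [:: v 0 2; v 0 2; v 0 1] m * p.2.
Proof.
by rewrite dot3E !mxE; case: (ord3P m) => -> /=; ring.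
Qed.

(** Coefficient of one transverse coordinate in [dot v (footpt m p)] once the parameter [crossing]
    is eliminated; [w] selects that coordinate. *)
Let slope m (v : 'rV[R]_3) (w : 'rV[R]_3 -> R) := w v - w n * v 0 m / n 0 m.

Lemma fcoord_footpt m : wf_face F -> n 0 m != 0 ->
  exists a b c e u v : R, a * e - b * c != 0 /\
    forall p, fcoord F (footpt m p) = row2 (affine2 a b c e u v p).
Proof.
move=> wF nm.
pose w1 (v : 'rV[R]_3) := nth 0 [:: v 0 1; v 0 0; v 0 0] m.
pose w2 (v : 'rV[R]_3) := nth 0 [:: v 0 2; v 0 2; v 0 1] m.
pose o (v : 'rV[R]_3) := - dot v (forig F) + dot n (forig F) * v 0 m / n 0 m.
exists (slope m (ftan0 F) w1), (slope m (ftan0 F) w2),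
  (slope m (ftan1 F) w1), (slope m (ftan1 F) w2), (o (ftan0 F)), (o (ftan1 F)).
split; last first.
  have E v p : dot v (footpt m p - forig F) = o v + (slope m v w1 * p.1 + slope m v w2 * p.2).
    rewrite /footpt dotBr dot_ins /crossing dotBr !dot_ins0 /o /slope /w1 /w2.
    by field.
  by move=> p; apply: row2_eq; rewrite !mxE /= E.
have nn : dot n n = 1 := fnor_norm wF.
rewrite /slope.
(* The slopes form the Schur complement of $n_m$ in the matrix with rows $t_0,t_1,n$, whose
   determinant is $|n|^2=1$ up to the sign of the permutation that moves column [m] to the end. *)
suff : (w1 (ftan0 F) - w1 n * ftan0 F 0 m / n 0 m) * (w2 (ftan1 F) - w2 n * ftan1 F 0 m / n 0 m) -
  (w2 (ftan0 F) - w2 n * ftan0 F 0 m / n 0 m) * (w1 (ftan1 F) - w1 n * ftan1 F 0 m / n 0 m)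
  = nth 0 [:: 1; -1; 1] m / n 0 m.
  move=> ->; rewrite mulf_neq0 ?invr_eq0//.
  by case: (ord3P m) => -> /=; rewrite ?oppr_eq0 oner_eq0.
(* Once 1 is written as [dot n n] the claim is a rational identity in the entries of the two
   tangents. *)
have -> : nth 0 [:: 1; -1; 1] m / n 0 m = nth 0 [:: 1; -1; 1] m * dot n n / n 0 m by rewrite nn mulr1.
rewrite dot3E /w1 /w2; move: nm.
have n0 : n 0 0 = ftan0 F 0 1 * ftan1 F 0 2 - ftan0 F 0 2 * ftan1 F 0 1 by rewrite mxE.
have n1 : n 0 1 = ftan0 F 0 2 * ftan1 F 0 0 - ftan0 F 0 0 * ftan1 F 0 2 by rewrite mxE.
have n2 : n 0 2 = ftan0 F 0 0 * ftan1 F 0 1 - ftan0 F 0 1 * ftan1 F 0 0 by rewrite mxE.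
case: (ord3P m) => -> /= nm.
- by rewrite n1 n2 n0; field; rewrite -n0.
- by rewrite n0 n2 n1; field; rewrite -n1.
- by rewrite n0 n1 n2; field; rewrite -n2.
Qed.

End FootPoint.

Section LocalDivergence.
Context (R : realType).
Local Notation RB := (measurableTypeR R).
Local Notation mu := (@lebesgue_measure R).
Variables (K : polyhedron R) (i : 'I_(phnf K)) (phi : 'rV[R]_3 -> R) (C : set 'rV[R]_3).
Hypotheses (wK : wf_polyhedron K) (sphi : smooth phi) (cC : compact C).
Hypotheses (CF : C `&` bdry (phset K) `<=` fopen (phface i)) (phi0 : forall x, ~ C x -> phi x = 0).
Let D := phset K.
Let F := phface i.
Let n := fnor F.
Let wF : wf_face F := wf_polyhedron_face wK i.

(** Off the compact set [C] the function vanishes nearby; in [D], or off its closure, the indicator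
    is locally constant. The only other points are boundary points in [C], and these lie in the open
    face. *)
Lemma near_indicator x : ~ (C x /\ fopen F x) ->
  (\forall z \near x, phi z = 0) \/ (\forall z \near x, \1_D z = \1_D x :> R).
Proof.
move=> nCF; have [Cx|nCx] := pselect (C x); last first.
  left; have : open_nbhs x (~` C).
    by split => //; apply: closed_openC; apply: compact_closed => //; exact: norm_hausdorff.
  by move=> /open_nbhs_nbhs; apply: filterS => z; exact: phi0.
right; have [Dx|nDx] := pselect (D x).
  have /open_nbhs_nbhs : open_nbhs x D by split => //; exact: open_phset wK.
  by apply: filterS => z Dz; rewrite !indicE !mem_set.
have /open_nbhs_nbhs : open_nbhs x (~` closure D).
  split; first by apply: closed_openC; exact: closed_closure.
  move=> cDx; apply: nCF; split => //; apply: CF; split => //; split => //.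
  by move=> /interior_subset.
by apply: filterS => z cDz; rewrite !indicE !memNset// => Dz; apply: cDz; exact: subset_closure.
Qed.

Section Line.
Variables (m : 'I_3) (p : RB * RB).
Let psi (t : R) := phi (ins m (p, t)).
Let dpsi (t : R) := pd m phi (ins m (p, t)).
Let h (t : R) := \1_D (ins m (p, t)) : R.

Let dpsiP (t : R) : is_derive t (1 : R) psi (dpsi t).
Proof. exact: is_derive_ins. Qed.

Let cdpsi : continuous dpsi.
Proof.
move=> t; apply: (@continuous_comp _ _ _ (fun s : R => ins m (p, s)) (pd m phi)).
  exact: continuous_ins.
by apply: smooth_continuous; exact: smooth_pd.
Qed.

Let M := projT1 (cid (compact_ins_out cC)).

Let psi0 t : M < `|t| -> psi t = 0.
Proof. by move=> Mt; apply: phi0; exact: (projT2 (cid (compact_ins_out cC))) Mt. Qed.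

Lemma line_integral_off : (forall t, ~ (C (ins m (p, t)) /\ fopen F (ins m (p, t)))) ->
  (\int[mu]_t (h t * dpsi t)%:E = 0)%E.
Proof.
move=> off; have [|_ ->//] := integral_jump_derive dpsiP cdpsi psi0 (h := h).
by move=> t; have [/near_ins|/near_ins] := near_indicator (off t); [left|right].
Qed.

Lemma line_integral_parallel : n 0 m = 0 -> (\int[mu]_t (h t * dpsi t)%:E = 0)%E.
Proof.
move=> nm; have [|_ ->//] := integral_jump_derive dpsiP cdpsi psi0 (h := h).
move=> t; have [Ft|nFt] := pselect (fopen F (ins m (p, t))); last first.
  have : ~ (C (ins m (p, t)) /\ fopen F (ins m (p, t))) by case.
  by move=> /near_indicator[/near_ins|/near_ins]; [left|right].
right; have /near_ins := half_space_near_fopen wK Ft.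
(* The line stays in the plane of the face, where the strict inequality of the half-space
   description fails, so near such a point it runs outside the element. *)
have out s : (D (ins m (p, s)) <-> dot n (ins m (p, s) - ins m (p, t)) < 0) -> h s = 0.
  rewrite ins_line dotZr dot_delta nm mulr0 ltxx => -[Ds _].
  by rewrite /h indicE memNset// => /Ds.
move=> H; have := nbhs_singleton H => /out ->.
by apply: filterS H => s /out.
Qed.

Lemma line_integral_cross t0 : n 0 m != 0 -> fopen F (ins m (p, t0)) ->
  (\int[mu]_t (h t * dpsi t)%:E = (Num.sg (n 0 m) * psi t0)%:E)%E.
Proof.
move=> nm F0.
have cross t : fopen F (ins m (p, t)) -> t = t0.
  move=> /(fopenP wF)[nt _]; move: F0 => /(fopenP wF)[n0 _].
  have : dot n (ins m (p, t) - ins m (p, t0)) = 0.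
    have -> : ins m (p, t) - ins m (p, t0) = (ins m (p, t) - forig F) - (ins m (p, t0) - forig F).
      by rewrite opprB addrA subrK.
    by rewrite dotBr nt n0 subr0.
  rewrite ins_line dotZr dot_delta => /eqP; rewrite mulf_eq0 (negbTE nm) orbF subr_eq0.
  by move/eqP.
(* [g] stands for the indicator of the half-line on the inner side. It jumps at [t0] exactly as [h]
   does, so [h \- g] can only jump where [psi] vanishes nearby and contributes nothing; the integral
   against [g] is explicit. *)
have key (g : R -> R) : (forall t, t != t0 -> \forall s \near t, g s = g t) ->
    (forall s, g s = (n 0 m * (s - t0) < 0)%R%:R) ->
    mu.-integrable setT (EFin \o (g \* dpsi)) ->
    (\int[mu]_t (h t * dpsi t)%:E = \int[mu]_t (g t * dpsi t)%:E)%E.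
  move=> gc gE ig.
  have [t|ih ih0] := integral_jump_derive dpsiP cdpsi psi0 (h := h \- g).
    have [->|tt0] := eqVneq t t0.
      right; have /near_ins := half_space_near_fopen wK F0.
      have out s : (D (ins m (p, s)) <-> dot n (ins m (p, s) - ins m (p, t0)) < 0) ->
          (h \- g) s = 0.
        rewrite ins_line dotZr dot_delta mulrC => Ds /=; rewrite gE.
        have [/Ds Dx|/negP nx] := boolP (_ < 0); first by rewrite /h indicE mem_set// subrr.
        by rewrite /h indicE memNset ?subrr// => /Ds.
      move=> H; have := nbhs_singleton H => /out ->.
      by apply: filterS H => s /out.
    have : ~ (C (ins m (p, t)) /\ fopen F (ins m (p, t))).
      by move=> [_ /cross tE]; rewrite tE eqxx in tt0.
    move=> /near_indicator[/near_ins|/near_ins]; [by left|move=> H; right].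
    by apply: filterS2 H (gc _ tt0) => s hs gs /=; rewrite gs; congr (_ - _).
  transitivity (\int[mu]_t (((h \- g) t * dpsi t)%:E + (g t * dpsi t)%:E))%E.
    by apply: eq_integral => t _; rewrite -EFinD -mulrDl /= subrK.
  by rewrite integralD// ih0 add0e.
have lt_cst (t : R) : t != t0 -> \forall s \near t, ((s < t0) = (t < t0)) /\ ((t0 < s) = (t0 < t)).
  move=> tt0; have [tlt|tgt|/eqP] := ltgtP t t0; last by rewrite (negbTE tt0).
    by apply: filterS (lt_nbhsl tlt) => s st0; rewrite st0 ltNge (ltW st0).
  by apply: filterS (lt_nbhsr tgt) => s st0; rewrite st0 ltNge (ltW st0).
have [nm0|nm0|/eqP] := ltgtP (n 0 m) 0; last by rewrite (negbTE nm).
  have [ig iE] := integral_gt_derive dpsiP cdpsi psi0 t0.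
  rewrite (key (fun t => (t0 < t)%R%:R))//.
  - by rewrite iE ltr0_sg// mulN1r.
  - by move=> t /lt_cst; apply: filterS => s [_ ->].
  - by move=> s; rewrite nmulr_rlt0// subr_gt0.
have [ig iE] := integral_lt_derive dpsiP cdpsi psi0 t0.
rewrite (key (fun t => (t < t0)%R%:R))//.
- by rewrite iE gtr0_sg// mul1r.
- by move=> t /lt_cst; apply: filterS => s [-> _].
- by move=> s; rewrite pmulr_rlt0// subr_lt0.
Qed.

End Line.
Let phiF (y : 'rV[R]_2) : R := (phi \o fpar F) y * \1_(fset2 F) y.

(** The indicator in [phiF] accounts for lines whose foot point misses the face: they do not meet
    the open face at all, and their integral is 0. *)
Lemma line_integral m p : n 0 m != 0 ->
  (\int[mu]_t (\1_D (ins m (p, t)) * pd m phi (ins m (p, t)))%:E =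
   (Num.sg (n 0 m) * phiF (fcoord F (footpt F m p)))%:E)%E.
Proof.
move=> nm; have pl := footpt_plane p nm.
rewrite /phiF /= fcoordK// indicE.
have [Ff|Ff] := pselect (fset2 F (fcoord F (footpt F m p))).
  rewrite mem_set// mulr1; apply: (line_integral_cross nm); exact/(fopenP wF).
rewrite memNset// !mulr0 line_integral_off// => t [_ /[dup] Ft /(fopenP wF)[nt]].
suff -> : t = crossing F m p by [].
apply/eqP; rewrite -subr_eq0 -(mulIr_eq0 _ (mulIf nm)) -dot_delta -dotZr -(ins_line m p).
have -> : ins m (p, t) - ins m (p, crossing F m p) =
    (ins m (p, t) - forig F) - (footpt F m p - forig F) by rewrite opprB addrA subrK.
by rewrite dotBr nt pl subr0.
Qed.

Lemma integral_pd_lines m : (leb3 D < +oo)%E ->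
  (\int[@leb3 R]_(x in D) (pd m phi x)%:E =
   \int[mu \x mu]_p \int[mu]_t (\1_D (ins m (p, t)) * pd m phi (ins m (p, t)))%:E)%E.
Proof.
move=> Doo; have mD : measurable D := open_measurable_rV (open_phset wK).
have ipd : (@leb3 R).-integrable D (EFin \o pd m phi).
  apply: L2_integrable => //; apply: (testfun_L2 (D' := setT)) => //.
  by apply: testfun_pd; split => //; exists C; split.
have E : (EFin \o pd m phi) \_ D = EFin \o (\1_D \* pd m phi).
  apply/funext => x; rewrite patchE /= indicE.
  by case: (x \in D); rewrite ?mul1r ?mul0r.
rewrite integral_mkcond E (integral_leb3 m)//.
by rewrite -E; apply/integrable_restrict => //; rewrite setTI.
Qed.

End LocalDivergence.

Lemma leb2_bounded (R : realType) (D : set 'rV[R]_2) : measurable D -> bounded_set D ->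
  (leb2 D < +oo)%E.
Proof.
move=> mD [M [_ /(_ (`|M| + 1))]] DM.
have DB : D `<=` ball (0 : 'rV[R]_2) (`|M| + 2).
  move=> x /DM; rewrite -ball_normE /ball_/= sub0r normrN => H.
  apply: le_lt_trans (H _) _; last by rewrite ltrD2l ltr1n.
  by rewrite (le_lt_trans (ler_norm _))// ltrDl.
set e := `|M| + 2 in DB; pose B : set (measurableTypeR R) := ball (0 : R) e.
have mB : measurable B by rewrite /B ball_itv; exact: measurable_itv.
have muB : (lebesgue_measure B < +oo)%E.
  by rewrite /B ball_itv lebesgue_measure_itv/=; case: ifP => _; rewrite ?ltry// -EFinB ltry.
apply: (@le_lt_trans _ _ ((lebesgue_measure \x lebesgue_measure)%E (B `*` B))).
  apply: (@le_measure _ _ _ (lebesgue_measure \x lebesgue_measure)%E (@row2 R @^-1` D)); rewrite ?inE//.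
  - by rewrite -[X in measurable X]setTI; exact: measurable_row2.
  - exact: measurableX.
  - move=> [x y] /DB[_ H]; split.
      by have := H 0 0; rewrite !mxE.
    by have := H 0 1; rewrite !mxE.
by rewrite product_measure1E// lte_mul_pinfty// ge0_fin_numE.
Qed.

(* The constant is the m-th component of the outward normal of the face. *)
Lemma local_divergence (R : realType) (K : polyhedron R) (i : 'I_(phnf K)) (m : 'I_3) :
  wf_polyhedron K -> exists k : R, forall phi, loctest (phset K) (fopen (phface i)) phi ->
    \int[@leb3 R]_(x in phset K) pd m phi x =
    k * \int[@leb2 R]_(y in fset2 (phface i)) phi (fpar (phface i) y).
Proof.
move=> wK; set F := phface i; set D := phset K.
have mD : measurable D := open_measurable_rV (open_phset wK).
have Doo : (leb3 D < +oo)%E by apply: leb3_bounded => //; case: (wK) => [[]].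
have wF : wf_face F := wf_polyhedron_face wK i.
have mF : measurable (fset2 F) := open_measurable_rV (open_fset2 wF).
have Foo : (leb2 (fset2 F) < +oo)%E.
  by apply: leb2_bounded => //; case: (wF) => _ _ _ [[]].
have [nm|nm] := eqVneq (fnor F 0 m) 0.
  exists 0 => phi [sphi [C [cC CF phi0]]]; rewrite mul0r /Rintegral.
  rewrite (integral_pd_lines wK sphi cC phi0)// integral0_eq// => p _.
  exact: (line_integral_parallel wK sphi cC CF phi0).
have [a [b [c [e [u [v [det fE]]]]]]] := fcoord_footpt wF nm.
(* Replaces [p] by the planar coordinates of its foot point. The Jacobian is $\pm1/n_m$, so [k]
   amounts to $|n_m|$, and its product with the sign of $n_m$ is $n_m$. *)
have [k kP] := integral_affine2 u v det.
exists (Num.sg (fnor F 0 m) * k) => phi [sphi [C [cC CF phi0]]].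
pose g (y : 'rV[R]_2) := phi (fpar F y) * \1_(fset2 F) y.
have gE : EFin \o g = (EFin \o (phi \o fpar F)) \_ (fset2 F).
  apply/funext => y; rewrite patchE /g /= indicE.
  by case: (y \in fset2 F); rewrite ?mulr1 ?mulr0.
have ig : (@leb2 R).-integrable setT (EFin \o g).
  rewrite gE; apply/integrable_restrict => //; rewrite setTI.
  have [M phiM] := testfun_bounded (conj sphi (ex_intro _ C (And3 cC (@subsetT _ C) phi0))).
  apply: L2_integrable => //; apply: (L2_bounded mF (M := M)) => [//||y _]; last exact: phiM.
  apply: measurable_funTS; apply: continuous_measurable_rV => y.
  by apply: continuous_comp; [exact: continuous_fpar|exact: smooth_continuous].
have ig2 : (lebesgue_measure \x lebesgue_measure)%E.-integrable setT (EFin \o (g \o @row2 R)).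
  have mg := measurable_int _ ig; have mg2 := measurableT_comp mg (@measurable_row2 R).
  apply/integrableP; split => //.
  case/integrableP: ig => _; rewrite /leb2 ge0_integral_pushforward//.
  - exact: measurable_row2.
  - exact: measurableT_comp.
rewrite /Rintegral (integral_pd_lines wK sphi cC phi0)//.
transitivity (fine (\int[lebesgue_measure \x lebesgue_measure]_p
   ((Num.sg (fnor F 0 m))%:E * (EFin \o (g \o @row2 R)) (affine2 a b c e u v p)))%E).
  congr fine; apply: eq_integral => p _.
  by rewrite (line_integral wK sphi cC CF phi0)// fE.
transitivity (fine ((Num.sg (fnor F 0 m) * k)%:E * \int[@leb2 R]_y (EFin \o g) y)%E); last first.
  rewrite fineM//; last exact: integrable_fin_num ig.
  by rewrite gE -integral_mkcond.
congr fine.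
have iZ := integrableZl measurableT (Num.sg (fnor F 0 m)) ig2.
rewrite (kP _ iZ) integralZl// muleA -EFinM (mulrC k); congr (_ * _)%E.
rewrite /leb2 integral_pushforward ?preimage_setT//; first exact: measurable_row2.
exact: measurable_int ig.
Qed.

(** * The discrete spaces *)

Section ConstantProjection.
Context (R : realType) (n : nat) (m : {measure set 'rV[R]_n -> \bar R}).
Implicit Types (D : set 'rV[R]_n) (f : 'rV[R]_n -> R).

Lemma polyfun0_cst (c : R) : polyfun 0 (fun _ : 'rV[R]_n => c).
Proof.
exists (fun=> c) => x; rewrite (big_pred1 [ffun=> ord0]).
  by rewrite big1 ?mulr1// => i _; rewrite ffunE.
move=> a /=; rewrite [RHS](_ : _ = true); last by apply/eqP/ffunP => i; rewrite ffunE ord1.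
by rewrite big1// => i _; rewrite ord1.
Qed.

Lemma polyfun0P f : polyfun 0 f -> exists c, f = fun=> c.
Proof.
move=> [c fc]; exists (f 0); apply/funext => x; rewrite !fc.
by apply: eq_bigr => a _; congr (_ * _); apply: eq_bigr => i _; rewrite (ord1 (a i)).
Qed.

Definition mean D f : R := (\int[m]_(x in D) f x) / fine (m D).

Variable D : set 'rV[R]_n.
Hypotheses (mD : measurable D) (D0 : (0 < m D)%E) (Doo : (m D < +oo)%E).

Let fD0 : fine (m D) != 0.
Proof. by rewrite gt_eqF// fine_gt0// D0. Qed.

Lemma ip_cst f c : L2 m D f -> ip m D f (fun=> c) = c * \int[m]_(x in D) f x.
Proof.
move=> Lf; rewrite ipC /ip RintegralZl//; exact: L2_integrable.
Qed.

Lemma mean_lin a f g : L2 m D f -> L2 m D g ->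
  mean D (fun x => a * f x + g x) = a * mean D f + mean D g.
Proof.
move=> Lf Lg; rewrite /mean RintegralD//; last exact: L2_integrable.
  by rewrite RintegralZl ?mulrDl ?mulrA//; exact: L2_integrable.
by apply: L2_integrable => //; exact: L2Z.
Qed.

Lemma mean_cst c : mean D (fun=> c) = c.
Proof. by rewrite /mean Rintegral_cst// mulfK. Qed.

(** Polynomials of degree 0 are constants and the mean is the only admissible one. The chosen
    representative is thus known at every point, not just almost everywhere, and linearity of
    [Pi0 0] holds pointwise. *)
Lemma l2proj0E f : L2 m D f -> l2proj m 0 D f = fun=> mean D f.
Proof.
move=> Lf.
have proj c q : polyfun 0 q -> exists d, ip m D ((fun=> c) \- f) q = d * (c - mean D f).
  move=> /polyfun0P[d ->]; exists (d * fine (m D)).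
  rewrite ip_cst; last by apply: L2B => //; exact: L2_cst.
  rewrite RintegralB//; [|exact: L2_integrable (L2_cst _ _ _)|exact: L2_integrable].
  by rewrite Rintegral_cst// /mean; field.
have ex : exists p, is_l2proj m 0 D f p.
  exists (fun=> mean D f); split; first exact: polyfun0_cst.
  by move=> q /(proj (mean D f))[d ->]; rewrite subrr mulr0.
have : is_l2proj m 0 D f (l2proj m 0 D f) by apply: xgetPex.
move=> [/polyfun0P[c ->] /(_ _ (polyfun0_cst 1))].
rewrite ip_cst; last by apply: L2B => //; exact: L2_cst.
rewrite mul1r RintegralB//; [|exact: L2_integrable (L2_cst _ _ _)|exact: L2_integrable].
rewrite Rintegral_cst// => /eqP; rewrite subr_eq0 => /eqP E.
by rewrite /mean -E mulfK.
Qed.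

End ConstantProjection.

Section WholeSpace.
Context (R : realType).
Local Notation RB := (measurableTypeR R).
Local Notation mu := (@lebesgue_measure R).

(** A test function vanishes off [D], so the integral extends to whole lines in direction [m], where
    the jump lemma applies with the constant function 1 and gives 0. *)
Lemma integral_pd_testfun (D : set 'rV[R]_3) phi m : open D -> (leb3 D < +oo)%E ->
  testfun D phi -> \int[@leb3 R]_(x in D) pd m phi x = 0.
Proof.
move=> oD Doo tphi; have mD := open_measurable_rV oD.
have [sphi [C [cC _ phi0]]] := tphi.
have E : (EFin \o pd m phi) \_ D = EFin \o pd m phi.
  apply/funext => x; rewrite patchE; case: ifPn => //.
  by rewrite notin_setE /= => /(testfun_out (testfun_pd m tphi)) ->.
have ipd : (@leb3 R).-integrable D (EFin \o pd m phi).
  by apply: L2_integrable => //; exact: testfun_L2 (testfun_pd m tphi).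
rewrite /Rintegral integral_mkcond E (integral_leb3 m); last first.
  by rewrite -E; apply/integrable_restrict => //; rewrite setTI.
rewrite integral0_eq// => p _; have [M CM] := compact_ins_out cC.
have psi0 t : M < `|t| -> phi (ins m (p, t)) = 0 by move=> /(CM m p) /phi0.
have cd : continuous (fun t : R => pd m phi (ins m (p, t))).
  move=> t; apply: (@continuous_comp _ _ _ (fun s : R => ins m (p, s)) (pd m phi)).
    exact: continuous_ins.
  by apply: smooth_continuous; exact: smooth_pd.
have [t|_ <-] := integral_jump_derive (fun t => is_derive_ins m p t sphi) cd psi0 (h := cst 1).
  by right; apply/nbhs_ballP; exists 1 => //=.
by apply: eq_integral => t _ /=; rewrite mul1r.
Qed.

End WholeSpace.

Section LocalFaceSpace.
Context (R : realType).
Local Notation field := ('rV[R]_3 -> 'rV[R]_3).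
Variable K : polyhedron R.
Hypothesis wK : wf_polyhedron K.
Let D := phset K.
Let oD : open D := open_phset wK.

Lemma measurable_phset : measurable D.
Proof. exact: open_measurable_rV. Qed.
Let mD := measurable_phset.

Lemma phset_lty : (leb3 D < +oo)%E.
Proof. by apply: leb3_bounded => //; case: wK => [[]]. Qed.
Let Doo := phset_lty.

Lemma phset_gt0 : (0 < leb3 D)%E.
Proof. by apply: leb3_open_gt0 => //; case: wK => [[]]. Qed.
Let D0 := phset_gt0.

Lemma L2_coord j : L2 'mu3 D (fun x => x 0 j).
Proof.
have [M [_ /(_ (`|M| + 1))]] : bounded_set D by case: wK => [[]].
move=> DM; apply: (L2_bounded mD (M := `|M| + 2)) => //.
  by apply: measurable_funTS; exact: measurable_coord.
move=> x Dx; have : ball (0 : 'rV[R]_3) (`|M| + 2) x.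
  rewrite -ball_normE /ball_/= sub0r normrN.
  apply: le_lt_trans (DM _ _ Dx) _; last by rewrite ltrD2l ltr1n.
  by rewrite (le_lt_trans (ler_norm _))// ltrDl.
by move=> [_ /(_ 0 j)]; rewrite /ball/= mxE sub0r normrN => /ltW.
Qed.

Let b := barycenter 'mu3 D.

Let cross_lin (q : 'rV[R]_3) (j : 'I_3) : exists c : 'rV[R]_3,
  forall x, cross (x - b) q 0 j = dot c (x - b).
Proof.
exists (nth 0 [:: vec3 0 (q 0 2) (- q 0 1); vec3 (- q 0 2) 0 (q 0 0); vec3 (q 0 1) (- q 0 0) 0] j).
by move=> x; case: (ord3P j) => ->; rewrite dot3E !mxE /=; ring.
Qed.

Let L2_coordB (c : 'rV[R]_3) : L2 'mu3 D (fun x => dot c (x - b)).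
Proof.
apply: L2_sum => // j; apply: L2Z => //; under eq_fun do rewrite !mxE.
by apply: L2B => //; [exact: L2_coord|exact: L2_cst].
Qed.

Lemma L2v_cross_barycenter (q : 'rV[R]_3) : L2v 'mu3 D (fun x => cross (x - b) q).
Proof.
move=> j; have [c cE] := cross_lin q j; rewrite (_ : cmp _ j = fun x => dot c (x - b)) //.
by apply/funext => x; exact: cE.
Qed.

Lemma L2v_cst (w : 'rV[R]_3) : L2v 'mu3 D (fun=> w).
Proof. by move=> j; exact: L2_cst. Qed.

(** Each component of the cross product is a linear form in [x - b], of mean zero because [b] is the
    barycenter. This is the moment condition of the face space for constants. *)
Lemma ip_cross_barycenter (w q : 'rV[R]_3) : ipv 'mu3 D (fun=> w) (fun x => cross (x - b) q) = 0.
Proof.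
rewrite ipv_ipE//; [|exact: L2v_cst|exact: L2v_cross_barycenter].
apply: big1 => j _; have [c cE] := cross_lin q j.
have -> : cmp (fun x => cross (x - b) q) j = fun x => dot c (x - b) by apply/funext => x; exact: cE.
rewrite ipC ip_cst//.
have -> : (fun x : 'rV[R]_3 => dot c (x - b)) = fun x => \sum_i c 0 i * (x 0 i - b 0 i).
  by apply/funext => x; apply: eq_bigr => i _; rewrite !mxE.
have int0 i : \int['mu3]_(x in D) (x 0 i - b 0 i) = 0.
  rewrite RintegralB//; [|by apply: L2_integrable => //; exact: L2_coord|by apply: L2_integrable => //; exact: L2_cst].
  rewrite Rintegral_cst// /b mxE Rintegral_cst// mul1r.
  by rewrite divfK ?subrr// gt_eqF// fine_gt0// D0.
have sumE (r : seq 'I_3) : \int['mu3]_(x in D) \sum_(i <- r) c 0 i * (x 0 i - b 0 i) = 0.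
  elim: r => [|i r IH].
    by under eq_Rintegral do rewrite big_nil; rewrite Rintegral_cst// mul0r.
  have Li k : L2 'mu3 D (fun x => c 0 k * (x 0 k - b 0 k)).
    by apply: L2Z => //; apply: L2B => //; [exact: L2_coord|exact: L2_cst].
  under eq_Rintegral do rewrite big_cons; rewrite RintegralD//.
  - rewrite IH addr0 RintegralZl//; first by rewrite int0 mulr0.
    by apply: L2_integrable => //; apply: L2B => //; [exact: L2_coord|exact: L2_cst].
  - exact: L2_integrable.
  - by apply: L2_integrable => //; exact: L2_sum.
by rewrite sumE mulr0.
Qed.

End LocalFaceSpace.

(** * Closure properties of the local face space *)

Section FaceSpaceClosure.
Context (R : realType).
Local Notation field := ('rV[R]_3 -> 'rV[R]_3).
Variable K : polyhedron R.
Hypothesis wK : wf_polyhedron K.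
Let D := phset K.
Let oD : open D := open_phset wK.
Let mD := measurable_phset wK.
Let Doo := phset_lty wK.
Implicit Types u v B : field.

Let mF j : measurable (fset2 (@phface _ K j)).
Proof. apply: open_measurable_rV; exact: open_fset2 (wf_polyhedron_face wK j). Qed.

Let Foo j : (leb2 (fset2 (@phface _ K j)) < +oo)%E.
Proof. by apply: leb2_bounded => //; case: (wf_polyhedron_face wK j) => _ _ _ [[]]. Qed.

Lemma L2_loctest G phi : loctest D G phi -> L2 'mu3 D phi.
Proof. by move=> /loctest_testfunT; exact: testfun_L2. Qed.

Lemma L2v_loctest G (phi : field) : testvec (loctest D G) phi -> L2v 'mu3 D phi.
Proof. by move=> t i; exact: L2_loctest (t i). Qed.

Lemma testvec_loctest_grad G phi : loctest D G phi -> testvec (loctest D G) (grad phi).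
Proof. by move=> t i; rewrite cmp_grad; exact: loctest_pd. Qed.

Lemma L2_loctest_fpar j phi : loctest D (fopen (phface j)) phi ->
  L2 'mu2 (fset2 (@phface _ K j)) (phi \o fpar (phface j)).
Proof.
move=> /loctest_testfunT tphi; have [M phiM] := testfun_bounded tphi.
apply: (L2_bounded (mF j) (M := M) (Foo j)) => [|y _]; last exact: phiM.
apply: measurable_funTS; apply: continuous_measurable_rV => y.
apply: continuous_comp; first exact: continuous_fpar.
by apply: smooth_continuous; exact: testfun_smooth tphi.
Qed.

(** Trades the chosen [wdiv] for any weak divergence at hand, the two being equal almost
    everywhere. *)
Lemma is_ntraceE (j : 'I_(phnf K)) B d g : is_wdiv 'mu3 D B d -> is_ntrace K (phface j) B g <->
  L2 'mu2 (fset2 (phface j)) g /\ forall phi, loctest D (fopen (phface j)) phi ->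
    ipv 'mu3 D B (grad phi) + ip 'mu3 D d phi
    = ip 'mu2 (fset2 (phface j)) g (phi \o fpar (phface j)).
Proof.
move=> Bd; have E phi : ip 'mu3 D (wdiv 'mu3 D B) phi = ip 'mu3 D d phi.
  by apply: ip_aeeq; apply: (wdiv_unique oD Doo _ Bd); apply: wdivP; exists d.
by split=> -[Lg H]; split => // phi /H; rewrite E.
Qed.

Lemma VfaceK_cst (w : 'rV[R]_3) : VfaceK K (fun=> w).
Proof.
have div0 : is_wdiv 'mu3 D (fun=> w) (fun=> 0).
  split; first exact: L2_cst.
  move=> phi tphi; rewrite ip0l// oppr0 ipv_ipE//; first last.
  - exact: testvec_L2v (testvec_grad tphi).
  - exact: L2v_cst.
  apply: big1 => i _; rewrite cmp_grad ipC ip_cst//; last exact: testfun_L2 (testfun_pd i tphi).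
  by rewrite integral_pd_testfun// mulr0.
split; first exact: L2v_cst.
(* One constant for each axis; weighted by the components of [w] they add up to the normal trace. *)
- move=> j; have ex m := local_divergence j m wK.
  have [k kP] := choice ex.
  exists (fun=> \sum_i w 0 i * k i); split; first exact: polyfun0_cst.
  apply/(is_ntraceE _ _ div0);
    split; first exact: (L2_cst (mF j) _ (Foo j)).
  move=> phi lphi; rewrite ip0l// addr0 ipv_ipE//; first last.
  - exact: L2v_loctest (testvec_loctest_grad lphi).
  - exact: L2v_cst.
  rewrite ipC (ip_cst (mF j) (Foo j) _ (L2_loctest_fpar lphi)).
  rewrite mulr_suml; apply: eq_bigr => i _; rewrite cmp_grad ipC ip_cst//.
    by rewrite kP// mulrA.
  exact: L2_loctest (loctest_pd i lphi).
- by exists (fun=> 0); split => //; exact: polyfun0_cst.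
- exists (fun=> 0); split; first by move=> i; rewrite (_ : cmp _ i = fun=> 0);
    [exact: polyfun0_cst|apply/funext => x; rewrite /cmp mxE].
  split; first exact: L2v_cst.
  move=> phi tphi; rewrite [RHS]ipvC ipv0r ipv_ipE//; first last.
  - exact: L2v_curl tphi.
  - exact: L2v_cst.
  apply: big1 => i _; rewrite ipC.
  have tL k l : L2 'mu3 D (pd k (cmp phi l)) by exact: testfun_L2 (testfun_pd k (tphi l)).
  (* Each component of [curl phi] is a difference of two partial derivatives of test functions,
     hence has integral 0. *)
  have [k [l [k' [l' E]]]] : exists k l k' l',
      cmp (curl phi) i = pd k (cmp phi l) \- pd k' (cmp phi l').
    by case: (ord3P i) => ->; do 4![eexists]; apply/funext => x; rewrite /cmp !mxE /=.
  rewrite E (ip_cst mD Doo _ (L2B mD (tL k l) (tL k' l'))).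
  rewrite RintegralB//; [|exact: L2_integrable|exact: L2_integrable].
  by rewrite !(integral_pd_testfun _ oD Doo (tphi _)) subrr mulr0.
- by move=> q; exact: ip_cross_barycenter.
Qed.

Lemma VfaceK_lin (a : R) u v : VfaceK K u -> VfaceK K v -> VfaceK K (fun x => a *: u x + v x).
Proof.
move=> [Lu tu [du [pdu udu]] [Cu [pCu uCu]] bu] [Lv tv [dv [pdv vdv]] [Cv [pCv vCv]] bv].
have plin (f g : 'rV[R]_3 -> R) : polyfun 0 f -> polyfun 0 g -> polyfun 0 (fun x => a * f x + g x).
  by move=> /polyfun0P[c ->] /polyfun0P[c' ->]; exact: polyfun0_cst.
have Luv : L2v 'mu3 D (fun x => a *: u x + v x) by apply: L2vD => //; exact: L2vZ.
have ipvl w : L2v 'mu3 D w ->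
    ipv 'mu3 D (fun x => a *: u x + v x) w = a * ipv 'mu3 D u w + ipv 'mu3 D v w.
  by move=> Lw; rewrite ipvDl ?ipvZl//; exact: L2vZ.
have divl := is_wdiv_lin oD Doo a Lu Lv udu vdv.
split; first exact: Luv.
- move=> j; have [cu [/polyfun0P[c ->] /(is_ntraceE _ _ udu)[_ cuP]]] := tu j.
  have [cv [/polyfun0P[c' ->] /(is_ntraceE _ _ vdv)[_ cvP]]] := tv j.
  exists (fun=> a * c + c'); split; first exact: polyfun0_cst.
  apply/(is_ntraceE _ _ divl);
    split; first exact: (L2_cst (mF j) _ (Foo j)).
  move=> phi lphi; have Lphi := L2_loctest lphi; have LF := L2_loctest_fpar lphi.
  rewrite ipvl; last exact: L2v_loctest (testvec_loctest_grad lphi).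
  have [Ldu _] := udu; have [Ldv _] := vdv.
  rewrite ipDl//; last exact: L2Z.
  have cE d : ip 'mu2 (fset2 (phface j)) (fun=> d) (phi \o fpar (phface j)) =
      d * \int['mu2]_(x in fset2 (phface j)) (phi \o fpar (phface j)) x.
    by rewrite ipC (ip_cst (mF j) (Foo j) d LF).
  have {}cuP := cuP _ lphi; have {}cvP := cvP _ lphi.
  rewrite ipZl// addrACA -mulrDr [X in a * X]cuP [X in _ + X]cvP !cE.
  by rewrite mulrDl mulrA.
- by exists (fun x => a * du x + dv x); split => //; exact: plin.
- exists (fun x => a *: Cu x + Cv x); split; last exact: is_wcurl_lin.
  move=> i; rewrite (_ : cmp _ i = fun x => a * cmp Cu i x + cmp Cv i x); first exact: plin.
  by apply/funext => x; rewrite /cmp !mxE.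
- by move=> q; rewrite ipvl ?bu ?bv ?mulr0 ?addr0//; exact: L2v_cross_barycenter.
Qed.

(** Serves to pass from [wcurl] over an element to [wcurl] over [Om], two representatives that need
    not agree pointwise. Square integrability of [v] is a separate hypothesis because it includes
    measurability, which a change on a null set may destroy. *)
Lemma VfaceK_aeeq u v : aeeq 'mu3 D u v -> L2v 'mu3 D v -> VfaceK K u -> VfaceK K v.
Proof.
move=> uv Lv [Lu tu [d [pd' ud]] [C [pC uC]] bu].
have vd := is_wdiv_aeeq uv ud.
split; first exact: Lv.
- move=> j; have [c [pc /(is_ntraceE _ _ ud)[Lc cP]]] := tu j.
  exists c; split => //; apply/(is_ntraceE _ _ vd); split => // phi /cP <-.
  by rewrite (ipv_aeeq _ uv).
- by exists d.
- by exists C; split => //; exact: is_wcurl_aeeq uC.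
- by move=> q; rewrite -(ipv_aeeq _ uv).
Qed.

End FaceSpaceClosure.

(** * The curl of a local edge field is a local face field *)

Section CurlOfEdge.
Context (R : realType).
Local Notation field := ('rV[R]_3 -> 'rV[R]_3).

Section Face.
Variable K : polyhedron R.
Hypothesis wK : wf_polyhedron K.
Variable j : 'I_(phnf K).
Let D := phset K.
Let F := phface j.
Let wF : wf_face F := wf_polyhedron_face wK j.

(** The support of [phi] meets the closed face in a compact subset of the open face, so cutting off
    outside the open face keeps the trace smooth. *)
Lemma testfun_trace phi : loctest D (fopen F) phi ->
  testfun (fset2 F) ((phi \o fpar F) \_ (fset2 F)).
Proof.
move=> [sphi [C [cC CF phi0]]].
have clC : closed C by apply: compact_closed => //; exact: norm_hausdorff.
pose C' := fpar F @^-1` C `&` closure (fset2 F).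
have cC' : closed C'.
  apply: closedI; last exact: closed_closure.
  by apply: closed_comp => // y _; exact: continuous_fpar.
have C'F : C' `<=` fset2 F.
  move=> y [Cy cy]; have : fopen F (fpar F y).
    by apply: CF; split => //; apply: (fclosed_bdry wK (i := j)); exists y.
  by move=> /(fopenP wF)[_]; rewrite (fparK wF).
have sF : smooth (phi \o fpar F).
  rewrite (_ : phi \o fpar F = fun y => phi (forig F + y *m fmx F)); first exact: smooth_affine.
  by apply/funext => y; rewrite /= fparE.
split.
  apply: (smooth_patch (open_fset2 wF) cC' C'F sF) => y Fy nC'.
  by apply: phi0 => Cy; apply: nC'; split => //; exact: subset_closure.
exists C'; split => //.
  apply: bounded_closed_compact => //; case: (wF) => _ _ _ [[_ _ bF _] _ _ _ _].
  case: bF => M [Mr HM]; exists M; split => // x Mx y /C'F; exact: HM.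
move=> y nC'; rewrite patchE; case: ifPn => //; rewrite inE => Fy.
by apply: phi0 => Cy; apply: nC'; split => //; exact: subset_closure.
Qed.

Lemma pd_fpar phi k y : smooth phi ->
  pd k (phi \o fpar F) y = dot (row k (fmx F)) (grad phi (fpar F y)).
Proof.
move=> sphi; rewrite (_ : phi \o fpar F = fun y => phi (forig F + y *m fmx F)); last first.
  by apply/funext => z; rewrite /= fparE.
rewrite pd_affine; last by move=> x; exact: smooth_differentiable.
by apply: eq_bigr => l _; rewrite fparE !mxE.
Qed.

(* Surface curls are normal traces of curls: n . curl E = rot (E_tau). *)
Lemma is_ntrace_wcurl E G c : (exists w, is_wcurl D E w) ->
  is_ttrace K F E G -> is_wrot (fset2 F) G c -> is_ntrace K F (wcurl D E) c.
Proof.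
move=> exw [LG tG] [Lc Gc].
have oD : open D := open_phset wK; have mD := measurable_phset wK; have Doo := phset_lty wK.
have d0 : is_wdiv 'mu3 D (wcurl D E) (fun=> 0) by apply: (wcurl_div0 mD Doo (wcurlP exw)).
apply/(is_ntraceE wK _ _ d0); split => // phi lphi.
have sphi : smooth phi by case: lphi.
rewrite ip0l// addr0.
have := tG _ (testvec_loctest_grad lphi); rewrite curl_grad// ipv0r subr0 => ->.
have tpsi := testfun_trace lphi; set psi := _ \_ _ in tpsi.
have psiE y : fset2 F y -> psi y = phi (fpar F y) by move=> Fy; rewrite /psi patchE mem_set.
transitivity (ip 'mu2 (fset2 F) c psi); last first.
  by apply: ip_eq => y //; rewrite inE => /psiE.
rewrite -(Gc _ tpsi); apply: eq_Rintegral => y; rewrite inE => Fy.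
have pE k : pd k psi y = dot (row k (fmx F)) (grad phi (fpar F y)).
  rewrite -pd_fpar//; apply: near_eq_pd.
  have := open_nbhs_nbhs (conj (open_fset2 wF) Fy).
  by apply: filterS => z /psiE.
have r0 : row 0 (fmx F) = ftan0 F by apply/rowP => l; rewrite !mxE.
have r1 : row 1 (fmx F) = ftan1 F by apply/rowP => l; rewrite !mxE.
(* The rotated trace paired with the gradient is $G_0\partial_1\psi-G_1\partial_0\psi$, that is, [G]
   against [vrot psi]. *)
rewrite [RHS]dot2E /vrot !mxE /= !pE r0 r1.
by rewrite dotC dotBr !dotZr !(dotC (grad _ _)) mulrN.
Qed.

End Face.

Lemma VfaceK_wcurl (K : polyhedron R) E : wf_polyhedron K -> VedgeK K E -> VfaceK K (wcurl (phset K) E).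
Proof.
move=> wK [LE [G [GP _]] [J [C [EJ JC pC]]] _ bE].
have oD : open (phset K) := open_phset wK.
have mD := measurable_phset wK; have Doo := phset_lty wK.
have exw : exists w, is_wcurl (phset K) E w by exists J.
have wE := wcurlP exw.
split.
- by case: wE.
- move=> j; have [tG [_ _ [c [pc Gc]] _ _]] := GP j.
  by exists c; split => //; exact: is_ntrace_wcurl tG Gc.
- exists (fun=> 0); split; first exact: polyfun0_cst.
  exact: wcurl_div0 wE.
(* [J] and the chosen curl agree almost everywhere, so [C] is also a curl of the latter. *)
- exists C; split => //; apply: is_wcurl_aeeq JC.
  exact: wcurl_unique EJ wE.
- exact: bE.
Qed.

End CurlOfEdge.

(** * From elements to the whole domain *)

Section Global.
Context (R : realType) (Om : set 'rV[R]_3) (M : mesh R).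
Local Notation field := ('rV[R]_3 -> 'rV[R]_3).
Hypotheses (HOm : lipschitz_polyhedral_domain Om) (HM : mesh_of Om M).

Let wOm : exists K, wf_polyhedron K /\ phset K = Om.
Proof. by case: HOm. Qed.

Lemma open_Om : open Om.
Proof. by have [K [wK <-]] := wOm; exact: open_phset. Qed.

Lemma measurable_Om : measurable Om.
Proof. exact: open_measurable_rV open_Om. Qed.

Lemma Om_lty : (leb3 Om < +oo)%E.
Proof. by have [K [wK <-]] := wOm; exact: phset_lty. Qed.

Lemma wf_mesh k : wf_polyhedron (@mshel _ M k).
Proof. by case: HM => /(_ k)[]. Qed.

Lemma mshel_sub k : phset (@mshel _ M k) `<=` Om.
Proof. by case: HM => /(_ k)[]. Qed.

(* The skeleton of the mesh lies in finitely many planes. *)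
Lemma ae_mesh (P : 'rV[R]_3 -> Prop) :
  (forall k, {ae 'mu3, forall x, phset (@mshel _ M k) x -> P x}) ->
  {ae 'mu3, forall x, Om x -> P x}.
Proof.
move=> Hk.
have pl k (i : 'I_(phnf (@mshel _ M k))) : {ae 'mu3, forall x, ~ Defs.fclosed (phface i) x}.
  have wF := wf_polyhedron_face (wf_mesh k) i.
  exists [set x | dot (fnor (phface i)) x = dot (fnor (phface i)) (forig (phface i))]; split.
  - rewrite (_ : [set x | _] = dot (fnor (phface i)) @^-1` [set dot (fnor (phface i)) (forig (phface i))])//.
    apply: closed_measurable_rV; apply: closed_comp => [x _|]; last exact: closed_eq.
    exact: continuous_dot.
  - by apply: leb3_plane; exact: fnor_neq0.
  - move=> x /= /contrapT /(fclosedP wF)[/eqP]; rewrite dotBr subr_eq0 => /eqP -> _.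
    by [].
have {}pl : {ae 'mu3, forall x, forall k (i : 'I_(phnf (@mshel _ M k))), ~ Defs.fclosed (phface i) x}.
  by apply: ae_countable => k; apply: ae_countable => i; exact: pl.
have {}Hk : {ae 'mu3, forall x, forall k, phset (@mshel _ M k) x -> P x}.
  exact: ae_countable.
apply: filterS2 pl Hk => x nF Hx Ox.
case: HM => _ _ cE _; have : closure Om x by exact: subset_closure.
rewrite cE => -[k _ ck]; have [Kx|nKx] := pselect (phset (mshel k) x); first exact: Hx Kx.
have : bdry (phset (@mshel _ M k)) x by split => // /interior_subset.
by have [_ [_ ->] _ _ _] := wf_mesh k; move=> [i _ /nF].
Qed.

Lemma H0div_lin (a : R) (u v : field) : H0div 'mu3 Om u -> H0div 'mu3 Om v ->
  H0div 'mu3 Om (fun x => a *: u x + v x).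
Proof.
have oD := open_Om; have mD := measurable_Om; have Doo := Om_lty.
move=> [Lu exu tu] [Lv exv tv]; have Wu := wdivP exu; have Wv := wdivP exv.
have Wuv := is_wdiv_lin oD Doo a Lu Lv Wu Wv.
split; [by apply: L2vD => //; exact: L2vZ|by eexists; exact: Wuv|].
move=> phi tphi; have Lphi := testfun_L2 mD Doo tphi.
have Lgrad : L2v 'mu3 Om (grad phi) by exact: testvec_L2v (testvec_grad tphi).
have E : aeeq 'mu3 Om (wdiv 'mu3 Om (fun x => a *: u x + v x))
    (fun x => a * wdiv 'mu3 Om u x + wdiv 'mu3 Om v x).
  by apply: (wdiv_unique oD Doo _ Wuv); apply: wdivP; eexists; exact: Wuv.
rewrite (ip_aeeq _ E); have [Ldu _] := Wu; have [Ldv _] := Wv.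
rewrite (ipvDl mD (L2vZ a mD Lu) Lv Lgrad) (ipvZl a mD Lu Lgrad).
rewrite (ipDl mD (L2Z mD a Ldu) Ldv Lphi) (ipZl mD a Ldu Lphi).
by rewrite addrACA -mulrDr tu// tv// mulr0 addr0.
Qed.

Lemma wcurl_local (k : 'I_(mshn M)) E : H0curl Om E -> VedgeK (mshel k) E ->
  aeeq 'mu3 (phset (mshel k)) (wcurl (phset (mshel k)) E) (wcurl Om E).
Proof.
move=> [_ exw _] [_ _ [J [_ [EJ _ _]]] _ _].
have wK := wf_mesh k.
apply: (wcurl_unique (open_phset wK) (phset_lty wK)); first by apply: wcurlP; exists J.
apply: (is_wcurl_sub (measurable_phset wK) measurable_Om (@mshel_sub k)).
exact: wcurlP.
Qed.

Lemma Vface_wcurl E : Vedge Om M E -> Vface Om M (wcurl Om E).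
Proof.
move=> [HE KE]; split; first by apply: H0div_wcurl => //; [exact: open_Om|exact: Om_lty].
move=> k; have wK := wf_mesh k.
apply: (VfaceK_aeeq wK (wcurl_local HE (KE k))); last exact: VfaceK_wcurl.
case: HE => _ exw _; have [Lw _] := wcurlP exw.
exact: (L2v_sub (measurable_phset wK) measurable_Om (@mshel_sub k)).
Qed.

Lemma Vface_lin (a : R) u v : Vface Om M u -> Vface Om M v ->
  Vface Om M (fun x => a *: u x + v x).
Proof.
move=> [Hu Ku] [Hv Kv]; split; first exact: (H0div_lin a Hu Hv).
by move=> k; exact: (VfaceK_lin (wf_mesh k) a (Ku k) (Kv k)).
Qed.

End Global.

(** * The face product is definite *)

Section Definiteness.
Context (R : realType).
Local Notation field := ('rV[R]_3 -> 'rV[R]_3).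

Section Element.
Variable K : polyhedron R.
Hypothesis wK : wf_polyhedron K.
Let D := phset K.
Let mD := measurable_phset wK.
Let Doo := phset_lty wK.
Let D0 := phset_gt0 wK.

Lemma Pi0E (v : field) : L2v 'mu3 D v ->
  Pi0 0 K v = fun=> \row_i mean 'mu3 D (cmp v i).
Proof.
move=> Lv; apply/funext => x; apply/rowP => i; rewrite !mxE.
by rewrite (l2proj0E mD D0 Doo (Lv i)).
Qed.

Lemma Pi0_lin (a : R) (u v : field) : L2v 'mu3 D u -> L2v 'mu3 D v ->
  Pi0 0 K (fun x => a *: u x + v x) = fun x => a *: Pi0 0 K u x + Pi0 0 K v x.
Proof.
move=> Lu Lv; have Luv : L2v 'mu3 D (fun x => a *: u x + v x).
  by apply: (L2vD mD _ Lv); exact: L2vZ.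
rewrite !Pi0E//; apply/funext => x; apply/rowP => i; rewrite !mxE.
rewrite -(mean_lin mD Doo a (Lu i) (Lv i)); congr mean.
by apply/funext => y; rewrite /cmp !mxE.
Qed.

Lemma Pi0_cst (w : 'rV[R]_3) : Pi0 0 K (fun=> w) = fun=> w.
Proof.
rewrite Pi0E; last exact: (L2v_cst wK).
apply/funext => x; apply/rowP => i; rewrite !mxE.
exact: (mean_cst mD D0 Doo).
Qed.

Lemma L2v_Pi0 (v : field) : L2v 'mu3 D v -> L2v 'mu3 D (Pi0 0 K v).
Proof. by move=> Lv; rewrite Pi0E//; exact: (L2v_cst wK). Qed.

Let subE (v : field) : v \- Pi0 0 K v = fun x => (-1) *: Pi0 0 K v x + v x.
Proof. by apply/funext => x /=; rewrite scaleN1r addrC. Qed.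

Lemma Pi0_sub (v : field) x : L2v 'mu3 D v -> Pi0 0 K (v \- Pi0 0 K v) x = 0.
Proof.
move=> Lv; rewrite subE Pi0_lin//; last exact: L2v_Pi0.
by rewrite {1}(Pi0E Lv) Pi0_cst scaleN1r (Pi0E Lv) addNr.
Qed.

Lemma VfaceK_sub_Pi0 v : VfaceK K v -> VfaceK K (v \- Pi0 0 K v).
Proof.
move=> Vv; have Lv : L2v 'mu3 D v by case: Vv.
rewrite subE; apply: (VfaceK_lin wK (-1) _ Vv).
by rewrite (Pi0E Lv); exact: VfaceK_cst.
Qed.

Variables (St : field -> field -> R) (lo : R).
Hypotheses (lo0 : 0 < lo) (bSt : symmetric_bilinear_on (VfaceK K) St).
Hypothesis cSt : forall v, VfaceK K v -> (forall x, Pi0 0 K v x = 0) -> lo * sqn0 K v <= St v v.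

Definition vemprodK (u v : field) : R :=
  ipv 'mu3 D (Pi0 0 K u) (Pi0 0 K v) + St (u \- Pi0 0 K u) (v \- Pi0 0 K v).

Lemma vemprodK_lin (a : R) u v w : VfaceK K u -> VfaceK K v -> VfaceK K w ->
  vemprodK (fun x => a *: u x + v x) w = a * vemprodK u w + vemprodK v w.
Proof.
move=> Vu Vv Vw; have Lu : L2v 'mu3 D u by case: Vu.
have Lv : L2v 'mu3 D v by case: Vv.
have Lw : L2v 'mu3 D w by case: Vw.
have [_ bl] := bSt.
rewrite /vemprodK Pi0_lin//.
rewrite (ipvDl mD (L2vZ a mD (L2v_Pi0 Lu)) (L2v_Pi0 Lv) (L2v_Pi0 Lw)).
rewrite (ipvZl a mD (L2v_Pi0 Lu) (L2v_Pi0 Lw)).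
have -> : (fun x => a *: u x + v x) \- (fun x => a *: Pi0 0 K u x + Pi0 0 K v x) =
    fun x => a *: (u \- Pi0 0 K u) x + (v \- Pi0 0 K v) x.
  by apply/funext => x /=; rewrite scalerBr opprD addrACA.
rewrite (bl a _ _ _ (VfaceK_sub_Pi0 Vu) (VfaceK_sub_Pi0 Vv) (VfaceK_sub_Pi0 Vw)).
have alg (p q r s : R) : a * p + q + (a * r + s) = a * (p + r) + (q + s) by ring.
exact: alg.
Qed.

Lemma vemprodK_ge0 v : VfaceK K v -> 0 <= vemprodK v v.
Proof.
move=> Vv; have Lv : L2v 'mu3 D v by case: Vv.
rewrite addr_ge0 ?ipv_ge0//; apply: le_trans (cSt (VfaceK_sub_Pi0 Vv) _); last first.
  by move=> x; exact: Pi0_sub.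
by rewrite mulr_ge0 ?(ltW lo0)// /sqn0 sqr_ge0.
Qed.

(** Both terms are nonnegative, so both vanish: the first kills the projection of [v], the second,
    by coercivity on the kernel of the projection, kills the remainder. *)
Lemma vemprodK_eq0 v : VfaceK K v -> vemprodK v v = 0 -> aeeq 'mu3 D v (fun=> 0).
Proof.
move=> Vv; have Lv : L2v 'mu3 D v by case: Vv.
have Vw := VfaceK_sub_Pi0 Vv; set w := v \- _ in Vw.
have Lw : L2v 'mu3 D w by case: Vw.
have Sw := cSt Vw (fun x => Pi0_sub x Lv).
rewrite /vemprodK -/w => v0.
have w0 : ipv 'mu3 D w w = 0.
  apply/eqP; rewrite eq_le ipv_ge0 andbT -(pmulr_rle0 _ lo0).
  have -> : ipv 'mu3 D w w = sqn0 K w by rewrite /sqn0 /nrmv sqr_sqrtr ?ipv_ge0.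
  apply: (le_trans Sw); rewrite -v0 lerDr; exact: ipv_ge0.
have p0 : ipv 'mu3 D (Pi0 0 K v) (Pi0 0 K v) = 0.
  apply/eqP; rewrite eq_le ipv_ge0 andbT -v0 lerDl.
  by apply: le_trans Sw; rewrite mulr_ge0 ?(ltW lo0)// /sqn0 sqr_ge0.
have := ipv_eq0 mD Lw w0; have := ipv_eq0 mD (L2v_Pi0 Lv) p0.
apply: filterS2 => x P0 W0 Dx; have := W0 Dx.
by rewrite /w /= (P0 Dx) subr0.
Qed.

End Element.

(** The factor 1 in [w] gives the sum the shape in which bilinearity of the stabilization is stated.
    The two products collapse to the square of [w], a sum of nonnegative contributions of the
    elements. *)
Lemma vemprod_face_eq0 (Om : set 'rV[R]_3) (M : mesh R) St u v :
  mesh_of Om M ->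
  (exists lo hi : R, [/\ 0 < lo, 0 < hi & forall k : 'I_(mshn M), let K := mshel k in
      symmetric_bilinear_on (VfaceK K) (St k) /\
      forall v, VfaceK K v -> (forall x, Pi0 0 K v x = 0) ->
        lo * sqn0 K v <= St k v v <= hi * sqn0 K v]) ->
  (forall k : 'I_(mshn M), VfaceK (mshel k) u) -> (forall k : 'I_(mshn M), VfaceK (mshel k) v) ->
  let w x := 1 *: u x + v x in
  vemprod St (fun=> u) (fun=> w) + vemprod St (fun=> v) (fun=> w) = 0 ->
  aeeq 'mu3 Om w (fun=> 0).
Proof.
move=> HM [lo [hi [lo0 _ HS]]] Vu Vv w.
have Vw k : VfaceK (mshel k) w := VfaceK_lin (wf_mesh HM k) 1 (Vu k) (Vv k).
have cS k v0 : VfaceK (mshel k) v0 -> (forall x, Pi0 0 (mshel k) v0 x = 0) ->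
    lo * sqn0 (mshel k) v0 <= St k v0 v0.
  by move=> V0 p0; have [_ /(_ _ V0 p0)/andP[]] := HS k.
rewrite /vemprod -big_split /=.
have E k : ipv 'mu3 (phset (mshel k)) (Pi0 0 (mshel k) u) (Pi0 0 (mshel k) w) +
   St k (u \- Pi0 0 (mshel k) u) (w \- Pi0 0 (mshel k) w) +
   (ipv 'mu3 (phset (mshel k)) (Pi0 0 (mshel k) v) (Pi0 0 (mshel k) w) +
   St k (v \- Pi0 0 (mshel k) v) (w \- Pi0 0 (mshel k) w)) = vemprodK (mshel k) (St k) w w.
  have [bS _] := HS k.
  by rewrite {5}/w (vemprodK_lin (wf_mesh HM k) bS 1 (Vu k) (Vv k) (Vw k)) mul1r.
under eq_bigr do rewrite E.
move=> /eqP; rewrite psumr_eq0 => [/allP H|k _]; last first.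
  exact: (vemprodK_ge0 (wf_mesh HM k) lo0 (cS k)).
apply: (ae_mesh HM) => k.
apply: (vemprodK_eq0 (wf_mesh HM k) lo0 (cS k) (Vw k)).
by apply/eqP; exact: H (mem_index_enum k).
Qed.

End Definiteness.

(** * Divergence of the velocity and of the magnetic field *)

Lemma le_cvg0 (R : realType) (T : topologicalType) (F : set_system T) (FF : ProperFilter F)
    (a : T -> R) (c N : R) : a x @[x --> F] --> (0 : R) ->
  (\forall x \near F, c <= a x * N) -> c <= 0.
Proof.
move=> a0 ca; have aN : a x * N @[x --> F] --> (0 : R).
  by rewrite -(mul0r N); apply: cvgMl; exact: a0.
exact: (ler_cvg_to (f := cst c) (cvg_cst c) aN ca).
Qed.

(** Norm convergence implies weak convergence. Square integrability of [w s] is required only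
    eventually, since the curves are controlled only at times in an open interval. *)
Lemma ipv_cvg0 (R : realType) (T : Type) (F : set_system T) (FF : Filter F)
    n p (m : {measure set 'rV[R]_n -> \bar R}) (D : set 'rV[R]_n)
    (w : T -> 'rV[R]_n -> 'rV[R]_p) psi : measurable D ->
  (\forall s \near F, L2v m D (w s)) -> L2v m D psi ->
  nrmv m D (w s) @[s --> F] --> (0 : R) ->
  ipv m D (w s) psi @[s --> F] --> (0 : R).
Proof.
move=> mD Lw Lpsi w0; pose N := \sum_i nrm m D (cmp psi i).
have le : \forall s \near F, - (nrmv m D (w s) * N) <= ipv m D (w s) psi <= nrmv m D (w s) * N.
  apply: filterS Lw => s Ls; rewrite -ler_norml.
  by apply: le_trans (ipv_cauchy_schwarz mD Ls Lpsi) _; rewrite mulr_sumr.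
have wN : nrmv m D (w s) * N @[s --> F] --> (0 : R).
  by rewrite -(mul0r N); apply: cvgMl; exact: w0.
apply: (squeeze_cvgr le) => //.
by rewrite -oppr0; apply: cvgN; exact: wN.
Qed.

(** * Mean of the divergence of the velocity, evolution of magnetic fluxes *)

Section Divergence.
Context (R : realType) (Om : set 'rV[R]_3).
Local Notation field := ('rV[R]_3 -> 'rV[R]_3).
Hypotheses (oOm : open Om) (Oo : (leb3 Om < +oo)%E).
Let mOm : measurable Om := open_measurable_rV oOm.

(** The derivatives of the approximating test functions have integral 0 and converge in $L^2$;
    Cauchy-Schwarz against the constant 1, which is square integrable on the bounded domain, passes
    this to the limit. *)
Lemma integral_wpd_H10 f i : H10 'mu3 Om f -> \int['mu3]_(x in Om) wpd 'mu3 Om i f x = 0.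
Proof.
move=> [[Lf exf] [phi [tphi _ /(_ i) phif]]].
have [Lg _] : is_wpd 'mu3 Om i f (wpd 'mu3 Om i f) by apply: xgetPex; exact: exf.
set g := wpd _ _ _ _ in Lg phif *.
have L1 : L2 'mu3 Om (fun=> 1) by exact: L2_cst.
have Lk k : L2 'mu3 Om (pd i (phi k) \- g).
  by apply: L2B => //; exact: testfun_L2 (testfun_pd i (tphi k)).
have E k : ip 'mu3 Om (pd i (phi k) \- g) (fun=> 1) = - \int['mu3]_(x in Om) g x.
  rewrite (ip_cst mOm Oo 1 (Lk k)) mul1r RintegralB//; last exact: L2_integrable.
    by rewrite (integral_pd_testfun i oOm Oo (tphi k)) sub0r.
  by apply: L2_integrable => //; exact: testfun_L2 (testfun_pd i (tphi k)).
apply/eqP; rewrite -normr_le0.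
apply: (le_cvg0 _ phif (N := nrm 'mu3 Om (fun=> 1))); apply: nearW => k.
rewrite -normrN -(E k) /nrm -sqrtrM ?ip_ge0// -sqrtr_sqr ler_sqrt.
  exact: ip_cauchy_schwarz.
by rewrite mulr_ge0 ?ip_ge0.
Qed.

Lemma ip_suml (I : Type) (r : seq I) (f : I -> 'rV[R]_3 -> R) g :
  (forall i, L2 'mu3 Om (f i)) -> L2 'mu3 Om g ->
  ip 'mu3 Om (fun x => \sum_(i <- r) f i x) g = \sum_(i <- r) ip 'mu3 Om (f i) g.
Proof.
move=> Lf Lg; elim: r => [|i r IH].
  by rewrite big_nil; under eq_fun do rewrite big_nil; rewrite ip0l.
rewrite big_cons -IH -ipDl//; last exact: L2_sum.
by congr ip; apply/funext => x; rewrite big_cons.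
Qed.

Lemma is_wdiv_H1 (u : field) : (forall i, H1 'mu3 Om (cmp u i)) ->
  is_wdiv 'mu3 Om u (fun x => \sum_i wpd 'mu3 Om i (cmp u i) x).
Proof.
move=> Hu.
have W i : is_wpd 'mu3 Om i (cmp u i) (wpd 'mu3 Om i (cmp u i)).
  by have [_ /(_ i)] := Hu i; exact: xgetPex.
have LW i : L2 'mu3 Om (wpd 'mu3 Om i (cmp u i)) by case: (W i).
split; first exact: L2_sum.
move=> phi tphi; have Lphi := testfun_L2 mOm Oo tphi.
rewrite ipv_ipE//; first last.
- exact: testvec_L2v (testvec_grad tphi).
- by move=> i; case: (Hu i).
rewrite ip_suml// -sumrN; apply: eq_bigr => i _.
by rewrite cmp_grad; case: (W i) => _; apply.
Qed.

Lemma is_wdiv_H10_mean0 (u : field) d : (forall i, H10 'mu3 Om (cmp u i)) ->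
  is_wdiv 'mu3 Om u d -> \int['mu3]_(x in Om) d x = 0.
Proof.
move=> Hu ud; have H1u i : H1 'mu3 Om (cmp u i) by case: (Hu i).
have W := is_wdiv_H1 H1u.
have LW i : L2 'mu3 Om (wpd 'mu3 Om i (cmp u i)).
  have [_ /(_ i) ex] := H1u i.
  by have [] : is_wpd 'mu3 Om i (cmp u i) (wpd 'mu3 Om i (cmp u i)) by exact: xgetPex.
have L1 : L2 'mu3 Om (fun=> 1) by exact: L2_cst.
have [Ld _] := ud.
rewrite -[LHS]mul1r -(ip_cst mOm Oo 1 Ld) (ip_aeeq _ (wdiv_unique oOm Oo ud W)).
rewrite ip_suml// big1// => i _; rewrite (ip_cst mOm Oo 1 (LW i)).
by rewrite integral_wpd_H10// mulr0.
Qed.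

Lemma wdiv_Qh (M : mesh R) (u : field) : mesh_of Om M -> Wh Om M u -> Qh Om M (wdiv 'mu3 Om u).
Proof.
move=> HM [Hu Ku]; have H1u i : H1 'mu3 Om (cmp u i) by case: (Hu i).
have W : is_wdiv 'mu3 Om u (wdiv 'mu3 Om u) by apply: wdivP; eexists; exact: is_wdiv_H1 H1u.
split; first by split; [case: W|exact: is_wdiv_H10_mean0 W].
move=> k; have wK := wf_mesh HM k; have [_ _ _ [c [pc uc]] _] := Ku k.
(* The constant divergence given by the local velocity space and the restriction of the global
   divergence are weak divergences of the same field. *)
exists c; split => //; apply: (wdiv_unique (open_phset wK) (phset_lty wK) _ uc).
exact: (is_wdiv_sub (measurable_phset wK) mOm (@mshel_sub _ _ _ HM k) W).
Qed.

Lemma wdiv_eq0 (M : mesh R) (u : field) : mesh_of Om M -> Wh Om M u ->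
  (forall q, Qh Om M q -> bform Om u q = 0) -> aeeq 'mu3 Om (wdiv 'mu3 Om u) (fun=> 0).
Proof.
move=> HM Wu /(_ _ (wdiv_Qh HM Wu)) /eqP; rewrite oppr_eq0 => /eqP.
by apply: (ip_eq0 mOm); case: (wdiv_Qh HM Wu) => -[].
Qed.

(** Pairing with a fixed gradient is a continuous linear functional on $L^2$, so it commutes with
    the time derivative. *)
Lemma flux_derive (B : R -> field) (Bt : field) (T t : R) phi : 0 < t < T ->
  (forall s, 0 < s < T -> L2v 'mu3 Om (B s)) -> L2v 'mu3 Om Bt ->
  time_derivative Om B t Bt -> testfun Om phi ->
  is_derive t (1 : R) (fun s => ipv 'mu3 Om (B s) (grad phi)) (ipv 'mu3 Om Bt (grad phi)).
Proof.
move=> /andP[t0 tT] LB LBt dB tphi.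
have Lgrad : L2v 'mu3 Om (grad phi) by exact: testvec_L2v (testvec_grad tphi).
set b := fun s => _; set b' := ipv _ _ _ _.
have LBt' : L2v 'mu3 Om (B t) by apply: LB; rewrite t0 tT.
have lin s a : L2v 'mu3 Om (B s) ->
  L2v 'mu3 Om (fun x => a *: (B s x - B t x) - Bt x) /\
  ipv 'mu3 Om (fun x => a *: (B s x - B t x) - Bt x) (grad phi) = a * (b s - b t) - b'.
  move=> Ls.
  have E : (fun x => a *: (B s x - B t x) - Bt x) =
      (fun x => a *: ((fun x => (-1) *: B t x) \+ B s) x) \+ (fun x => (-1) *: Bt x).
    by apply/funext => x /=; rewrite !scaleN1r addrC [- B t x + _]addrC addrC.
  have L1 := L2vZ (-1) mOm LBt'; have L2 := L2vD mOm L1 Ls.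
  have L3 := L2vZ a mOm L2; have L4 := L2vZ (-1) mOm LBt.
  rewrite E; split; first exact: L2vD.
  rewrite (ipvDl mOm L3 L4 Lgrad) (ipvZl a mOm L2 Lgrad) (ipvDl mOm L1 Ls Lgrad).
  rewrite (ipvZl (-1) mOm LBt' Lgrad) (ipvZl (-1) mOm LBt Lgrad).
  by rewrite -/(b t) -/(b s) -/b'; ring.
(* The pairing splits linearly only where [B (t + s)] is square integrable, which is known for times
   in the open interval. *)
have near0T : \forall s \near (0:R)^', 0 < t + s < T.
  have : \forall s \near (0 : R), 0 < t + s < T.
    have P1 : \forall s \near (0 : R), - t < s by apply: lt_nbhsr; rewrite oppr_lt0.
    have P2 : \forall s \near (0 : R), s < T - t by apply: lt_nbhsl; rewrite subr_gt0.
    by apply: filterS2 P1 P2 => s; rewrite -subr_gt0 opprK addrC ltrBrDl => -> ->.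
  by move=> H; apply: nbhs_dnbhs.
have c0 : (s^-1 * (b (t + s) - b t) - b') @[s --> (0 : R)^'] --> (0 : R).
  have Lw : \forall s \near (0:R)^', L2v 'mu3 Om (fun x => s^-1 *: (B (t + s) x - B t x) - Bt x).
    by apply: filterS near0T => s /LB /(lin _ s^-1)[].
  have := ipv_cvg0 (dnbhs_filter _) mOm Lw Lgrad dB.
  apply: cvg_trans; apply: near_eq_cvg; apply: filterS near0T => s /LB /(lin _ s^-1)[_ ->].
  by [].
have c1 : (s^-1 *: ((b \o shift t) (s *: 1) - b t)) @[s --> (0 : R)^'] --> b'.
  rewrite -[b'](add0r b').
  rewrite (_ : (fun s => _) = (fun s => s^-1 * (b (t + s) - b t) - b') \+ cst b').
    by apply: cvgD; [exact: c0|exact: cvg_cst].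
  apply/funext => s /=; rewrite subrK.
  by have -> : s *: (1 : R) + t = t + s by rewrite [_ *: _]mulr1 addrC.
apply: DeriveDef; first by apply/cvg_ex; exists b'.
exact: cvg_lim c1.
Qed.

(** The mean value theorem makes [b] constant on the open interval, and its right limit at 0 fixes
    the constant. *)
Lemma flux_zero (b : R -> R) (T : R) : (forall t, 0 < t < T -> is_derive t (1 : R) b 0) ->
  b s @[s --> (0:R)^'+] --> (0 : R) -> forall t, 0 < t < T -> b t = 0.
Proof.
move=> db b0 t /andP[t0 tT].
have cst_b s : 0 < s < t -> b s = b t.
  move=> /andP[s0 st].
  have dst x : s <= x <= t -> is_derive x (1 : R) b 0.
    by move=> /andP[sx xt]; apply: db; rewrite (lt_le_trans s0 sx) (le_lt_trans xt tT).
  have [x||x _ /eqP] := MVT (f := b) (df := cst 0) st.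
  - by rewrite in_itv /= => /andP[sx xt]; apply: dst; rewrite !ltW.
  - apply/continuous_in_subspaceT => x; rewrite inE /= in_itv /= => sxt.
    by apply/differentiable_continuous/derivable1_diffP; case: (dst _ sxt).
  - by rewrite mul0r subr_eq0 => /eqP.
have : b s @[s --> (0:R)^'+] --> b t.
  have : (fun=> b t) s @[s --> (0:R)^'+] --> b t by exact: cvg_cst.
  apply: cvg_trans; apply: near_eq_cvg.
  have P1 : \forall s \near (0:R)^'+, 0 < s by exact: nbhs_right_gt.
  have P2 : \forall s \near (0:R)^'+, s < t by exact: nbhs_right_lt.
  by apply: filterS2 P1 P2 => s s0 st; rewrite cst_b// s0.
by move=> bt; apply: (cvg_unique _ bt b0).
Qed.

Lemma wdiv_evolution (B Bt : R -> field) (B0 : field) (T : R) :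
  (forall t, 0 < t < T -> L2v 'mu3 Om (B t)) ->
  (forall t, 0 < t < T -> is_wdiv 'mu3 Om (Bt t) (fun=> 0)) ->
  (forall t, 0 < t < T -> L2v 'mu3 Om (Bt t)) ->
  (forall t, 0 < t < T -> time_derivative Om B t (Bt t)) ->
  L2v 'mu3 Om B0 -> initial_value Om B B0 -> is_wdiv 'mu3 Om B0 (fun=> 0) ->
  forall t, 0 <= t < T -> is_wdiv 'mu3 Om (B t) (fun=> 0).
Proof.
move=> LB dBt LBt dB LB0 [B00 B0c] d0 t /andP[t0 tT].
(* At time 0 the initial condition identifies [B 0] with [B0] almost everywhere; the evolution
   equation speaks only of positive times. *)
have [t0'|t0'] := eqVneq t 0.
  by rewrite t0'; apply: is_wdiv_aeeq d0; apply: filterS B00 => x H Dx; rewrite H.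
have {t0 t0'}t0 : 0 < t by rewrite lt_neqAle eq_sym t0'.
split; first exact: L2_cst.
move=> phi tphi; rewrite ip0l// oppr0.
have Lgrad : L2v 'mu3 Om (grad phi) by exact: testvec_L2v (testvec_grad tphi).
apply: (flux_zero (b := fun s => ipv 'mu3 Om (B s) (grad phi)) (T := T)); last by rewrite t0 tT.
  move=> s s0T; have := flux_derive s0T LB (LBt _ s0T) (dB _ s0T) tphi.
  by have [_ ->//] := dBt _ s0T; rewrite ip0l// oppr0.
have P1 : \forall s \near (0:R)^'+, 0 < s < T.
  have P1 : \forall s \near (0:R)^'+, 0 < s by exact: nbhs_right_gt.
  have P2 : \forall s \near (0:R)^'+, s < T by apply: nbhs_right_lt; exact: lt_trans tT.
  by apply: filterS2 P1 P2 => s -> ->.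
have E s : B s \- B0 = fun x => (-1) *: B0 x + B s x.
  by apply/funext => x /=; rewrite scaleN1r addrC.
have L1 := L2vZ (-1) mOm LB0.
have Lw : \forall s \near (0:R)^'+, L2v 'mu3 Om (B s \- B0).
  by apply: filterS P1 => s /LB Ls; rewrite E; exact: L2vD.
have := ipv_cvg0 (at_right_proper_filter _) mOm Lw Lgrad B0c.
apply: cvg_trans; apply: near_eq_cvg; apply: filterS P1 => s /LB Ls.
rewrite E (ipvDl mOm L1 Ls Lgrad) (ipvZl (-1) mOm LB0 Lgrad).
by have [_ ->//] := d0; rewrite ip0l// oppr0 mulr0 add0r.
Qed.

End Divergence.

Theorem mainTheorem3 (R : realType) (Om : set 'rV[R]_3)
  (HOm : lipschitz_polyhedral_domain Om)
  (T Re Rem : R) (HT : 0 < T) (HRe : 0 < Re) (HRem : 0 < Rem)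
  (I : Type) (Th : I -> mesh R)
  (HTh : forall h, mesh_of Om (Th h))
  (Hreg : exists gamma : R, 0 < gamma < 1 /\ forall h, regular_mesh gamma (Th h))
  (S : forall h, stab R (mshn (Th h)))
  (HS : admissible_stab S)
  (f : R -> 'rV[R]_3 -> 'rV[R]_3)
  (Hf : forall t, 0 < t < T -> L2v (@leb3 R) Om (f t))
  (h : I)
  (u0 B0 : 'rV[R]_3 -> 'rV[R]_3)
  (Hu0 : Wh Om (Th h) u0) (HB0 : Vface Om (Th h) B0)
  (u ut E B Bt : R -> 'rV[R]_3 -> 'rV[R]_3) (p : R -> 'rV[R]_3 -> R)
  (Hsol : is_solution Om (S h) T Re Rem f u0 B0 u ut E B Bt p) :
  (forall t, 0 < t < T ->
     aeeq (@leb3 R) Om (fun x => Bt t x + wcurl Om (E t) x) (fun=> 0) /\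
     aeeq (@leb3 R) Om (wdiv (@leb3 R) Om (u t)) (fun=> 0)) /\
  (aeeq (@leb3 R) Om (wdiv (@leb3 R) Om B0) (fun=> 0) ->
     forall t, 0 <= t < T -> aeeq (@leb3 R) Om (wdiv (@leb3 R) Om (B t)) (fun=> 0)).
Proof.
have HM := HTh h.
have oOm := open_Om HOm; have mOm := measurable_Om HOm; have Oo := Om_lty HOm.
case: Hsol => HV HT' HS' [_ HB].
have HSf : exists lo hi : R, [/\ 0 < lo, 0 < hi & forall k : 'I_(mshn (Th h)), let K := mshel k in
    symmetric_bilinear_on (VfaceK K) (Sface (S h) k) /\
    forall v, VfaceK K v -> (forall x, Pi0 0 K v x = 0) ->
      lo * sqn0 K v <= Sface (S h) k v v <= hi * sqn0 K v].
  case: HS => _ _ _ [lo [hi [lo0 hi0 H]]].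
  by exists lo, hi; split => // k; exact: (H h k).
have dE t : 0 < t < T -> is_wdiv (@leb3 R) Om (wcurl Om (E t)) (fun=> 0).
  move=> /HV[_ _ [[_ exw _] _] _].
  exact: (wcurl_div0 mOm Oo (wcurlP exw)).
have faraday t : 0 < t < T -> aeeq (@leb3 R) Om (fun x => Bt t x + wcurl Om (E t) x) (fun=> 0).
  move=> tT; have [_ _ VE _] := HV _ tT; have [_ _ VBt _] := HT' _ tT.
  have [_ _ Hf3 _] := HS' _ tT.
  have VcE := Vface_wcurl HOm HM VE.
  have VC := Vface_lin HOm HM 1 VBt VcE.
  have := vemprod_face_eq0 HM HSf (proj2 VBt) (proj2 VcE) (Hf3 _ VC).
  by apply: filterS => x H Dx; rewrite -[RHS](H Dx) scale1r.
split=> [t tT|dB0 t tT].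
  split; first exact: faraday.
  have [Wu _ _ _] := HV _ tT; have [_ _ _ Hf4] := HS' _ tT.
  exact: (wdiv_eq0 oOm Oo HM Wu Hf4).
have LV v : Vface Om (Th h) v -> L2v (@leb3 R) Om v by case=> -[].
have d0 : is_wdiv (@leb3 R) Om B0 (fun=> 0).
  case: HB0 => -[_ exd _] _; have [Ld dP] := wdivP exd.
  split=> [|phi tphi]; first exact: L2_cst.
  by rewrite dP// (ip_aeeq _ dB0).
have W : is_wdiv (@leb3 R) Om (B t) (fun=> 0).
  apply: (@wdiv_evolution R Om oOm Oo B Bt B0 T) tT => // [s sT|s sT|s sT|s sT|].
  - by apply: LV; case: (HV _ sT).
  - have [_ _ VE _] := HV _ sT; have LcE := LV _ (Vface_wcurl HOm HM VE).
    (* By the first claim [Bt s] is the opposite of [wcurl Om (E s)] almost everywhere, and a weak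
       curl has zero divergence. *)
    apply: (is_wdiv_aeeq (v := fun x => (-1) *: wcurl Om (E s) x)).
      apply: filterS (faraday _ sT) => x H Dx.
      by rewrite scaleN1r; apply/esym/eqP; rewrite -addr_eq0 H.
    split=> [|phi tphi]; first exact: L2_cst.
    have Lgrad : L2v (@leb3 R) Om (grad phi) by exact: testvec_L2v (testvec_grad tphi).
    rewrite (ipvZl (-1) mOm LcE Lgrad).
    by have [_ ->//] := dE _ sT; rewrite ip0l// oppr0 mulr0.
  - by apply: LV; case: (HT' _ sT).
  - by case: (HT' _ sT).
  - exact: LV HB0.
apply: (wdiv_unique oOm Oo _ W); apply: wdivP; exists (fun=> 0); exact: W.
Qed.
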